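(* Let $\xi_0,\xi_1,\xi_2,\dots$ be a stationary Markov chain on a Polish space $\mathcal X$ with stationary distribution $\mu$, let $\ell\ge 1$, and let $F:\mathcal X^\ell\to\mathbb R$ be a Borel function with $\int F^2\,d\mu^\ell<\infty$ and $\int F\,d\mu^\ell=0$. Suppose that for some $\alpha>0$ the $\psi$-mixing coefficient satisfies $\psi(m)\le\alpha^{-1}e^{-\alpha m}$ for all $m\ge1$. Put $S_N=\sum_{n=1}^N F(\xi_n,\xi_{2n},\dots,\xi_{\ell n})$ and $\sigma_N^2=\mathrm{var}\,S_N=E(S_N-ES_N)^2$. (i) The limit $$\sigma^2=\lim_{N\to\infty}\frac1N\sigma_N^2=\lim_{N\to\infty}\frac1N ES_N^2$$ exists. (ii) Let $\{\xi^{(1)}_n\},\{\xi_n^{(2)}\},\dots,\{\xi_n^{(\ell)}\}$ be $\ell$ independent copies of the stationary Markov chain $\{\xi_n\}$ with initial distribution $\mu$, and set $U_{\ell,N}=\sum_{n=1}^N F_\ell(\xi_n^{(1)},\xi_{2n}^{(2)},\dots,\xi_{\ell n}^{(\ell)})$. Then the limit $$s_\ell^2=\lim_{N\to\infty}\frac1N\mathrm{var}\,U_{\ell,N}=\lim_{N\to\infty}\frac1N EU_{\ell,N}^2$$ exists and $$\sigma^2\ge\frac1{2\ell}s_\ell^2.$$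
   Context: The chain is defined on a probability space $(\Omega,\mathcal F,P)$ and $\xi_0$ has distribution $\mu$; $\mu^k=\mu\times\cdots\times\mu$ ($k$ times). $\psi$-mixing coefficient: with $\mathcal F_n=\sigma\{\xi_j:\,j\le n\}$ and $\mathcal F^m=\sigma\{\xi_j:\,j\ge m\}$, $$\psi(m)=\sup\Big\{\Big|\frac{P(\Gamma\cap\Psi)}{P(\Gamma)P(\Psi)}-1\Big|:\ n\ge 0,\ \Gamma\in\mathcal F_n,\ \Psi\in\mathcal F^{n+m},\ P(\Gamma),P(\Psi)>0\Big\}.$$ The function $F_\ell$ is $$F_\ell(x_1,\dots,x_\ell)=F(x_1,\dots,x_\ell)-\int F(x_1,\dots,x_\ell)\,d\mu(x_\ell).$$ *)

(* Defs.v *)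
From HB Require Import structures.
From mathcomp Require Import all_boot all_order all_algebra.
From mathcomp Require Import all_classical all_reals all_analysis.

Set Implicit Arguments.
Unset Strict Implicit.
Unset Printing Implicit Defensive.

Import Order.TTheory GRing.Theory Num.Theory.
Import numFieldNormedType.Exports.

Local Open Scope classical_set_scope.
Local Open Scope ring_scope.

Definition homeomorphism (T U : topologicalType) (f : T -> U) : Prop :=
  bijective f /\ forall V : set U, open (f @^-1` V) <-> open V.

Definition separable (T : topologicalType) : Prop :=
  exists2 D : set T, countable D & dense D.

(* The complete metric is not part of the structure of a Polish space: it is
   only required to exist. *)
Definition polish (R : realType) (T : topologicalType) : Prop :=
  separable T /\
  exists M : metricType R,
    (forall G : set_system M, ProperFilter G -> cauchy G ->
      exists x : M, G --> x) /\
    exists f : T -> M, homeomorphism f.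

Notation borel X := (g_sigma_algebraType (@open X)).

Section product_power.
Context d (X : measurableType d) (R : realType) (mu : probability X R).

Definition cons_pair n (x : X * n.-tuple X) : n.+1.-tuple X :=
  [the n.+1.-tuple X of x.1 :: x.2].

Lemma measurable_cons_pair n : measurable_fun setT (@cons_pair n).
Proof. exact: measurable_cons. Qed.

HB.instance Definition _ n :=
  isMeasurableFun.Build _ _ _ _ (@cons_pair n) (@measurable_cons_pair n).

(* [n.-tuple X] carries the product sigma-algebra, which is the Borel one when
   [X] is a second countable space with its Borel sigma-algebra. *)
Fixpoint product_power n : probability (n.-tuple X) R :=
  if n is n'.+1 then
    distribution (mu \x product_power n')%E (@cons_pair n')
  else \d_([tuple] : 0.-tuple X).

End product_power.

Section processes.
Context d (Omega : measurableType d) d' (X : measurableType d') (R : realType).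
Implicit Types (P : probability Omega R) (xi : nat -> Omega -> X).

Definition sigma_process xi (J : set nat) : set_system Omega :=
  <<s \bigcup_(j in J) preimage_set_system setT (xi j) measurable >>.

(* The last field says that [p (xi n _) A] is a version of the conditional
   probability of [xi n.+1 \in A] given the past up to time [n]. *)
Record stationary_markov_chain P (xi : nat -> {RV P >-> X})
    (p : R.-pker X ~> X) (mu : probability X R) : Prop := {
  initial_distribution :
    forall A, measurable A -> distribution P (xi 0) A = mu A ;
  stationary_distribution :
    forall A, measurable A -> (\int[mu]_x p x A)%E = mu A ;
  markov_property :
    forall n G A, sigma_process xi [set j | (j <= n)%N] G -> measurable A ->
      P (G `&` xi n.+1 @^-1` A) = (\int[P]_(w in G) p (xi n w) A)%E }.

Definition psi_mixing P xi (m : nat) : \bar R :=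
  ereal_sup [set r | exists n G H,
    [/\ sigma_process xi [set j | (j <= n)%N] G,
        sigma_process xi [set j | (n + m <= j)%N] H,
        (0 < P G)%E, (0 < P H)%E &
        r = `|fine (P (G `&` H)) / (fine (P G) * fine (P H)) - 1|%:E]].

Definition independent_processes P k (eta : 'I_k -> nat -> Omega -> X) : Prop :=
  forall (J : {set 'I_k}) (E : 'I_k -> set Omega),
    (forall i, i \in J -> sigma_process (eta i) setT (E i)) ->
    P (\bigcap_(i in [set` J]) E i) = (\prod_(i in J) P (E i))%E.

End processes.

(* Equality of all finite-dimensional distributions. *)
Definition same_law d (Omega : measurableType d) d0 (Omega0 : measurableType d0)
    d' (X : measurableType d') (R : realType)
    (P : probability Omega R) (xi : nat -> Omega -> X)
    (P0 : probability Omega0 R) (eta : nat -> Omega0 -> X) : Prop :=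
  forall n (A : set (n.-tuple X)), measurable A ->
    P ((fun w => [tuple xi i w | i < n]) @^-1` A) =
    P0 ((fun w => [tuple eta i w | i < n]) @^-1` A).

Section nonconventional_sums.
Context d (Omega : measurableType d) d' (X : measurableType d') (R : realType).
Context (l : nat).

(* Coordinates are numbered from [0], so coordinate [i : 'I_l] is read at time
   [i.+1 * n]. *)
Definition nonconventional_sum (F : l.-tuple X -> R) (xi : nat -> Omega -> X)
    (N : nat) (w : Omega) : R :=
  \sum_(1 <= n < N.+1) F [tuple xi (i.+1 * n)%N w | i < l].

Definition decoupled_sum (F : l.-tuple X -> R)
    (eta : 'I_l -> nat -> Omega -> X) (N : nat) (w : Omega) : R :=
  \sum_(1 <= n < N.+1) F [tuple eta i (i.+1 * n)%N w | i < l].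

Definition set_last (x : l.-tuple X) (y : X) : l.-tuple X :=
  [tuple if val i == l.-1 then y else tnth x i | i < l].

Definition last_centered (mu : probability X R) (F : l.-tuple X -> R)
    (x : l.-tuple X) : R :=
  F x - \int[mu]_y F (set_last x y).

End nonconventional_sums.

(* Main.v *)
Require Import Defs.
From HB Require Import structures.
From mathcomp Require Import all_boot all_order all_algebra.
From mathcomp Require Import all_classical all_reals all_analysis.
From mathcomp Require Import measurable_realfun zify ring lra.

(** The variance of the sums is computed from covariance estimates for functions of
    finitely many states, and these are carried over to square integrable functions by
    density.

    Call [F] discretized when it only depends on the codes of its arguments under a
    measurable map [g] to a finite type, so that expectations are finite sums. Averaging
    out the coordinates one after the other writes a centered [F] as a sum of components
    [F_0, ..., F_(l-1)]: the component [F_i] depends on the coordinates up to [i] only, and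
    has mean zero in coordinate [i] when the others are fixed ([sum_component],
    [centered_component]). The last component is [last_centered mu F].

    Let [F_i(n)] be the value of [F_i] along the times [n, 2 n, ..., l n]. If
    [(i+1) n > (j+1) k], then in the product [F_i(n) F_j(k)] the variable at time [(i+1) n]
    comes after all the others. Psi-mixing has a relative error, so it compares the joint
    law with the one in which this variable is independent of the past, at the level of
    second moments; under the latter the product has mean zero. The outcome is a bound of
    the covariance by a constant times [th^|(i+1) n - (j+1) k| + th^(n+k)]
    ([component_covariance_bound]). Moreover, if [n] and [k] run along arithmetic
    progressions of index [t], the times involved separate into clusters according to their
    slope; the clusters become independent and each of them is stationary, so the covariance
    converges as [t] tends to infinity ([line_event_cvg], [covariance_line_cvg]).

    Existence of the limit. The increments of [N -> E S_N^2] are sums of covariances over a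
    row [n = N]. They concentrate around [k = (i+1) N / (j+1)], and along each residue class
    of [N] modulo [l!] the terms at a fixed offset from this centre converge. Hence the
    increments are asymptotically periodic and [E S_N^2 / N] converges ([row_sum_cvg],
    [box_sum_cvg]).

    Comparison. Let [B] be the sum of [F_(l-1)(n)] over [(l-1) t < n <= l t]. Its last times
    exceed [l (l-1) t], and no other component of [S_(l t)] is read after that time, so
    [B] is uncorrelated with these up to a bounded error
    ([cross_sum_bound]). From [0 <= E (S_(l t) - B)^2] it follows that [E S_(l t)^2] is at
    least [D_(l t) - D_((l-1) t)] minus a constant, where [D_N] is the second moment of the sum of
    [F_(l-1)(n)] for [n <= N]; thus [sigma^2 >= s^2 / l] with [s^2] the limit of [D_N / N]
    ([variance_lower_bound]). For independent copies the covariance of the last components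
    at lag [k] is exactly the limit, as [n] tends to infinity, of that of [F_(l-1)(n)] and
    [F_(l-1)(n+k)] ([covariance_decoupling], [copy_sum_variance]), so that
    [E U_N^2 / N] has the same limit [s^2] ([stationary_comparison]). Finally
    [s^2 / l >= s^2 / (2 l)] because [s^2 >= 0].

    Extension. The law of a sample is dominated by a multiple of the product measure, so
    for fixed [N] the sums are continuous in [F] for the mean square norm ([domination]).
    On centered discretized functions the second moment of the sums is at most a constant
    times [N] times the squared norm. Density of the discretized functions
    ([approximable_sqint]) then gives limits for all [F], continuous in [F]
    ([variance_limit]). The means of the sums remain bounded, so the variances and the second
    moments have the same limits. *)

Set Implicit Arguments.
Unset Strict Implicit.
Unset Printing Implicit Defensive.

Import Order.TTheory GRing.Theory Num.Theory.
Import numFieldNormedType.Exports.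

Local Open Scope classical_set_scope.
Local Open Scope ring_scope.

(** * Rectangles in a finite power *)

Section rectangles.
Context d (X : measurableType d).

Definition rect n (A : 'I_n -> set X) : set (n.-tuple X) :=
  [set x | forall i, A i (tnth x i)].

Lemma measurable_preimage_tnth n (i : 'I_n) (A : set X) : measurable A ->
  measurable [set x : n.-tuple X | A (tnth x i)].
Proof. by move=> mA; rewrite -[X in measurable X]setTI; exact: measurable_tnth. Qed.

Lemma measurable_rect n (A : 'I_n -> set X) :
  (forall i, measurable (A i)) -> measurable (rect A).
Proof.
move=> mA.
have -> : rect A = \bigcap_(i in [set: 'I_n]) [set x | A i (tnth x i)].
  by apply/seteqP; split => [x Ax i _|x Ax i]; [exact: Ax|exact: (Ax i I)].
apply: fin_bigcap_measurable => //.
by move=> i _; exact: measurable_preimage_tnth.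
Qed.

(** Rectangles are stable under intersection and generate the product sigma-algebra, so
    this is Dynkin's pi-lambda theorem. It identifies laws here, and in the density
    argument it shows that indicators can be approximated. *)
Lemma rect_ind n (Q : set (n.-tuple X) -> Prop) :
  (forall A : 'I_n -> set X, (forall i, measurable (A i)) -> Q (rect A)) ->
  (forall S, measurable S -> Q S -> Q (~` S)) ->
  (forall F : (set (n.-tuple X))^nat, (forall k, measurable (F k)) ->
    trivIset setT F -> (forall k, Q (F k)) -> Q (\bigcup_k F k)) ->
  forall S, measurable S -> Q S.
Proof.
move=> Qr QC QU S mS.
pose G : set (set (n.-tuple X)) :=
  [set B | exists2 A : 'I_n -> set X, (forall i, measurable (A i)) & B = rect A].
have rectT : rect (fun _ : 'I_n => [set: X]) = setT.
  by apply/seteqP; split => // x _ i.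
have GE : @measurable _ (n.-tuple X) = <<s G >>.
  apply/seteqP; split.
    apply: smallest_sub; first exact: smallest_sigma_algebra.
    move=> B /= BU.
    have : (\bigcup_(i in [set: 'I_n])
        preimage_set_system setT (fun x : n.-tuple X => tnth x i) measurable) B.
      rewrite -bigcup_seq in BU.
      by case: BU => i _ Bi; exists i.
    move=> [i _ [A mA <-]].
    apply: sub_gen_smallest; exists (fun j => if j == i then A else setT).
      by move=> j; case: ifP.
    rewrite setTI; apply/seteqP; split => x /=.
      by move=> Ax j; case: eqP => [->|].
    by move=> /(_ i); rewrite eqxx.
  apply: smallest_sub; first exact: sigma_algebra_measurable.
  by move=> _ [A mA ->]; exact: measurable_rect.
have GI : setI_closed G.
  move=> _ _ [A mA ->] [B mB ->]; exists (fun i => A i `&` B i).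
    by move=> i; exact: measurableI.
  apply/seteqP; split => x /=.
    by move=> [Ax Bx] i; split.
  by move=> ABx; split => i; case: (ABx i).
apply: (dynkin_induction GE GI) => //.
- by rewrite -rectT; exact: Qr.
- by move=> _ [A mA ->]; exact: Qr.
- by rewrite -GE.
Qed.

Lemma eq_rect_probability (R : realType) n (m1 m2 : probability (n.-tuple X) R) :
  (forall A : 'I_n -> set X, (forall i, measurable (A i)) ->
    m1 (rect A) = m2 (rect A)) ->
  forall S, measurable S -> m1 S = m2 S.
Proof.
move=> m12; apply: rect_ind => //.
- by move=> S mS e; rewrite !probability_setC// e.
- move=> F mF tF e.
  rewrite !measure_bigcup//.
  by apply: eq_eseriesr => k _; exact: e.
Qed.

(** The recursive product measure is only used through this formula, which determines it
    by [eq_rect_probability]. *)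
Lemma product_power_rect (R : realType) (mu : probability X R) n
    (A : 'I_n -> set X) : (forall i, measurable (A i)) ->
  product_power mu n (rect A) = (\prod_(i < n) mu (A i))%E.
Proof.
elim: n A => [|n IH] A mA.
  rewrite big_ord0 /= diracE.
  by rewrite mem_set// => -[].
rewrite big_ord_recl -(IH (fun i => A (lift ord0 i)))// /=.
rewrite /distribution /pushforward /=.
rewrite -product_measure1E//; last exact: measurable_rect.
congr (_ _); apply/seteqP; split => -[y x] /=.
  move=> H; split; first by have := H ord0.
  by move=> i; have := H (lift ord0 i); rewrite tnthS.
move=> [Ay Ax] i; case: (unliftP ord0 i) => [j|] -> //.
by rewrite tnthS.
Qed.

End rectangles.

(** * Stationarity and mixing *)

Section sigma_process_events.
Context d (Omega : measurableType d) d' (X : measurableType d').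
Implicit Types xi : nat -> Omega -> X.

(** The predicate [D] selects some of the constraints, so that one family of times and
    sets also describes its past part and its future part. *)
Definition event xi (K : finType) (D : pred K) (tm : K -> nat)
    (A : K -> set X) : set Omega :=
  [set w | forall i, D i -> A i (xi (tm i) w)].

Lemma sigma_process_preimage xi (J : set nat) j A : J j -> measurable A ->
  sigma_process xi J (xi j @^-1` A).
Proof.
move=> Jj mA; apply: sub_gen_smallest; exists j => //.
by exists A => //; rewrite setTI.
Qed.

Lemma sigma_process_event xi (J : set nat) (K : finType) (D : pred K)
    (tm : K -> nat) (A : K -> set X) :
  (forall i, D i -> J (tm i)) -> (forall i, measurable (A i)) ->
  sigma_process xi J (event xi D tm A).
Proof.
move=> DJ mA.
pose T' := g_sigma_algebraType
  (\bigcup_(j in J) preimage_set_system setT (xi j) measurable).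
have -> : event xi D tm A =
    \bigcap_(i in [set i | D i]) (xi (tm i) @^-1` A i) :> set T'.
  by apply/seteqP; split => w Dw i /=; exact: Dw.
apply: (@fin_bigcap_measurable _ T') => // i Di.
by apply: sigma_process_preimage => //; exact: DJ.
Qed.

Lemma sigma_process_measurable (xi : nat -> {mfun Omega >-> X}) (J : set nat) G :
  sigma_process xi J G -> measurable G.
Proof.
apply: smallest_sub; first exact: sigma_algebra_measurable.
move=> _ [j _ [A mA <-]]; rewrite setTI -[X in measurable X]setTI.
exact: measurable_funP.
Qed.

Lemma measurable_event (xi : nat -> {mfun Omega >-> X}) (K : finType)
    (D : pred K) (tm : K -> nat) (A : K -> set X) :
  (forall i, measurable (A i)) -> measurable (event xi D tm A).
Proof.
by move=> mA; apply: (@sigma_process_measurable xi setT);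
  exact: sigma_process_event.
Qed.

End sigma_process_events.

Section stationarity.
Context d (Omega : measurableType d) d' (X : measurableType d') (R : realType).
Variables (P : probability Omega R) (xi : nat -> {RV P >-> X}).
Variables (p : R.-pker X ~> X) (mu : probability X R).
Hypothesis mc : stationary_markov_chain xi p mu.

Lemma chain_law n A : measurable A -> P (xi n @^-1` A) = mu A.
Proof.
elim: n A => [|n IH] A mA; first exact: (initial_distribution mc).
have := markov_property mc (n := n) (G := setT) _ mA.
rewrite setTI => ->; last first.
  rewrite -setC0; apply: (@sigma_algebraC _ _); exact: sigma_algebra0.
rewrite -(stationary_distribution mc mA).
rewrite -(@ge0_integral_distribution _ _ _ _ _ P (xi n) (fun x => p x A))//; last first.
  exact: measurable_kernel.
by apply: eq_measure_integral => B mB _; exact: IH.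
Qed.

Definition block k n (w : Omega) : k.+1.-tuple X := [tuple xi (n + i) w | i < k.+1].

Lemma measurable_block k n : measurable_fun setT (block k n).
Proof.
apply/measurable_fun_tnthP => i.
rewrite (_ : _ \o _ = xi (n + i)) //.
by apply/funext => w /=; rewrite tnth_mktuple.
Qed.

HB.instance Definition _ k n :=
  isMeasurableFun.Build _ _ _ _ (block k n) (@measurable_block k n).

(** Induction on the length: the Markov property turns the law of a block of length k+2
    into the integral of a fixed function against the law of the block of length k+1,
    which is already known to be independent of the starting time. *)
Lemma block_law k n S : measurable S ->
  P (block k n @^-1` S) = P (block k 0 @^-1` S).
Proof.
elim: k n S => [|k IH] n S mS.
  apply: (@eq_rect_probability _ _ _ _
    (distribution P (block 0 n)) (distribution P (block 0 0))) => // A mA.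
  have E m : distribution P (block 0 m) (rect A) = P (xi m @^-1` A ord0).
    congr (P _); apply/seteqP; split => w /=.
      by move=> /(_ ord0); rewrite /= tnth_mktuple addn0.
    by move=> Aw i; rewrite (ord1 i) tnth_mktuple addn0.
  etransitivity; first exact: (E n).
  by etransitivity; last exact: (esym (E 0)); rewrite !chain_law.
apply: (@eq_rect_probability _ _ _ _
  (distribution P (block k.+1 n)) (distribution P (block k.+1 0))) => // A mA.
pose A' (i : 'I_k.+1) := A (widen_ord (leqnSn _) i).
have mA' : forall i, measurable (A' i) by move=> i; exact: mA.
pose h (x : k.+1.-tuple X) : \bar R :=
  ((\1_(rect A') x)%:E * p (tnth x ord_max) (A ord_max))%E.
have mh : measurable_fun [set: k.+1.-tuple X] h.
  apply: emeasurable_funM.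
    by apply/measurable_EFinP; apply: measurable_indic; exact: measurable_rect.
  apply: (@measurableT_comp _ _ _ _ _ _ (fun x => p x (A ord_max))).
    exact: measurable_kernel.
  exact: measurable_tnth.
have h0 x : (0 <= h x)%E by rewrite mule_ge0 ?lee_fin.
have E m : distribution P (block k.+1 m) (rect A) =
    (\int[distribution P (block k m)]_x h x)%E.
  rewrite ge0_integral_distribution// /distribution /pushforward.
  have -> : block k.+1 m @^-1` rect A =
      (block k m @^-1` rect A') `&` xi (m + k).+1 @^-1` A ord_max.
    apply/seteqP; split => w /=.
      move=> H; split => [i|].
        by have := H (widen_ord (leqnSn _) i); rewrite !tnth_mktuple.
      by have := H ord_max; rewrite !tnth_mktuple /= addnS.
    move=> [H1 H2] i; rewrite tnth_mktuple.
    have [ik|ki] := ltnP i k.+1.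
      have := H1 (Ordinal ik); rewrite tnth_mktuple /A' /=.
      by congr (A _ _); apply: val_inj.
    have -> : i = ord_max by apply/val_inj/eqP; rewrite eqn_leq ki -ltnS ltn_ord.
    by rewrite /= addnS.
  rewrite (markov_property mc (n := m + k)) //; last first.
    have -> : block k m @^-1` rect A' =
        event xi predT (fun i : 'I_k.+1 => (m + i)%N) A'.
      apply/seteqP; split => w H i; have := H i; rewrite ?tnth_mktuple//.
      by apply.
    by apply: sigma_process_event => // i _ /=; rewrite leq_add2l -ltnS.
  rewrite integral_mkcond; apply: eq_integral => w _ /=.
  rewrite /h patchE indicE tnth_mktuple /=.
  have -> : (block k m w \in rect A') = (w \in block k m @^-1` rect A').
    by apply/idP/idP; rewrite !inE.
  by case: ifP => _ /=; rewrite ?mul1e ?mul0e.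
etransitivity; first exact: (E n).
etransitivity; last exact: (esym (E 0)).
by apply: eq_measure_integral => B mB _; exact: IH.
Qed.

Lemma event_shift n (K : finType) (D : pred K) (c : K -> nat) (A : K -> set X) :
  (forall i, measurable (A i)) ->
  P (event xi D (fun i => n + c i)%N A) = P (event xi D c A).
Proof.
move=> mA; pose k := \max_i c i.
pose S : set (k.+1.-tuple X) :=
  [set x | forall i, D i -> A i (tnth x (inord (c i)))].
have mS : measurable S.
  have -> : S = \bigcap_(i in [set i | D i]) [set x | A i (tnth x (inord (c i)))].
    by apply/seteqP; split => w Dw i /=; exact: Dw.
  by apply: fin_bigcap_measurable => // i _; exact: measurable_preimage_tnth.
have E m : event xi D (fun i => m + c i)%N A = block k m @^-1` S.
  by apply/seteqP; split => w H i Di; have := H i Di;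
    rewrite tnth_mktuple inordK// ltnS leq_bigmax.
have E0 : event xi D c A = event xi D (fun i => 0 + c i)%N A by [].
by rewrite E0 !E block_law.
Qed.

End stationarity.

Section mixing.
Context d (Omega : measurableType d) d' (X : measurableType d') (R : realType).

(** Everything that the variance estimates need from the chain. The mixing inequality is
    the product form of the psi-mixing bound, so that it also holds for null events; its
    error is relative to the product of the probabilities, which is what makes mean
    square bounds possible without higher moments. *)
Record mixing_process (P : probability Omega R) (xi : nat -> {RV P >-> X})
    (mu : probability X R) (rho : nat -> R) : Prop := {
  process_law : forall n A, measurable A -> P (xi n @^-1` A) = mu A ;
  process_shift : forall n (K : finType) (D : pred K) (c : K -> nat)
    (A : K -> set X), (forall i, measurable (A i)) ->
    P (event xi D (fun i => n + c i)%N A) = P (event xi D c A) ;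
  process_mixing : forall n m G H, (1 <= m)%N ->
    sigma_process xi [set j | (j <= n)%N] G ->
    sigma_process xi [set j | (n + m <= j)%N] H ->
    `|fine (P (G `&` H)) - fine (P G) * fine (P H)|
      <= rho m * (fine (P G) * fine (P H)) }.

Lemma markov_mixing_process (P : probability Omega R) (xi : nat -> {RV P >-> X})
    (p : R.-pker X ~> X) (mu : probability X R) (rho : nat -> R) :
  stationary_markov_chain xi p mu ->
  (forall m, (1 <= m)%N -> (psi_mixing P xi m <= (rho m)%:E)%E) ->
  mixing_process xi mu rho.
Proof.
move=> mc rhoP; split.
- by move=> n A mA; exact: (chain_law mc).
- by move=> n K D c A mA; exact: (event_shift mc).
move=> n m G H m1 sG sH.
have mG := sigma_process_measurable sG; have mH := sigma_process_measurable sH.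
have fG : P G \is a fin_num by exact: fin_num_measure.
have fH : P H \is a fin_num by exact: fin_num_measure.
have [G0|G0] := eqVneq (P G) 0%E.
  have -> : P (G `&` H) = 0%E.
    by apply: (subset_measure0 (mu := P)) _ _ _ G0 => //; exact: measurableI.
  by rewrite G0 /= mul0r subrr normr0 mulr0.
have [H0|H0] := eqVneq (P H) 0%E.
  have -> : P (G `&` H) = 0%E.
    by apply: (subset_measure0 (mu := P)) _ _ _ H0 => //; exact: measurableI.
  by rewrite H0 /= !mulr0 subrr normr0.
have PG : (0 < P G)%E by rewrite lt_def G0 measure_ge0.
have PH : (0 < P H)%E by rewrite lt_def H0 measure_ge0.
have g0 : 0 < fine (P G) by rewrite fine_gt0// PG ltey_eq fG.
have h0 : 0 < fine (P H) by rewrite fine_gt0// PH ltey_eq fH.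
have gh0 : 0 < fine (P G) * fine (P H) by exact: mulr_gt0.
have : (`|fine (P (G `&` H)) / (fine (P G) * fine (P H)) - 1|%:E <= (rho m)%:E)%E.
  apply: le_trans (rhoP m m1); apply: ereal_sup_ubound.
  by exists n, G, H.
rewrite lee_fin => le.
rewrite -{1}[fine (P G) * fine (P H)]mul1r.
rewrite -[fine (P (G `&` H))](divfK (lt0r_neq0 gh0)).
by rewrite -mulrBl normrM (gtr0_norm gh0) ler_pM2r.
Qed.

End mixing.

(** * Asymptotic independence along diverging progressions *)

Section asymptotic_independence.
Context d (Omega : measurableType d) d' (X : measurableType d') (R : realType).
Variables (P : probability Omega R) (xi : nat -> {RV P >-> X}).
Variables (mu : probability X R) (rho : nat -> R).
Hypothesis mp : mixing_process xi mu rho.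
Hypothesis rho0 : rho @ \oo --> (0 : R).

Local Notation pr A := (fine (P A)).

Lemma pr_ge0 (A : set Omega) : 0 <= pr A.
Proof. by rewrite fine_ge0. Qed.

Lemma pr_le1 (A : set Omega) : measurable A -> pr A <= 1.
Proof.
by move=> mA; rewrite -[leRHS]/(fine 1%:E) fine_le// ?fin_num_measure// probability_le1.
Qed.

Section lines.
Variables (K : finType) (sl c : K -> nat) (A : K -> set X).
Hypothesis mA : forall i, measurable (A i).

Let ev s t := event xi (fun i => sl i < s)%N (fun i => sl i * t + c i)%N A.
Let cl s t := event xi (fun i => sl i == s) (fun i => sl i * t + c i)%N A.

Let cl_cst s t : P (cl s t) = P (event xi (fun i => sl i == s) c A).
Proof.
rewrite -(process_shift mp (s * t)) //; congr (P _).
by apply/seteqP; split => w H i /eqP sli; have := H i; rewrite sli eqxx; apply.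
Qed.

Let evS s t : ev s.+1 t = ev s t `&` cl s t.
Proof.
apply/seteqP; split => w.
  move=> H; split => i Di; apply: H => /=; first exact: leqW.
  by rewrite (eqP Di).
move=> [H1 H2] i; rewrite ltnS leq_eqVlt => /orP[|]; first exact: H2.
exact: H1.
Qed.

(** The times [sl i * t + c i] form one cluster for each slope. As [t] grows the
    clusters move apart, hence become independent by mixing, while the law of each of
    them is constant by stationarity. The product adds one slope at a time; a slope that
    is not taken contributes the factor 1. *)
Lemma line_event_cvg s :
  (fun t => pr (event xi (fun i => sl i < s)%N (fun i => sl i * t + c i)%N A))
    @ \oo --> \prod_(r < s) pr (event xi (fun i => sl i == r) c A).
Proof.
have mev r t : measurable (ev r t) by exact: measurable_event.
have mcl r t : measurable (cl r t) by exact: measurable_event.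
elim: s => [|s IH].
  have H t : pr (ev 0 t) = 1.
    rewrite -[RHS]/(fine 1%:E) -(@probability_setT _ _ _ P).
    by congr (fine (P _)); apply/seteqP; split => // w _ i.
  by rewrite big_ord0; under eq_fun do rewrite H; exact: cvg_cst.
rewrite big_ord_recr /=.
have lim1 : (fun t => pr (ev s t) * pr (cl s t)) @ \oo -->
    (\prod_(r < s) pr (event xi (fun i => sl i == r) c A)) *
    pr (event xi (fun i => sl i == s) c A).
  apply: cvgM; first exact: IH.
  by under eq_fun do rewrite cl_cst; exact: cvg_cst.
pose cm := \max_i c i.
have lim0 : (fun t => pr (ev s.+1 t) - pr (ev s t) * pr (cl s t)) @ \oo --> (0 : R).
  apply/cvgrPdist_le => e e0.
  have := rho0 => /cvgrPdist_le /(_ e e0) [T _ HT].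
  exists (T + cm + 1)%N => // t /= Tt.
  rewrite sub0r normrN evS.
  have [-> | s0] := posnP s.
    have -> : ev 0 t = setT by apply/seteqP; split => // w _ i.
    by rewrite setTI probability_setT /= mul1r subrr normr0 ltW.
  have : `|pr (ev s t `&` cl s t) - pr (ev s t) * pr (cl s t)| <=
      rho (t - cm) * (pr (ev s t) * pr (cl s t)).
    (* the slopes below s only use times up to (s - 1) t + cm, and slope s starts at s
       t *)
    apply: (process_mixing mp (n := (s.-1 * t + cm)%N)).
    - by rewrite subn_gt0; lia.
    - apply: sigma_process_event => // i /= sli.
      apply: leq_add; last exact: (@leq_bigmax _ c).
      by rewrite leq_mul2r; apply/orP; right; lia.
    - apply: sigma_process_event => // i /= /eqP ->.
      have : (s * t = s.-1 * t + t)%N by rewrite -{1}(prednK s0) mulSn addnC.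
      lia.
  move=> /le_trans; apply.
  have Hm : `|rho (t - cm)%N| <= e.
    by have := HT (t - cm)%N; rewrite sub0r normrN; apply => /=; lia.
  have l0 : 0 <= pr (ev s t) * pr (cl s t) by rewrite mulr_ge0 ?pr_ge0.
  have l1 : pr (ev s t) * pr (cl s t) <= 1.
    by rewrite mulr_ile1 ?pr_ge0// pr_le1.
  apply: (le_trans (ler_wpM2r l0 (ler_norm _))).
  by apply: le_trans Hm; rewrite ler_piMr.
have E : (fun t => pr (ev s.+1 t)) =
    (fun t => (pr (ev s.+1 t) - pr (ev s t) * pr (cl s t)) +
              pr (ev s t) * pr (cl s t)).
  by apply/funext => t; rewrite subrK.
rewrite -[X in _ --> X]add0r -/(ev s.+1) [X in X @ _]E.
exact: cvgD lim0 lim1.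
Qed.

End lines.

End asymptotic_independence.

(** * Orthogonal components on a finite power *)

Section finite_products.
Context (R : realType) (I : finType) (l : nat) (m : I -> R).
Hypotheses (m_ge0 : forall v, 0 <= m v) (m_sum1 : \sum_v m v = 1).
Implicit Types (x y : {ffun 'I_l -> I}) (phi : {ffun 'I_l -> I} -> R).

Definition weight x : R := \prod_a m (x a).

Definition normsq phi : R := \sum_x weight x * phi x ^+ 2.

Definition update (i : 'I_l) (v : I) x : {ffun 'I_l -> I} :=
  [ffun a => if a == i then v else x a].

Definition merge (i : nat) x y : {ffun 'I_l -> I} :=
  [ffun a : 'I_l => if (a < i)%N then x a else y a].

(** Conditional expectation of [phi] given the coordinates of index less than [i], under
    the product of [m]. *)
Definition proj (i : nat) phi x : R := \sum_y weight y * phi (merge i x y).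

(** Martingale differences of [phi] for the filtration generated by the successive
    coordinates. *)
Definition component (i : nat) phi x : R := proj i.+1 phi x - proj i phi x.

Definition depends_upto (i : 'I_l) phi : Prop :=
  forall x y, (forall a : 'I_l, (a <= i)%N -> x a = y a) -> phi x = phi y.

Definition centered_at (i : 'I_l) phi : Prop :=
  forall x, \sum_v m v * phi (update i v x) = 0.

Let ffun_eq x y : (forall a : 'I_l, x a = y a) -> x = y.
Proof. by move=> xy; apply/ffunP. Qed.

Lemma weight_ge0 x : 0 <= weight x.
Proof. by apply: prodr_ge0 => a _. Qed.

Lemma weight_sum1 : \sum_x weight x = 1.
Proof.
rewrite /weight -(bigA_distr_bigA (fun (_ : 'I_l) v => m v)).
by rewrite big1 // => a _; rewrite m_sum1.
Qed.

Lemma normsq_ge0 phi : 0 <= normsq phi.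
Proof. by apply: sumr_ge0 => x _; rewrite mulr_ge0 ?weight_ge0 ?sqr_ge0. Qed.

(** The difference of the two sides is the variance of [phi]. *)
Lemma jensen_sqr phi : (\sum_x weight x * phi x) ^+ 2 <= normsq phi.
Proof.
set M := \sum_x _; rewrite -subr_ge0.
have -> : normsq phi - M ^+ 2 = \sum_x weight x * (phi x - M) ^+ 2.
  transitivity (\sum_x (weight x * phi x ^+ 2 - 2 * M * (weight x * phi x) +
      M ^+ 2 * weight x)); last by apply: eq_bigr => x _; ring.
  rewrite big_split sumrB -!mulr_sumr weight_sum1 /= -/M /normsq; ring.
by apply: sumr_ge0 => x _; rewrite mulr_ge0 ?weight_ge0 ?sqr_ge0.
Qed.

(** Exchanging the coordinates of index at least [i] between [x] and [y] is a
    weight-preserving involution on pairs, and it moves [merge i x y] to the first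
    place. *)
Lemma sum_merge i phi :
  \sum_x \sum_y weight x * weight y * phi (merge i x y) = \sum_x weight x * phi x.
Proof.
pose s (u : {ffun 'I_l -> I} * {ffun 'I_l -> I}) := (merge i u.1 u.2, merge i u.2 u.1).
have sK : involutive s.
  by move=> [x y]; rewrite /s /=; congr pair; apply: ffun_eq => a; rewrite !ffunE /=;
    case: (_ < _)%N.
rewrite pair_big (reindex_inj (inv_inj sK)) /=.
transitivity (\sum_(u : {ffun 'I_l -> I} * {ffun 'I_l -> I})
    weight u.2 * (weight u.1 * phi u.1)).
  apply: eq_bigr => -[x y] _ /=.
  have -> : merge i (merge i x y) (merge i y x) = x.
    by apply: ffun_eq => a; rewrite !ffunE; case: (_ < _)%N.
  rewrite [RHS]mulrA; congr (_ * _); rewrite /weight -!big_split /=.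
  by apply: eq_bigr => a _; rewrite !ffunE; case: (_ < _)%N => //; rewrite mulrC.
rewrite -(pair_big xpredT xpredT (fun x y => weight y * (weight x * phi x))) /=.
by apply: eq_bigr => x _; rewrite -mulr_suml weight_sum1 mul1r.
Qed.

(** As for [sum_merge], with the involution that swaps a fresh value [v] with coordinate
    [i]. *)
Lemma sum_update i phi :
  \sum_v m v * (\sum_y weight y * phi (update i v y)) = \sum_y weight y * phi y.
Proof.
pose s (u : I * {ffun 'I_l -> I}) := (u.2 i, update i u.1 u.2).
have sK : involutive s.
  move=> [v y]; rewrite /s /= ffunE eqxx; congr pair.
  by apply: ffun_eq => a; rewrite !ffunE; case: eqP => [->|].
under eq_bigr => v _ do rewrite mulr_sumr.
rewrite pair_big (reindex_inj (inv_inj sK)) /=.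
transitivity (\sum_(u : I * {ffun 'I_l -> I}) m u.1 * (weight u.2 * phi u.2)).
  apply: eq_bigr => -[v y] _ /=.
  have -> : update i (y i) (update i v y) = y.
    by apply: ffun_eq => a; rewrite !ffunE; case: eqP => [->|].
  rewrite !mulrA; congr (_ * _); rewrite /weight.
  rewrite (bigD1 i)// [X in _ = _ * X](bigD1 i)//= ffunE eqxx !mulrA.
  rewrite [m (y i) * _]mulrC; congr (_ * _).
  by apply: eq_bigr => a /negbTE ai; rewrite ffunE ai.
rewrite -(pair_big xpredT xpredT (fun v y => m v * (weight y * phi y))) /=.
rewrite exchange_big /=.
by apply: eq_bigr => y _; rewrite -mulr_suml m_sum1 mul1r.
Qed.

Lemma proj_last phi : proj l phi =1 phi.
Proof.
move=> x; rewrite /proj (eq_bigr (fun y => weight y * phi x)).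
  by rewrite -mulr_suml weight_sum1 mul1r.
move=> y _; congr (_ * phi _).
by apply: ffun_eq => a; rewrite ffunE ltn_ord.
Qed.

Lemma proj0 phi x : proj 0 phi x = \sum_y weight y * phi y.
Proof.
apply: eq_bigr => y _; congr (_ * phi _).
by apply: ffun_eq => a; rewrite ffunE.
Qed.

Lemma sum_component phi x :
  \sum_(i < l) component i phi x = phi x - \sum_y weight y * phi y.
Proof.
rewrite -(big_mkord xpredT (fun i => component i phi x)) telescope_sumr//.
by rewrite proj_last proj0.
Qed.

Lemma depends_proj (i : nat) phi x y :
  (forall a : 'I_l, (a < i)%N -> x a = y a) -> proj i phi x = proj i phi y.
Proof.
move=> xy; apply: eq_bigr => z _; congr (_ * phi _).
by apply: ffun_eq => a; rewrite !ffunE; case: ifP => // /xy.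
Qed.

Lemma depends_component (i : 'I_l) phi : depends_upto i (component i phi).
Proof.
move=> x y xy; congr (_ - _); apply: depends_proj => a ai; apply: xy => //.
exact: ltnW.
Qed.

Lemma proj_average (i : 'I_l) phi x :
  \sum_v m v * proj i.+1 phi (update i v x) = proj i phi x.
Proof.
rewrite /proj -(sum_update i); apply: eq_bigr => v _; congr (_ * _).
apply: eq_bigr => y _; congr (_ * phi _); apply: ffun_eq => a.
rewrite !ffunE ltnS leq_eqVlt -val_eqE /=.
by case: eqP => [->|]; rewrite ?ltnn.
Qed.

(** Averaging [proj i.+1 phi] over coordinate [i] gives [proj i phi], on which
    coordinate [i] has no influence. *)
Lemma centered_component (i : 'I_l) phi : centered_at i (component i phi).
Proof.
move=> x; rewrite /component.
under eq_bigr => v _ do rewrite mulrBr.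
rewrite sumrB proj_average; apply/eqP; rewrite subr_eq0; apply/eqP.
rewrite -[LHS]mul1r -m_sum1 mulr_suml; apply: eq_bigr => v _; congr (_ * _).
apply: depends_proj => a ai; rewrite ffunE; case: eqP => // aE.
by rewrite aE ltnn in ai.
Qed.

Lemma centered_sum0 (i : 'I_l) phi : centered_at i phi ->
  \sum_x weight x * phi x = 0.
Proof.
move=> cphi; rewrite -(sum_update i).
under eq_bigr => v _ do rewrite mulr_sumr.
rewrite exchange_big big1//= => y _.
under eq_bigr => v _ do rewrite mulrCA.
by rewrite -mulr_sumr cphi mulr0.
Qed.

Lemma normsq_proj i phi : normsq (proj i phi) <= normsq phi.
Proof.
rewrite /normsq -[leRHS](sum_merge i (fun x => phi x ^+ 2)).
apply: ler_sum => x _; under eq_bigr => y _ do rewrite -mulrA.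
rewrite -mulr_sumr ler_wpM2l ?weight_ge0//.
exact: (jensen_sqr (fun y => phi (merge i x y))).
Qed.

Lemma normsq_component i phi : normsq (component i phi) <= 4 * normsq phi.
Proof.
apply: (@le_trans _ _ (2 * normsq (proj i.+1 phi) + 2 * normsq (proj i phi))).
  rewrite /normsq !mulr_sumr -big_split; apply: ler_sum => x _ /=.
  rewrite /component; set a := proj _ _ _; set b := proj _ _ _.
  rewrite -subr_ge0 (_ : _ - _ = weight x * (a + b) ^+ 2); last by ring.
  by rewrite mulr_ge0 ?weight_ge0 ?sqr_ge0.
by have := normsq_proj i.+1 phi; have := normsq_proj i phi; lra.
Qed.

End finite_products.

(** * Limits of averages and of dominated sums *)

Section sequences_of_sums.
Context (R : realType).
Implicit Types (u v : nat -> R).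

Lemma cvg_epsP u (c : R) : u @ \oo --> c <->
  (forall e, 0 < e -> exists N, forall n, (N <= n)%N -> `|u n - c| <= e).
Proof.
split.
  move=> /cvgrPdist_le H e e0; have [N _ HN] := H e e0.
  by exists N => n Nn; rewrite distrC; exact: HN.
move=> H; apply/cvgrPdist_le => e e0; have [N HN] := H e e0.
by exists N => // n /= Nn; rewrite distrC; exact: HN.
Qed.

Lemma eq_cvgn u v (c : R) : u =1 v -> u @ \oo --> c -> v @ \oo --> c.
Proof. by move=> /funext ->. Qed.

Lemma seq_cvgD u v (a b : R) : u @ \oo --> a -> v @ \oo --> b ->
  (fun n => u n + v n) @ \oo --> a + b.
Proof. by move=> ua vb; exact: cvgD. Qed.

Lemma seq_cvgB u v (a b : R) : u @ \oo --> a -> v @ \oo --> b ->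
  (fun n => u n - v n) @ \oo --> a - b.
Proof. by move=> ua vb; exact: cvgB. Qed.

Lemma seq_cvgM u v (a b : R) : u @ \oo --> a -> v @ \oo --> b ->
  (fun n => u n * v n) @ \oo --> a * b.
Proof. by move=> ua vb; exact: cvgM. Qed.

Lemma seq_cvgZ u (k a : R) : u @ \oo --> a -> (fun n => k * u n) @ \oo --> k * a.
Proof. by move=> ua; exact: cvgMr. Qed.

Lemma seq_cvg_sum (f : nat -> nat -> R) (h : nat -> R) M :
  (forall q, f ^~ q @ \oo --> h q) ->
  (fun t => \sum_(0 <= q < M) f t q) @ \oo --> \sum_(0 <= q < M) h q.
Proof.
move=> fh; elim: M => [|M IH].
  by under eq_fun do rewrite big_geq//; rewrite big_geq//; exact: cvg_cst.
under eq_fun do rewrite big_nat_recr//=.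
by rewrite big_nat_recr//=; exact: seq_cvgD.
Qed.

Lemma cvg_squeeze0 u v : (forall n, `|u n| <= v n) -> v @ \oo --> (0 : R) ->
  u @ \oo --> (0 : R).
Proof.
move=> uv /cvg_epsP v0; apply/cvg_epsP => e e0.
have [N HN] := v0 e e0; exists N => n Nn; rewrite subr0.
by apply: (le_trans (uv n)); have := HN n Nn; rewrite subr0; apply: le_trans (ler_norm _).
Qed.

(** The bound is only asked for positive indices because the sequences to which it
    applies are quotients by the index. *)
Lemma cvg_uniform_limit u :
  (forall e, 0 < e -> exists v (c : R), v @ \oo --> c /\
     forall n, (0 < n)%N -> `|u n - v n| <= e) ->
  exists c : R, u @ \oo --> c.
Proof.
move=> H; suff : cvgn u by move=> uc; exists (limn u).
apply: cauchy_cvg; apply: cauchy_exP => e e0.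
have e30 : 0 < e / 3 by rewrite divr_gt0.
have [v [c [/cvg_epsP vc uv]]] := H _ e30.
have [N HN] := vc _ e30.
exists c; exists N.+1 => // n /= Nn; rewrite /ball /= distrC.
rewrite -(subrKA (v n)); apply: le_lt_trans (ler_normD _ _) _.
have := uv n (leq_ltn_trans (leq0n _) Nn); have := HN n (ltnW Nn); lra.
Qed.

Lemma cvg_lim_dist u v (a b e : R) : u @ \oo --> a -> v @ \oo --> b ->
  (forall n, (0 < n)%N -> `|u n - v n| <= e) -> `|a - b| <= e.
Proof.
move=> ua vb uv; apply: (cvgr_to_le (cvg_norm (cvgB ua vb))).
by near=> n; apply: uv; near: n; exact: nbhs_infty_gt.
Unshelve. all: by end_near. Qed.

Lemma cvg_subseq u (c : R) (f : nat -> nat) : (forall n, (n <= f n)%N) ->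
  u @ \oo --> c -> (fun n => u (f n)) @ \oo --> c.
Proof.
move=> nf /cvg_epsP H; apply/cvg_epsP => e e0; have [N HN] := H e e0.
by exists N => n Nn; apply: HN; exact: leq_trans (nf n).
Qed.

Lemma cvg_drop u (c : R) k :
  (fun n => u (n + k)%N) @ \oo --> c -> u @ \oo --> c.
Proof.
move=> /cvg_epsP H; apply/cvg_epsP => e e0; have [N HN] := H e e0.
exists (N + k)%N => n Nn; rewrite -(subnK (leq_trans (leq_addl _ _) Nn)).
by apply: HN; lia.
Qed.

Lemma cvg_inv_nat (C : R) : (fun N : nat => C / N%:R) @ \oo --> (0 : R).
Proof.
apply/cvg_epsP => e e0; exists (Num.truncn (`|C| / e)).+1 => n Nn.
have n0 : 0 < n%:R :> R by rewrite ltr0n (leq_ltn_trans _ Nn).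
rewrite subr0 normrM normfV (gtr0_norm n0) ler_pdivrMr// mulrC -ler_pdivrMr//.
apply/ltW/(lt_le_trans (truncnS_gt _)).
by rewrite ler_nat.
Qed.

Lemma cvg_mean u (c : R) : u @ \oo --> c ->
  (fun N => (\sum_(0 <= n < N) u n) / N%:R) @ \oo --> c.
Proof.
move=> /cesaro uc; apply: (@cvg_drop _ _ 1).
by under eq_fun do rewrite addn1 mulrC; exact: uc.
Qed.

(** The sequence is asymptotic to the periodic sequence [v (n %% L)], and the partial
    sums of the latter, once its mean over one period is subtracted, stay bounded. *)
Lemma periodic_mean L u (v : nat -> R) : (0 < L)%N ->
  (forall r, (r < L)%N -> (fun t => u (L * t + r)%N) @ \oo --> v r) ->
  (fun N => (\sum_(0 <= n < N) u n) / N%:R) @ \oo -->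
  (\sum_(0 <= r < L) v r) / L%:R.
Proof.
move=> L0 uv; set vb := _ / _.
pose w n := v (n %% L)%N - vb.
have uw0 : (fun n => u n - v (n %% L)%N) @ \oo --> (0 : R).
  apply/cvg_epsP => e e0.
  have H r : exists N, (r < L)%N -> forall t, (N <= t)%N ->
      `|u (L * t + r)%N - v r| <= e.
    have [rL|] := ltnP r L; last by exists 0.
    by have /cvg_epsP/(_ e e0)[N HN] := uv r rL; exists N.
  have [N HN] := choice H.
  exists (L * (\max_(r < L) N r))%N => n nM.
  rewrite subr0 [in u n](divn_eq n L) mulnC.
  apply: HN; first by rewrite ltn_mod.
  apply: (@leq_trans (\max_(r < L) N r)).
    exact: (leq_bigmax (Ordinal (ltn_pmod n L0))).
  by rewrite leq_divRL// mulnC.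
have sw0 q : \sum_(0 <= n < q * L) w n = 0.
  elim: q => [|q IH]; first by rewrite mul0n big_geq.
  rewrite mulSn addnC (big_cat_nat (n := q * L))//= ?leq_addr// IH add0r.
  rewrite -{1}[(q * L)%N]add0n big_addn addKn.
  rewrite (eq_big_nat _ _ (F2 := fun r => v r - vb)); last first.
    by move=> r /andP[_ rL]; rewrite /w addnC modnMDl modn_small.
  rewrite sumrB sumr_const_nat subn0 -mulr_natr /vb divfK ?subrr//.
  by rewrite pnatr_eq0 -lt0n.
have swb N : `|\sum_(0 <= n < N) w n| <= \sum_(0 <= r < L) `|v r - vb|.
  rewrite [in X in `|X|](divn_eq N L).
  rewrite (big_cat_nat (n := (N %/ L * L)%N))//= ?leq_addr// sw0 add0r.
  rewrite -{1}[(N %/ L * L)%N]add0n big_addn addKn.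
  apply: le_trans (ler_norm_sum _ _ _) _.
  have mL : (N %% L <= L)%N by rewrite ltnW// ltn_mod.
  rewrite [leRHS](big_cat_nat (n := N %% L))//= -[leLHS]addr0 lerD//.
    rewrite le_eqVlt; apply/orP; left; apply/eqP.
    apply: eq_big_nat => r /andP[_ rL].
    by rewrite /w addnC modnMDl modn_small// (leq_trans rL).
  exact: sumr_ge0.
have m1 := cvg_mean uw0.
have m2 : (fun N => (\sum_(0 <= n < N) w n) / N%:R) @ \oo --> (0 : R).
  apply: (@cvg_squeeze0 _ (fun N : nat =>
      (\sum_(0 <= r < L) `|v r - vb|) / N%:R)); last exact: cvg_inv_nat.
  move=> N; rewrite normrM [X in _ * X]ger0_norm ?invr_ge0//.
  by rewrite ler_wpM2r ?invr_ge0.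
have m3 : (fun N : nat => vb * (N%:R / N%:R)) @ \oo --> vb.
  apply: (@cvg_drop _ _ 1); under eq_fun => N.
    by rewrite divff ?pnatr_eq0 ?addn1// mulr1; over.
  exact: cvg_cst.
have := seq_cvgD (seq_cvgD m1 m2) m3; rewrite !add0r; apply: eq_cvgn => N /=.
rewrite mulrA -!mulrDl; congr (_ / _).
rewrite -big_split /= mulr_natr -[X in _ *+ X](subn0 N) -sumr_const_nat -big_split /=.
by apply: eq_bigr => n _; rewrite /w subrKA subrK.
Qed.

Section geometric.
Variable th : R.
Hypotheses (th0 : 0 < th) (th1 : th < 1).

Let g := (1 - th)^-1.

Let sth : 0 < 1 - th. Proof. by rewrite subr_gt0. Qed.

Let g0 : 0 < g. Proof. by rewrite invr_gt0. Qed.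

Lemma geo_sum N : \sum_(0 <= k < N) th ^+ k <= g.
Proof.
have -> : \sum_(0 <= k < N) th ^+ k = (1 - th ^+ N) * g.
  rewrite /g; apply: (mulIf (lt0r_neq0 sth)); rewrite mulfVK ?lt0r_neq0//.
  elim: N => [|N IH]; first by rewrite big_geq// mul0r expr0 subrr.
  by rewrite big_nat_recr//= mulrDl IH exprS; ring.
apply: ler_piMl; first exact: ltW.
by rewrite lerBlDr lerDl exprn_ge0// ltW.
Qed.

Lemma geo_tail M N : \sum_(M <= k < N) th ^+ k <= th ^+ M * g.
Proof.
have [NM|MN] := leqP N M.
  by rewrite big_geq// mulr_ge0// ?exprn_ge0// ltW.
rewrite -{1}[M]add0n big_addn.
under eq_bigr => k _ do rewrite exprD mulrC.
by rewrite -mulr_sumr ler_wpM2l ?exprn_ge0 ?geo_sum// ltW.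
Qed.

Lemma expr_cvg0 : (fun n => th ^+ n) @ \oo --> (0 : R).
Proof. by apply: cvg_expr; rewrite gtr0_norm. Qed.

Lemma expr_le_expr (a b : nat) : (a <= b)%N -> th ^+ b <= th ^+ a.
Proof. by move=> ab; rewrite ler_wiXn2l// ltW. Qed.

(** The tails of all the sums are uniformly small by domination, which allows the limit
    in [t] to be taken term by term although the number [Q t] of terms varies. *)
Lemma tannery C (f : nat -> nat -> R) (h : nat -> R) (Q : nat -> nat) :
  (forall t q, `|f t q| <= C * th ^+ q) ->
  (forall t q, (Q t <= q)%N -> f t q = 0) ->
  (forall q, f ^~ q @ \oo --> h q) ->
  exists2 s : R, (fun t => \sum_(0 <= q < Q t) f t q) @ \oo --> s &
             (fun M => \sum_(0 <= q < M) h q) @ \oo --> s.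
Proof.
move=> fC fQ fh.
have C0 : 0 <= C.
  by have := fC 0 0; rewrite expr0 mulr1; apply: le_trans.
have hC q : `|h q| <= C * th ^+ q.
  by apply: (cvgr_to_le (cvg_norm (fh q))); near=> t; exact: fC.
have tail (w : nat -> R) M N : (forall q, `|w q| <= C * th ^+ q) ->
    `|\sum_(M <= q < N) w q| <= C * g * th ^+ M.
  move=> wC; apply: le_trans (ler_norm_sum _ _ _) _.
  apply: (@le_trans _ _ (\sum_(M <= q < N) C * th ^+ q)).
    by apply: ler_sum_nat => q _.
  by rewrite -mulr_sumr -mulrA ler_wpM2l// mulrC geo_tail.
have tl0 : (fun M => C * g * th ^+ M) @ \oo --> (0 : R).
  by rewrite -[X in _ --> X](mulr0 (C * g)); apply: seq_cvgZ; exact: expr_cvg0.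
have ftail t M : `|\sum_(0 <= q < Q t) f t q - \sum_(0 <= q < M) f t q| <=
    C * g * th ^+ M.
  have [MQ|QM] := leqP M (Q t).
    by rewrite (big_cat_nat (n := M))//= addrAC subrr add0r; exact: tail.
  rewrite (big_cat_nat (n := Q t) (m := 0) (p := M))//=; last exact: ltnW.
  have -> : \sum_(Q t <= i < M) f t i = 0.
    by rewrite big_nat big1// => q /andP[Qq _]; exact: fQ.
  by rewrite addr0 subrr normr0 !mulr_ge0// ?exprn_ge0// ltW.
have cvM M : (fun t => \sum_(0 <= q < M) f t q) @ \oo --> \sum_(0 <= q < M) h q.
  exact: seq_cvg_sum.
have [s Hs] : exists c : R, (fun t => \sum_(0 <= q < Q t) f t q) @ \oo --> c.
  apply: cvg_uniform_limit => e e0.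
  move/cvg_epsP : tl0 => /(_ e e0)[M HM].
  exists (fun t => \sum_(0 <= q < M) f t q), (\sum_(0 <= q < M) h q); split => //.
  move=> t _; apply: (le_trans (ftail t M)); apply: le_trans (HM M (leqnn _)).
  by rewrite subr0 ler_norm.
exists s => //; apply/cvg_epsP => e e0.
move/cvg_epsP : tl0 => /(_ e e0)[M0 HM].
exists M0 => M M0M; rewrite distrC.
apply: (cvg_lim_dist Hs (cvM M)) => t _.
apply: (le_trans (ftail t M)); apply: le_trans (HM M M0M).
by rewrite subr0 ler_norm.
Unshelve. all: by end_near. Qed.

Definition dist (a b : nat) : nat := ((a - b) + (b - a))%N.

(** The multiples of [s] on either side of [A] lie at distances that grow at least by
    one at each step, so each side is bounded by a geometric series. *)
Lemma geo_dist_sum s A N : (0 < s)%N ->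
  \sum_(0 <= m < N) th ^+ dist A (s * m) <= 2 * g.
Proof.
move=> s0; pose M := (A %/ s)%N.
have sM : (s * M <= A)%N by rewrite mulnC leq_trunc_div.
have sM1 : (A < s * M.+1)%N by rewrite mulnC ltn_ceil.
apply: (@le_trans _ _ (\sum_(0 <= m < M.+1) th ^+ (M - m) +
    \sum_(M.+1 <= m < maxn N M.+1) th ^+ (m - M.+1))).
  apply: (@le_trans _ _ (\sum_(0 <= m < maxn N M.+1) th ^+ dist A (s * m))).
    rewrite [leRHS](big_cat_nat (n := N))//= ?leq_maxl//.
    by rewrite lerDl sumr_ge0// => m _; rewrite exprn_ge0// ltW.
  rewrite (big_cat_nat (n := M.+1))//= ?leq_maxr//.
  apply: lerD; apply: ler_sum_nat => m /andP[m1 m2]; apply: expr_le_expr.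
    have : (s * (M - m) <= A - s * m)%N by rewrite mulnBr leq_sub2r.
    have : (M - m <= s * (M - m))%N by rewrite leq_pmull.
    by rewrite /dist; lia.
  have : (s * (m - M.+1) <= s * m - A)%N by rewrite mulnBr leq_sub2l// ltnW.
  have : (m - M.+1 <= s * (m - M.+1))%N by rewrite leq_pmull.
  by rewrite /dist; lia.
rewrite mulr_natl; apply: lerD.
  rewrite big_nat_rev /= add0n.
  rewrite (eq_big_nat _ _ (F2 := fun k => th ^+ k)) ?geo_sum// => k /andP[_ kM].
  by congr (_ ^+ _); lia.
rewrite -{1}[M.+1]add0n big_addn.
by under eq_bigr => k _ do rewrite addnK; exact: geo_sum.
Qed.

End geometric.

End sequences_of_sums.

(** * Variance growth of arrays of covariances *)

Section covariance_arrays.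
Context (R : realType) (th : R) (l : nat).
Hypotheses (th0 : 0 < th) (th1 : th < 1).

Let g := (1 - th)^-1.

Let g0 : 0 < g. Proof. by rewrite invr_gt0 subr_gt0. Qed.

Let th_ge0 k : 0 <= th ^+ k. Proof. by rewrite exprn_ge0// ltW. Qed.

Let sum_th N : \sum_(0 <= k < N) th ^+ k <= g. Proof. exact: geo_sum. Qed.

Definition box_sum (c : nat -> nat -> R) (N : nat) : R :=
  \sum_(1 <= n < N.+1) \sum_(1 <= m < N.+1) c n m.

Definition row_sum (c : nat -> nat -> R) (N : nat) : R :=
  \sum_(1 <= m < N) c N m.

Lemma box_sumS c N : box_sum c N.+1 =
  box_sum c N + (c N.+1 N.+1 + row_sum c N.+1 + row_sum (fun n m => c m n) N.+1).
Proof.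
rewrite /box_sum /row_sum big_nat_recr//=.
under eq_bigr => n _ do rewrite big_nat_recr//=.
rewrite big_split /= [X in _ + X]big_nat_recr//=; ring.
Qed.

(** The box sum accumulates the increments of [box_sumS]; when these are asymptotically
    periodic their averages converge. *)
Lemma box_sum_mean c L (v : nat -> R) : (0 < L)%N ->
  (forall r, (r < L)%N -> (fun t => c (L * t + r)%N (L * t + r)%N +
     row_sum c (L * t + r) + row_sum (fun n m => c m n) (L * t + r)) @ \oo --> v r) ->
  (fun N => box_sum c N / N%:R) @ \oo --> (\sum_(0 <= r < L) v r) / L%:R.
Proof.
move=> L0 H.
pose u N := c N N + row_sum c N + row_sum (fun n m => c m n) N.
have E N : box_sum c N = \sum_(0 <= n < N.+1) u n - u 0%N.
  elim: N => [|N IH].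
    by rewrite big_nat1 subrr /box_sum big_geq.
  by rewrite box_sumS IH [in RHS]big_nat_recr//= [in RHS]addrAC.
have mu1 := periodic_mean (u := u) L0 H.
have m1 : (fun N : nat => (\sum_(0 <= n < N.+1) u n) / N.+1%:R * (1 + 1 / N%:R))
    @ \oo --> (\sum_(0 <= r < L) v r) / L%:R.
  rewrite -[X in _ --> X]mulr1; apply: cvgM.
    exact: (cvg_subseq (f := S) _ mu1).
  by rewrite -[X in _ --> X]addr0; apply: seq_cvgD; [exact: cvg_cst|exact: cvg_inv_nat].
pose w (N : nat) := (\sum_(0 <= n < N.+1) u n) / N.+1%:R * (1 + 1 / N%:R) - u 0%N / N%:R.
have m2 : w @ \oo --> (\sum_(0 <= r < L) v r) / L%:R.
  by rewrite -[X in _ --> X]subr0; exact: seq_cvgB m1 (cvg_inv_nat (u 0%N)).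
have m3 : (fun N => w (N + 1)%N) @ \oo --> (\sum_(0 <= r < L) v r) / L%:R.
  by apply: (cvg_subseq (f := fun n => (n + 1)%N)) => // n; exact: leq_addr.
apply: (@cvg_drop _ _ _ 1); apply: eq_cvgn m3 => N; rewrite /w.
rewrite E mulrBl addn1; congr (_ - _).
rewrite -mulrA; congr (_ * _).
have n1 : N.+1%:R != 0 :> R by rewrite pnatr_eq0.
have n2 : N.+2%:R != 0 :> R by rewrite pnatr_eq0.
have E2 : N.+2%:R = N.+1%:R + 1 :> R by rewrite -natr1.
move: n1 n2; rewrite E2; move: (N.+1%:R : R) => x n1 n2.
by field; rewrite ?n1 ?n2.
Qed.

Lemma sum_around (c : nat -> R) M N : (1 <= M <= N)%N ->
  \sum_(1 <= m < N) c m =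
  \sum_(0 <= q < N - M) c (M + q)%N + \sum_(0 <= q < M.-1) c (M - q.+1)%N.
Proof.
move=> /andP[M1 MN]; rewrite (big_cat_nat (n := M))//= addrC; congr (_ + _).
  rewrite -{1}[M]add0n big_addn; by under eq_bigr do rewrite addnC.
rewrite big_nat_rev /= -{1}[1%N]add0n big_addn subn1.
by apply: eq_bigr => q _; congr c; lia.
Qed.

Variable K : R.
(** [b i j n m] stands for the covariance of component [i] at index [n] with component
    [j] at index [m], whose last times are [i.+1 * n] and [j.+1 * m]. It is small unless
    these times are close ([bbd]), and it converges when [n] and [m] run along
    arithmetic progressions ([bline]). *)
Variable b : nat -> nat -> nat -> nat -> R.
Hypothesis bsym : forall i j n m, b i j n m = b j i m n.
Hypothesis bbd : forall i j n m, (i < l)%N -> (j < l)%N -> (0 < n)%N -> (0 < m)%N ->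
  `|b i j n m| <= K * (th ^+ dist (i.+1 * n) (j.+1 * m) + th ^+ (n + m)).
Hypothesis bline : forall i j s s' c c', (0 < s)%N -> (0 < s')%N ->
  exists v : R, (fun t => b i j (s * t + c) (s' * t + c')) @ \oo --> v.

Let K0 i j : (i < l)%N -> (j < l)%N -> 0 <= K.
Proof.
move=> il jl; have := bbd il jl (ltn0Sn 0) (ltn0Sn 0).
rewrite -[X in X -> _]/(is_true (_ <= _)) => H.
have := le_trans (normr_ge0 _) H; rewrite pmulr_lge0//.
by rewrite addr_gt0// exprn_gt0.
Qed.

Lemma box_sum_bound i j N : (i < l)%N -> (j < l)%N ->
  `|box_sum (b i j) N| <= K * (3 * g) * N%:R.
Proof.
move=> il jl; have Kp := K0 il jl.
apply: le_trans (ler_norm_sum _ _ _) _.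
rewrite [leRHS]mulr_natr -[X in _ *+ X](subn0 N) -[X in _ *+ X](subSS 0 N).
rewrite -sumr_const_nat; apply: ler_sum_nat => n /andP[n1 nN].
apply: le_trans (ler_norm_sum _ _ _) _.
apply: (@le_trans _ _ (\sum_(1 <= m < N.+1)
   K * (th ^+ dist (i.+1 * n) (j.+1 * m) + th ^+ m))).
  apply: ler_sum_nat => m /andP[m1 mN].
  apply: (le_trans (bbd il jl n1 m1)); rewrite ler_wpM2l// lerD2l.
  by apply: expr_le_expr => //; exact: leq_addl.
rewrite -mulr_sumr ler_wpM2l// big_split /= (_ : 3 * g = 2 * g + g); last by ring.
apply: lerD.
  apply: le_trans (geo_dist_sum th0 th1 (i.+1 * n) N.+1 (ltn0Sn j)).
  by rewrite [leRHS]big_nat_recl//= big_add1 lerDr.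
apply: le_trans (sum_th N.+1).
by rewrite [leRHS]big_nat_recl//= big_add1 lerDr.
Qed.

(** If [j < i] the last row [n = N] pairs the time [i.+1 * N] with times at most [j.+1 *
    N], so every term is exponentially small. Otherwise the terms concentrate around [m
    = i.+1 * N / j.+1]. This centre is an affine function of [t] because [j.+1] divides
    [l`!], which is why residue classes modulo [l`!] are used: the terms at a fixed
    offset from the centre converge by [bline], and domination on both sides of the
    centre gives the convergence of the row sums. *)
Lemma row_sum_cvg i j r : (i < l)%N -> (j < l)%N ->
  exists v : R, (fun t => row_sum (b i j) (l`! * t + r)) @ \oo --> v.
Proof.
move=> il jl; have Kp := K0 il jl; set L := l`!.
have L0 : (0 < L)%N by exact: fact_gt0.
suff [v Hv] : exists v : R, (fun t => row_sum (b i j) (L * (t + 1) + r)) @ \oo --> v.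
  by exists v; exact: (@cvg_drop _ _ _ 1).
have [ji|ij] := ltnP j i.
  pose f t q := let N := (L * (t + 1) + r)%N in
    if (q < N.-1)%N then b i j N (N - q.+1)%N else 0.
  have fbd t q : (q < (L * (t + 1) + r).-1)%N ->
      `|f t q| <= 2 * K * th ^+ (L * (t + 1) + r).
    rewrite /f => qN; rewrite qN.
    set N := (_ + r)%N in qN *.
    have m0 : (0 < N - q.+1)%N by lia.
    apply: (le_trans (bbd il jl _ m0)); first by lia.
    rewrite (_ : 2 * K * th ^+ N = K * (th ^+ N + th ^+ N)); last by ring.
    rewrite ler_wpM2l//; apply: lerD; apply: expr_le_expr => //.
      have : (j.+1 * (N - q.+1) <= j.+1 * N)%N by rewrite leq_mul2l leq_subr orbT.
      have : (j.+2 * N <= i.+1 * N)%N by rewrite leq_mul2r ltnS ji orbT.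
      by rewrite /dist [(j.+2 * N)%N]mulSn; lia.
    exact: leq_addr.
  have [||q|s Hs _] := tannery th0 th1 (C := 2 * K) (f := f) (h := fun _ => 0)
     (Q := fun t => (L * (t + 1) + r).-1).
  - move=> t q; have [qN|Nq] := ltnP q (L * (t + 1) + r).-1.
      apply: (le_trans (fbd t q qN)); rewrite ler_wpM2l ?mulr_ge0//.
      by apply: expr_le_expr => //; lia.
    by rewrite /f ltnNge Nq /= normr0 !mulr_ge0.
  - by move=> t q Nq; rewrite /f ltnNge Nq.
  - apply: (@cvg_squeeze0 _ _ (fun t => 2 * K * th ^+ t)).
      move=> t; have [qN|Nq] := ltnP q (L * (t + 1) + r).-1.
        apply: (le_trans (fbd t q qN)); rewrite ler_wpM2l ?mulr_ge0//.
        apply: expr_le_expr => //; have : (t <= L * t)%N by rewrite leq_pmull.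
        by rewrite mulnDr; lia.
      by rewrite /f ltnNge Nq /= normr0 !mulr_ge0.
    by rewrite -[X in _ --> X](mulr0 (2 * K)); apply: seq_cvgZ; exact: expr_cvg0.
  exists s; apply: eq_cvgn Hs => t; set N := (L * (t + 1) + r)%N.
  have N1 : (1 <= N)%N by rewrite /N; lia.
  rewrite -/N /row_sum (@sum_around (b i j N) N N) ?N1 ?leqnn// subnn [X in X + _]big_geq// add0r.
  by apply: eq_big_nat => q /andP[_ qN]; rewrite /f -/N qN.
(* the row is centred at m = e (t + 1), up to the bounded shift coming from r *)
have jL : (j.+1 %| L)%N by rewrite dvdn_fact// ltnS.
pose e := (i.+1 * (L %/ j.+1))%N.
have e0 : (0 < e)%N.
  by rewrite muln_gt0 /= divn_gt0// dvdn_leq.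
have je : (j.+1 * e = i.+1 * L)%N by rewrite mulnCA [(j.+1 * _)%N]mulnC divnK.
have eL : (e <= L)%N.
  rewrite -(leq_pmul2l (ltn0Sn j)) je leq_mul2r ltnS ij orbT//.
have eLt t : (e * (t + 1) <= L * (t + 1))%N by rewrite leq_mul2r eL orbT.
have e1 t : (1 <= e * (t + 1))%N by rewrite muln_gt0 e0 addn1.
have te t : (t <= e * t)%N by rewrite leq_pmull.
pose N t := (L * (t + 1) + r)%N.
pose f1 t q := if (q < N t - e * (t + 1))%N
  then b i j (N t) (e * (t + 1) + q)%N else 0.
pose f2 t q := if (q < (e * (t + 1)).-1)%N
  then b i j (N t) (e * (t + 1) - q.+1)%N else 0.
have N0 t : (0 < N t)%N by rewrite /N; have := e1 t; have := eLt t; lia.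
have iN t : (i.+1 * N t = j.+1 * (e * (t + 1)) + i.+1 * r)%N.
  by rewrite /N mulnDr [(j.+1 * (e * _))%N]mulnA je mulnA.
have f1bd t q : `|f1 t q| <= K * ((th ^+ (i.+1 * r))^-1 + 1) * th ^+ q.
  rewrite /f1; case: ifP => [qN|_]; last first.
    by rewrite normr0 !mulr_ge0// addr_ge0// invr_ge0.
  have m0 : (0 < e * (t + 1) + q)%N by have := e1 t; lia.
  apply: (le_trans (bbd il jl (N0 t) m0)).
  rewrite -mulrA ler_wpM2l// mulrDl mul1r; apply: lerD; last first.
    by apply: expr_le_expr => //; lia.
  rewrite ler_pdivlMl ?exprn_gt0// -exprD; apply: expr_le_expr => //.
  rewrite iN mulnDr /dist.
  have : (q <= j.+1 * q)%N by rewrite leq_pmull.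
  lia.
have f2bd t q : `|f2 t q| <= 2 * K * th ^+ q.
  rewrite /f2; case: ifP => [qN|_]; last by rewrite normr0 !mulr_ge0.
  have m0 : (0 < e * (t + 1) - q.+1)%N by lia.
  apply: (le_trans (bbd il jl (N0 t) m0)).
  rewrite (_ : 2 * K * th ^+ q = K * (th ^+ q + th ^+ q)); last by ring.
  rewrite ler_wpM2l//; apply: lerD; apply: expr_le_expr => //.
    rewrite iN mulnBr /dist.
    have : (q.+1 <= j.+1 * q.+1)%N by rewrite leq_pmull.
    have : (j.+1 * q.+1 <= j.+1 * (e * (t + 1)))%N by rewrite leq_pmul2l//; lia.
    lia.
  by have := eLt t; rewrite /N; lia.
have f1c q : exists v : R, f1 ^~ q @ \oo --> v.
  have [v Hv] := bline i j (L + r) (e + q) L0 e0.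
  have E t : b i j (L * t + (L + r)) (e * t + (e + q)) = b i j (N t) (e * (t + 1) + q).
    by congr b; rewrite /N mulnDr muln1; lia.
  have [eqL|neL] := eqVneq e L.
    exists (if (q < r)%N then v else 0).
    have -> : f1 ^~ q = fun t => if (q < r)%N then b i j (N t) (e * (t + 1) + q)%N else 0.
      by apply/funext => t; rewrite /f1 /N eqL addKn.
    case: ifP => _; last exact: cvg_cst.
    by apply: eq_cvgn Hv => t; rewrite E.
  have {neL} eL' : (e < L)%N by rewrite ltn_neqAle neL.
  exists v; apply: (@cvg_drop _ _ _ q.+1).
  apply: eq_cvgn (cvg_subseq (f := fun n => (n + q.+1)%N) _ Hv).
    move=> t /=; rewrite E /f1 ifT// /N.
    have : ((e + 1) * (t + q.+1 + 1) <= L * (t + q.+1 + 1))%N.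
      by apply: leq_mul => //; rewrite addn1.
    by rewrite mulnDl mul1n; lia.
  by move=> n; exact: leq_addr.
have f2c q : exists v : R, f2 ^~ q @ \oo --> v.
  (* [bline] needs intercepts in nat: starting from t = q + 1 keeps the index e (t + 1)
     - (q + 1) nonnegative *)
  have h0 : (q.+1 <= e * (q + 2))%N.
    by apply: (@leq_trans (q + 2)); [lia|rewrite leq_pmull].
  have [v Hv] := bline i j (L * (q + 2) + r) (e * (q + 2) - q.+1) L0 e0.
  exists v; apply: (@cvg_drop _ _ _ q.+1).
  apply: eq_cvgn Hv => t.
  have h1 : (q + 2 <= e * (q + 2))%N by rewrite leq_pmull.
  have E1 : (e * (t + q.+1 + 1) = e * t + e * (q + 2))%N.
    by rewrite -mulnDr; congr muln; lia.
  have E2 : (L * (t + q.+1 + 1) = L * t + L * (q + 2))%N.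
    by rewrite -mulnDr; congr muln; lia.
  rewrite /f2 /N E1 E2 ifT; last by lia.
  by congr b; lia.
have [h1 Hh1] := choice f1c; have [h2 Hh2] := choice f2c.
have [|s1 Hs1 _] := tannery th0 th1 (Q := fun t => (N t - e * (t + 1))%N) f1bd _ Hh1.
  by move=> t q Qq; rewrite /f1 ltnNge Qq.
have [|s2 Hs2 _] := tannery th0 th1 (Q := fun t => (e * (t + 1)).-1) f2bd _ Hh2.
  by move=> t q Qq; rewrite /f2 ltnNge Qq.
exists (s1 + s2); apply: eq_cvgn (seq_cvgD Hs1 Hs2) => t.
rewrite -/(N t) /row_sum (@sum_around (b i j (N t)) (e * (t + 1))%N (N t)); last first.
  by rewrite e1 /=; have := eLt t; rewrite /N; lia.
congr (_ + _); apply: eq_big_nat => q /andP[_ qQ].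
  by rewrite /f1 qQ.
by rewrite /f2 qQ.
Qed.

Lemma box_sum_cvg i j : (i < l)%N -> (j < l)%N ->
  exists v : R, (fun N => box_sum (b i j) N / N%:R) @ \oo --> v.
Proof.
move=> il jl; have L0 : (0 < l`!)%N by exact: fact_gt0.
have H r : exists v : R, (fun t => b i j (l`! * t + r)%N (l`! * t + r)%N +
    row_sum (b i j) (l`! * t + r) +
    row_sum (fun n m => b i j m n) (l`! * t + r)) @ \oo --> v.
  have [v1 H1] := bline i j r r L0 L0.
  have [v2 H2] := row_sum_cvg r il jl.
  have [v3 H3] := row_sum_cvg r jl il.
  exists (v1 + v2 + v3); apply: eq_cvgn (seq_cvgD (seq_cvgD H1 H2) H3) => t.
  by congr (_ + _); apply: eq_bigr => m _; rewrite bsym.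
have [v Hv] := choice H.
exists ((\sum_(0 <= r < l`!) v r) / (l`!)%:R).
by apply: box_sum_mean.
Qed.

(** Here the last component is read at times at least [l * M.+1], whereas the other
    components never go beyond [l.-1 * N <= l * M]. The gap between the two times grows
    with both [m - M] and [N - n], so the sum of all the covariances is bounded
    independently of [N]. *)
Lemma cross_sum_bound i M N : (i.+1 < l)%N -> (l.-1 * N <= l * M)%N ->
  `|\sum_(M.+1 <= m < N.+1) \sum_(1 <= n < N.+1) b i l.-1 n m| <= K * (2 * g ^+ 2).
Proof.
move=> il NM; have l0 : (0 < l)%N by lia.
have jl : (l.-1 < l)%N by rewrite prednK.
have il' : (i < l)%N by lia.
have Kp := K0 il' jl.
apply: le_trans (ler_norm_sum _ _ _) _.
apply: (@le_trans _ _ (\sum_(M.+1 <= m < N.+1) \sum_(1 <= n < N.+1)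
   K * (th ^+ (m - M.+1) * th ^+ (N - n) + th ^+ m * th ^+ n))).
  apply: ler_sum_nat => m /andP[Mm mN].
  apply: le_trans (ler_norm_sum _ _ _) _; apply: ler_sum_nat => n /andP[n1 nN].
  apply: (le_trans (bbd il' jl n1 (leq_ltn_trans (leq0n M) Mm))).
  rewrite ler_wpM2l// -!exprD [(m + n)%N]addnC lerD2r; apply: expr_le_expr => //.
  rewrite prednK//.
  have : (i.+1 * (N - n) <= l.-1 * N - i.+1 * n)%N.
    by rewrite mulnBr leq_sub2r// leq_mul2r; apply/orP; right; lia.
  have : (N - n <= i.+1 * (N - n))%N by rewrite leq_pmull.
  have : (l * (m - M) <= l * m - l * M)%N by rewrite mulnBr.
  have : (m - M <= l * (m - M))%N by rewrite leq_pmull.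
  have : (i.+1 * n <= l.-1 * N)%N by apply: leq_mul; lia.
  have : (l * M <= l * m)%N by rewrite leq_mul2l ltnW// orbT.
  rewrite /dist; lia.
under eq_bigr => m _ do rewrite -mulr_sumr big_split /= -!mulr_sumr.
rewrite -mulr_sumr ler_wpM2l// big_split /= -!mulr_suml.
have H1 : \sum_(M.+1 <= m < N.+1) th ^+ (m - M.+1) <= g.
  rewrite -{1}[M.+1]add0n big_addn.
  by under eq_bigr do rewrite addnK; exact: sum_th.
have H2 : \sum_(1 <= n < N.+1) th ^+ (N - n) <= g.
  rewrite big_nat_rev /= big_add1 /=.
  rewrite (eq_big_nat _ _ (F2 := fun k => th ^+ k)); first exact: sum_th.
  by move=> k /andP[_ kN]; congr (_ ^+ _); lia.
have H3 a N' : \sum_(a <= m < N') th ^+ m <= g.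
  apply: le_trans (geo_tail th0 th1 a N') _.
  by apply: ler_piMl; [exact: ltW|apply: exprn_ile1; exact: ltW].
rewrite (_ : 2 * g ^+ 2 = g * g + g * g); last by ring.
by apply: lerD; apply: ler_pM => //; exact: sumr_ge0.
Qed.

(** The positivity hypothesis says that [S - B] has a nonnegative second moment, where
    [S] is the total sum up to [N] and [B] the sum of the last components over [M < n <=
    N]. With [N = l * t] and [M = l.-1 * t], the block [B] is almost uncorrelated with
    the other components, by [cross_sum_bound]. Expanding the square leaves the second
    moment of [S] above the increment, between [M] and [N], of the variance of the sum
    of last components, up to a constant; divided by [l * t] this increment tends to [s
    / l]. *)
Lemma variance_lower_bound (sg s : R) : (0 < l)%N ->
  (forall M N, (M <= N)%N -> 0 <=
     \sum_(0 <= i < l) \sum_(0 <= j < l) box_sum (b i j) N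
     - 2 * (\sum_(0 <= i < l)
         \sum_(M.+1 <= m < N.+1) \sum_(1 <= n < N.+1) b i l.-1 n m)
     + \sum_(M.+1 <= m < N.+1) \sum_(M.+1 <= n < N.+1) b l.-1 l.-1 n m) ->
  (fun N => (\sum_(0 <= i < l) \sum_(0 <= j < l) box_sum (b i j) N) / N%:R)
    @ \oo --> sg ->
  (fun N => box_sum (b l.-1 l.-1) N / N%:R) @ \oo --> s ->
  s / l%:R <= sg.
Proof.
move=> l0 pos Hsg Hs.
pose D N := \sum_(0 <= i < l) \sum_(0 <= j < l) box_sum (b i j) N.
pose B := box_sum (b l.-1 l.-1).
pose C := l%:R * (K * (2 * g ^+ 2)).
have jl : (l.-1 < l)%N by rewrite prednK.
have Kp := K0 jl jl.
(* with S the sum of last components up to M and B the next block, the square of S + B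
   is S^2 + 2 S B + B^2 *)
have split1 M N : (M <= N)%N -> B N = B M +
    2 * (\sum_(M.+1 <= m < N.+1) \sum_(1 <= n < M.+1) b l.-1 l.-1 n m) +
    \sum_(M.+1 <= m < N.+1) \sum_(M.+1 <= n < N.+1) b l.-1 l.-1 n m.
  move=> MN; have M1 : (1 <= M.+1)%N by [].
  rewrite /B /box_sum (big_cat_nat (n := M.+1))//=.
  under eq_bigr => n _ do rewrite (big_cat_nat (n := M.+1) (m := 1%N))//=.
  under [X in _ + X]eq_bigr => n _ do rewrite (big_cat_nat (n := M.+1) (m := 1%N))//=.
  rewrite !big_split /= exchange_big /= [X in _ + X + _]exchange_big /=.
  set X1 := \sum_(1 <= i < M.+1) _; set X2 := \sum_(_ <= i < _) _.
  set X3 := \sum_(M.+1 <= i < N.+1) _; set X4 := \sum_(M.+1 <= i < N.+1) _.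
  have -> : X1 = \sum_(1 <= n < M.+1) \sum_(1 <= m < M.+1) b l.-1 l.-1 n m.
    by rewrite /X1 exchange_big.
  have -> : X3 = X2.
    by apply: eq_bigr => n _; apply: eq_bigr => m _; rewrite bsym.
  have -> : X4 = \sum_(M.+1 <= m < N.+1) \sum_(M.+1 <= n < N.+1) b l.-1 l.-1 n m.
    by apply: eq_bigr => n _; apply: eq_bigr => m _; rewrite bsym.
  ring.
have main t : - (2 * C) <= D (l * t)%N - B (l * t)%N + B (l.-1 * t)%N.
  have MN : (l.-1 * t <= l * t)%N by rewrite leq_mul2r leq_pred orbT.
  have := pos _ _ MN.
  rewrite (split1 _ _ MN) -/(D _).
  set M := (l.-1 * t)%N; set N := (l * t)%N.
  have E (G : nat -> R) : \sum_(0 <= i < l) G i = \sum_(0 <= i < l.-1) G i + G l.-1.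
    by rewrite -{1}(prednK l0) big_nat_recr.
  rewrite [X in 2 * X]E.
  under [X in 2 * (_ + X)]eq_bigr => m _ do rewrite (big_cat_nat (n := M.+1))//=.
  rewrite [X in 2 * (_ + X)]big_split /=.
  set S1 := \sum_(0 <= i < _) _; set X := \sum_(M.+1 <= m < _) _.
  set Z := \sum_(M.+1 <= m < _) _ => H.
  have : `|S1| <= C.
    apply: le_trans (ler_norm_sum _ _ _) _.
    apply: (@le_trans _ _ (\sum_(0 <= i < l.-1) K * (2 * g ^+ 2))).
      apply: ler_sum_nat => i /andP[_ il]; apply: cross_sum_bound; first by lia.
      by rewrite /N /M mulnCA.
    rewrite sumr_const_nat subn0 /C -[leLHS]mulr_natl ler_wpM2r ?ler_nat ?leq_pred//.
    by apply: mulr_ge0 => //; apply: mulr_ge0 => //; exact: sqr_ge0.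
  by rewrite ler_norml => /andP[h1 h2]; lra.
have lR : 0 < l%:R :> R by rewrite ltr0n.
have tl t : (t <= l * t)%N by rewrite leq_pmull.
have c1 : (fun t => D (l * t)%N / (l * t)%:R) @ \oo --> sg.
  exact: (cvg_subseq (f := fun t => (l * t)%N) tl Hsg).
have c2 : (fun t => B (l * t)%N / (l * t)%:R) @ \oo --> s.
  exact: (cvg_subseq (f := fun t => (l * t)%N) tl Hs).
have c3 : (fun t => B (l.-1 * t)%N / (l * t)%:R) @ \oo --> (l.-1)%:R / l%:R * s.
  have [lE|l1] := posnP l.-1.
    rewrite lE !mul0r; under eq_fun => t.
      rewrite mul0n /B /box_sum big_geq// mul0r; over.
    exact: cvg_cst.
  have c4 : (fun t => B (l.-1 * t)%N / (l.-1 * t)%:R) @ \oo --> s.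
    apply: (cvg_subseq (f := fun t => (l.-1 * t)%N) _ Hs) => t.
    by rewrite leq_pmull.
  apply: eq_cvgn (seq_cvgZ (k := (l.-1)%:R / l%:R) c4) => t.
  have l1R : (l.-1)%:R != 0 :> R by rewrite pnatr_eq0 -lt0n.
  have [->|t0] := posnP t; first by rewrite !muln0 invr0 !mulr0.
  have tR : t%:R != 0 :> R by rewrite pnatr_eq0 -lt0n.
  by rewrite !natrM; field; rewrite ?l1R ?tR ?lt0r_neq0.
have c5 : (fun t : nat => (- (2 * C) / l%:R) / t%:R) @ \oo --> (0 : R) by exact: cvg_inv_nat.
have lim := seq_cvgB (seq_cvgD (seq_cvgB c1 c2) c3) c5.
suff : 0 <= sg - s + (l.-1)%:R / l%:R * s - 0.
  rewrite subr0 -[in X in X -> _](prednK l0) -natr1.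
  rewrite -{3}(prednK l0) -natr1; move: (l.-1%:R : R) (ler0n R l.-1) => x x0.
  have x1 : x + 1 != 0 by rewrite lt0r_neq0// ltr_wpDl.
  rewrite (_ : sg - s + x / (x + 1) * s = sg - s / (x + 1)) ?subr_ge0//.
  by field.
apply: (cvgr_to_ge lim); near=> t.
rewrite -mulrBl -mulrDl -mulrA -invfM -natrM -mulrBl divr_ge0//.
by have := main t; lra.
Unshelve. all: by end_near. Qed.

Let lag_bound j n k : (j < l)%N -> (0 < n)%N ->
  `|b j j n (n + k)| <= 2 * K * th ^+ k.
Proof.
move=> jl n0; have Kp := K0 jl jl.
apply: (le_trans (bbd jl jl n0 (ltn_addr k n0))).
rewrite (_ : 2 * K * th ^+ k = K * (th ^+ k + th ^+ k)); last by ring.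
rewrite ler_wpM2l//; apply: lerD; apply: expr_le_expr => //.
  by rewrite mulnDr /dist; have : (k <= j.+1 * k)%N; rewrite ?leq_pmull//; lia.
by lia.
Qed.

Lemma stationary_bound j (c : nat -> R) : (j < l)%N ->
  (forall k, (fun n => b j j n (n + k)%N) @ \oo --> c k) ->
  forall k, `|c k| <= 2 * K * th ^+ k.
Proof.
move=> jl Hc k; apply: (cvgr_to_le (cvg_norm (Hc k))); near=> n.
have n0 : (0 < n)%N by near: n; exact: nbhs_infty_gt.
exact: lag_bound.
Unshelve. all: by end_near. Qed.

Lemma stationary_box_bound j (c : nat -> R) : (j < l)%N ->
  (forall k, (fun n => b j j n (n + k)%N) @ \oo --> c k) ->
  forall N, `|box_sum (fun n m => c (dist n m)) N| <= 4 * K * g * N%:R.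
Proof.
move=> jl Hc N; have Kp := K0 jl jl; have cbd := stationary_bound jl Hc.
apply: le_trans (ler_norm_sum _ _ _) _.
rewrite [leRHS]mulr_natr -[X in _ *+ X](subn0 N) -[X in _ *+ X](subSS 0 N).
rewrite -sumr_const_nat; apply: ler_sum_nat => n _.
apply: le_trans (ler_norm_sum _ _ _) _.
apply: (@le_trans _ _ (\sum_(0 <= m < N.+1) 2 * K * th ^+ dist n (1 * m))).
  rewrite [leRHS]big_nat_recl//= big_add1 /=.
  apply: (@le_trans _ _ (\sum_(0 <= m < N) 2 * K * th ^+ dist n (1 * m.+1))).
    by apply: ler_sum => m _; rewrite mul1n.
  by rewrite lerDr !mulr_ge0.
rewrite -mulr_sumr (_ : 4 * K * g = 2 * K * (2 * g)); last by ring.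
by rewrite ler_wpM2l ?mulr_ge0//; exact: geo_dist_sum.
Qed.

(** Replacing each covariance by its limit at the same lag changes the increments of the
    box sum by a quantity that tends to zero, by dominated convergence over the lags. *)
Lemma stationary_comparison j (c : nat -> R) (s : R) : (j < l)%N ->
  (forall k, (fun n => b j j n (n + k)%N) @ \oo --> c k) ->
  (fun N => box_sum (b j j) N / N%:R) @ \oo --> s ->
  (fun N => box_sum (fun n m => c (dist n m)) N / N%:R) @ \oo --> s.
Proof.
move=> jl Hc Hs; have Kp := K0 jl jl.
have cbd := stationary_bound jl Hc.
pose e n m := b j j n m - c (dist n m).
pose f t q := if (q < t.-1)%N then e t (t - q.+1)%N else 0.
have [|||r Hr H0] := tannery th0 th1 (C := 4 * K) (f := f) (h := fun _ => 0) (Q := predn).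
- move=> t q; rewrite /f; case: ifP => [qt|_]; last by rewrite normr0 !mulr_ge0.
  rewrite /e bsym; have -> : b j j (t - q.+1) t = b j j (t - q.+1) (t - q.+1 + q.+1).
    by congr b; lia.
  have -> : dist t (t - q.+1) = q.+1 by rewrite /dist; lia.
  apply: le_trans (ler_normB _ _) _.
  have h1 : `|b j j (t - q.+1) (t - q.+1 + q.+1)| <= 2 * K * th ^+ q.+1.
    by apply: lag_bound => //; lia.
  have h2 := cbd q.+1.
  have h3 : 2 * K * th ^+ q.+1 <= 2 * K * th ^+ q.
    by rewrite ler_wpM2l ?mulr_ge0//; apply: expr_le_expr.
  lra.
- by move=> t q tq; rewrite /f ltnNge tq.
- move=> q; apply: (@cvg_drop _ _ _ q.+2).
  have cc : (fun _ : nat => c q.+1) @ \oo --> c q.+1 by exact: cvg_cst.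
  have := seq_cvgB (cvg_subseq (f := fun n => (n + 1)%N) (fun n => leq_addr _ _) (Hc q.+1)) cc.
  rewrite subrr; apply: eq_cvgn => t.
  rewrite /f ifT; last by lia.
  rewrite /e bsym; congr (b _ _ _ _ - c _); rewrite /dist; lia.
have r0 : r = 0.
  have z : (fun _ : nat => 0 : R) @ \oo --> (0 : R) by exact: cvg_cst.
  have H00 : (fun M => \sum_(0 <= q < M) (0 : R)) @ \oo --> (0 : R).
    by apply: eq_cvgn z => M; rewrite big1.
  exact: (cvg_unique _ H0 H00).
rewrite {}r0 in Hr.
have row_e : (fun t => row_sum e t) @ \oo --> (0 : R).
  apply: (@cvg_drop _ _ _ 1).
  apply: eq_cvgn (cvg_subseq (f := fun n => (n + 1)%N) (fun n => leq_addr _ _) Hr) => t.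
  rewrite /row_sum (@sum_around (e (t + 1)%N) (t + 1)%N (t + 1)%N) ?leqnn ?addn1//.
  rewrite subnn [X in _ = X + _]big_geq// add0r.
  by apply: eq_big_nat => q /andP[_ qt]; rewrite /f qt.
have e_sym n m : e n m = e m n by rewrite /e bsym /dist addnC.
have He : (fun N => box_sum e N / N%:R) @ \oo --> (0 : R).
  have -> : (0 : R) = (\sum_(0 <= r < 1) (fun _ : nat => 0 : R) r) / 1%:R.
    by rewrite big_nat1 mul0r.
  apply: box_sum_mean => // -[|//] _.
  have cc : (fun _ : nat => c 0%N) @ \oo --> c 0%N by exact: cvg_cst.
  have h1 := seq_cvgB (Hc 0%N) cc.
  have := seq_cvgD (seq_cvgD h1 row_e) row_e; rewrite subrr !addr0.
  apply: eq_cvgn => t; rewrite mul1n addn0; congr (_ + _ + _).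
    by rewrite /e /dist subnn.
  by apply: eq_bigr => m _; rewrite e_sym.
have := seq_cvgB Hs He; rewrite subr0; apply: eq_cvgn => N.
rewrite -mulrBl; congr (_ / _).
rewrite /box_sum -sumrB; apply: eq_bigr => n _.
by rewrite -sumrB; apply: eq_bigr => m _; rewrite /e opprB addrC subrK.
Unshelve. all: by end_near. Qed.

End covariance_arrays.

(** * Square integrable and finite-valued variables *)

Section square_integrable.
Context d (T : measurableType d) (R : realType) (P : probability T R).
Implicit Types (Y Z : T -> R).

Definition L1 Z : Prop := P.-integrable setT (EFin \o Z).

(** The integral of the square is extended-real valued here, whereas [E] below is real
    valued and carries no information when the function is not integrable. *)
Definition sqint Z : Prop :=
  measurable_fun setT Z /\ (\int[P]_w ((Z w) ^+ 2)%:E < +oo)%E.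

Local Notation E Z := (\int[P]_w Z w).

Lemma L1_measurable Z : L1 Z -> measurable_fun setT Z.
Proof. by move=> /integrableP[mZ _]; exact/measurable_EFinP. Qed.

Lemma L1_le Y Z : measurable_fun setT Y -> (forall w, `|Y w| <= Z w) -> L1 Z -> L1 Y.
Proof.
move=> mY YZ; apply: le_integrable => //; first exact/measurable_EFinP.
move=> w _ /=; rewrite lee_fin; apply: (le_trans (YZ w)); exact: ler_norm.
Qed.

Lemma L1_cst (c : R) : L1 (fun _ => c).
Proof. exact: finite_measure_integrable_cst. Qed.

Lemma L1D Y Z : L1 Y -> L1 Z -> L1 (fun w => Y w + Z w).
Proof.
move=> iY iZ; rewrite /L1.
have -> : EFin \o (fun w => Y w + Z w) = (EFin \o Y) \+ (EFin \o Z) by [].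
exact: integrableD.
Qed.

Lemma L1Zl (c : R) Z : L1 Z -> L1 (fun w => c * Z w).
Proof.
move=> iZ; rewrite /L1.
have -> : EFin \o (fun w => c * Z w) = (fun w => c%:E * (EFin \o Z) w)%E by [].
exact: integrableZl.
Qed.

Lemma L1B Y Z : L1 Y -> L1 Z -> L1 (fun w => Y w - Z w).
Proof.
move=> iY iZ; have := L1D iY (L1Zl (-1) iZ); congr L1.
by apply/funext => w; rewrite mulN1r.
Qed.

Lemma L1_sum I (r : seq I) (F : I -> T -> R) :
  (forall i, L1 (F i)) -> L1 (fun w => \sum_(i <- r) F i w).
Proof.
move=> iF; elim: r => [|i r IH].
  by under eq_fun do rewrite big_nil; exact: L1_cst.
by under eq_fun do rewrite big_cons; exact: L1D.
Qed.

Lemma E_cst (c : R) : E (fun _ : T => c) = c.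
Proof.
rewrite Rintegral_cst// -[RHS]mulr1; congr (_ * _).
exact: (congr1 fine (@probability_setT _ _ _ P)).
Qed.

Lemma E_D Y Z : L1 Y -> L1 Z -> E (fun w => Y w + Z w) = E Y + E Z.
Proof. by move=> iY iZ; exact: RintegralD. Qed.

Lemma E_B Y Z : L1 Y -> L1 Z -> E (fun w => Y w - Z w) = E Y - E Z.
Proof. by move=> iY iZ; exact: RintegralB. Qed.

Lemma E_Zl (c : R) Z : L1 Z -> E (fun w => c * Z w) = c * E Z.
Proof. by move=> iZ; exact: RintegralZl. Qed.

Lemma E_sum I (r : seq I) (F : I -> T -> R) : (forall i, L1 (F i)) ->
  E (fun w => \sum_(i <- r) F i w) = \sum_(i <- r) E (F i).
Proof.
move=> iF; elim: r => [|i r IH].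
  rewrite big_nil; under eq_Rintegral do rewrite big_nil.
  exact: E_cst.
rewrite big_cons; under eq_Rintegral do rewrite big_cons.
by rewrite E_D// ?IH//; exact: L1_sum.
Qed.

Lemma E_ge0 Z : (forall w, 0 <= Z w) -> 0 <= E Z.
Proof. by move=> Z0; exact: Rintegral_ge0. Qed.

Lemma E_le Y Z : L1 Y -> L1 Z -> (forall w, Y w <= Z w) -> E Y <= E Z.
Proof. by move=> iY iZ YZ; exact: le_Rintegral. Qed.

Lemma E_norm_le Y Z : L1 Y -> L1 Z -> (forall w, `|Y w| <= Z w) -> `|E Y| <= E Z.
Proof.
move=> iY iZ YZ; rewrite ler_norml -[X in X <= _](mulN1r (E Z)) -E_Zl//.
apply/andP; split; apply: E_le => //; first exact: L1Zl.
  by move=> w; have := YZ w; rewrite ler_norml mulN1r => /andP[].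
by move=> w; apply: le_trans (YZ w); exact: ler_norm.
Qed.

Lemma sqint_sqr Z : sqint Z -> L1 (fun w => Z w ^+ 2).
Proof.
move=> [mZ Zoo]; apply/integrableP; split.
  by apply/measurable_EFinP; exact: measurable_funX.
by under eq_integral => w _ do rewrite /= ger0_norm ?sqr_ge0//.
Qed.

Lemma sqr_sqint Z : measurable_fun setT Z -> L1 (fun w => Z w ^+ 2) -> sqint Z.
Proof.
move=> mZ /integrableP[_]; split => //.
by under [X in (X < _)%E]eq_integral => w _ do
  rewrite -[X in X%:E](ger0_norm (sqr_ge0 _)).
Qed.

Lemma sqint_le Z Y : measurable_fun setT Y ->
  (forall w, Y w ^+ 2 <= Z w ^+ 2) -> sqint Z -> sqint Y.
Proof.
move=> mY YZ sZ; apply: sqr_sqint => //.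
apply: L1_le (sqint_sqr sZ); first exact: measurable_funX.
by move=> w; rewrite ger0_norm ?sqr_ge0.
Qed.

Lemma sqintM Y Z : sqint Y -> sqint Z -> L1 (fun w => Y w * Z w).
Proof.
move=> sY sZ; apply: L1_le (L1D (sqint_sqr sY) (sqint_sqr sZ)).
  by apply: measurable_funM; [exact: sY.1|exact: sZ.1].
move=> w; rewrite ler_norml; apply/andP; split; nra.
Qed.

Lemma sqint_cst (c : R) : sqint (fun _ => c).
Proof. by apply: sqr_sqint => //; exact: L1_cst. Qed.

Lemma sqint_L1 Z : sqint Z -> L1 Z.
Proof.
move=> sZ; have := sqintM sZ (sqint_cst 1); congr L1.
by apply/funext => w; rewrite mulr1.
Qed.

Lemma sqintD Y Z : sqint Y -> sqint Z -> sqint (fun w => Y w + Z w).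
Proof.
move=> sY sZ; apply: sqr_sqint.
  by apply: measurable_funD; [exact: sY.1|exact: sZ.1].
have := L1D (L1D (sqint_sqr sY) (sqint_sqr sZ)) (L1Zl 2 (sqintM sY sZ)).
by congr L1; apply/funext => w; ring.
Qed.

Lemma sqintZl (c : R) Z : sqint Z -> sqint (fun w => c * Z w).
Proof.
move=> sZ; apply: sqr_sqint; first by apply: measurable_funM => //; exact: sZ.1.
by have := L1Zl (c ^+ 2) (sqint_sqr sZ); congr L1; apply/funext => w; ring.
Qed.

Lemma sqintB Y Z : sqint Y -> sqint Z -> sqint (fun w => Y w - Z w).
Proof.
move=> sY sZ; have := sqintD sY (sqintZl (-1) sZ); congr sqint.
by apply/funext => w; rewrite mulN1r.
Qed.

Lemma sqint_sum I (r : seq I) (F : I -> T -> R) :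
  (forall i, sqint (F i)) -> sqint (fun w => \sum_(i <- r) F i w).
Proof.
move=> iF; elim: r => [|i r IH].
  by under eq_fun do rewrite big_nil; exact: sqint_cst.
by under eq_fun do rewrite big_cons; exact: sqintD.
Qed.

Lemma E_sqr_ge0 Z : 0 <= E (fun w => Z w ^+ 2).
Proof. by apply: E_ge0 => w; exact: sqr_ge0. Qed.

Lemma EFin_E_sqr Z : sqint Z ->
  (\int[P]_w ((Z w) ^+ 2)%:E)%E = (E (fun w => Z w ^+ 2))%:E.
Proof. by move=> sZ; rewrite fineK//; exact: integrable_fin_num (sqint_sqr sZ). Qed.

Lemma E_sqrD_le Y Z : sqint Y -> sqint Z ->
  E (fun w => (Y w + Z w) ^+ 2) <= 2 * E (fun w => Y w ^+ 2) + 2 * E (fun w => Z w ^+ 2).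
Proof.
move=> sY sZ; have iY := sqint_sqr sY; have iZ := sqint_sqr sZ.
rewrite -!E_Zl// -E_D//; [|exact: L1Zl..].
apply: E_le => //; first exact: (sqint_sqr (sqintD sY sZ)).
  by apply: L1D; exact: L1Zl.
by move=> w; have := sqr_ge0 (Y w - Z w); rewrite !expr2; lra.
Qed.

Lemma E_sqrB_le X Y Z : sqint X -> sqint Y -> sqint Z ->
  E (fun w => (X w - Z w) ^+ 2) <=
  2 * E (fun w => (X w - Y w) ^+ 2) + 2 * E (fun w => (Y w - Z w) ^+ 2).
Proof.
move=> sX sY sZ; apply: le_trans (E_sqrD_le (sqintB sX sY) (sqintB sY sZ)).
rewrite le_eqVlt; apply/orP; left; apply/eqP.
by apply: eq_Rintegral => w _; rewrite subrKA.
Qed.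

Lemma sqr_E_le Z : sqint Z -> E Z ^+ 2 <= E (fun w => Z w ^+ 2).
Proof.
move=> sZ; have iZ := sqint_L1 sZ; have i2 := sqint_sqr sZ.
have := E_sqr_ge0 (fun w => Z w - E Z).
have -> : E (fun w => (Z w - E Z) ^+ 2) =
    E (fun w => Z w ^+ 2 - (2 * E Z) * Z w + E Z ^+ 2).
  by apply: eq_Rintegral => w _; ring.
rewrite E_D; [|apply: L1B => //; exact: L1Zl|exact: L1_cst].
rewrite E_B//; last exact: L1Zl.
rewrite E_Zl// E_cst => h; rewrite -subr_ge0; apply: le_trans h _.
by rewrite le_eqVlt; apply/orP; left; apply/eqP; ring.
Qed.

Lemma E_sqr_sum I (r : seq I) (F : I -> T -> R) : (forall i, sqint (F i)) ->
  E (fun w => (\sum_(i <- r) F i w) ^+ 2) =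
  \sum_(i <- r) \sum_(j <- r) E (fun w => F i w * F j w).
Proof.
move=> sF; transitivity (E (fun w => \sum_(i <- r) \sum_(j <- r) F i w * F j w)).
  apply: eq_Rintegral => w _; rewrite expr2 mulr_suml.
  by apply: eq_bigr => i _; rewrite mulr_sumr.
rewrite E_sum; last by move=> i; apply: L1_sum => j; exact: sqintM.
by apply: eq_bigr => i _; rewrite E_sum// => j; exact: sqintM.
Qed.

Lemma E_sum_mul I J (r : seq I) (s : seq J) (F : I -> T -> R) (G : J -> T -> R) :
  (forall i, sqint (F i)) -> (forall j, sqint (G j)) ->
  E (fun w => (\sum_(i <- r) F i w) * (\sum_(j <- s) G j w)) =
  \sum_(i <- r) \sum_(j <- s) E (fun w => F i w * G j w).
Proof.
move=> sF sG; transitivity (E (fun w => \sum_(i <- r) \sum_(j <- s) F i w * G j w)).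
  apply: eq_Rintegral => w _; rewrite mulr_suml.
  by apply: eq_bigr => i _; rewrite mulr_sumr.
rewrite E_sum; last by move=> i; apply: L1_sum => j; exact: sqintM.
by apply: eq_bigr => i _; rewrite E_sum// => j; exact: sqintM.
Qed.

End square_integrable.

Section finite_valued.
Context d (T : measurableType d) (R : realType) (P : probability T R).

Definition finite_valued (J : finType) (U : T -> J) : Prop :=
  forall j, measurable (U @^-1` [set j]).

Definition mass (J : finType) (U : T -> J) (j : J) : R := fine (P (U @^-1` [set j])).

Local Notation E Z := (\int[P]_w Z w).

Lemma mass_ge0 (J : finType) (U : T -> J) j : 0 <= mass U j.
Proof. by rewrite fine_ge0. Qed.

(** Finite-valued variables have finite combinations of indicators as real functions,
    which reduces their moments to probabilities. *)
Lemma finite_valuedE (J : finType) (U : T -> J) (f : J -> R) w :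
  f (U w) = \sum_j f j * \1_(U @^-1` [set j]) w.
Proof.
rewrite (bigD1 (U w))//= indicE mem_set// mulr1 big1 ?addr0// => j jU.
rewrite indicE memNset ?mulr0// => /= Uj.
by rewrite Uj eqxx in jU.
Qed.

Lemma indic_L1 (A : set T) : measurable A -> L1 P (\1_A : T -> R).
Proof. by move=> mA; exact: integrable_indic. Qed.

Lemma finite_valued_L1 (J : finType) (U : T -> J) (f : J -> R) :
  finite_valued U -> L1 P (fun w => f (U w)).
Proof.
move=> fU; under eq_fun do rewrite finite_valuedE.
by apply: L1_sum => j; apply: L1Zl; exact: indic_L1.
Qed.

Lemma finite_valued_sqint (J : finType) (U : T -> J) (f : J -> R) :
  finite_valued U -> sqint P (fun w => f (U w)).
Proof.
move=> fU; apply: sqr_sqint; first by apply: (@L1_measurable _ _ _ P); exact: finite_valued_L1.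
exact: (finite_valued_L1 (fun j => f j ^+ 2)).
Qed.

Lemma E_finite_valued (J : finType) (U : T -> J) (f : J -> R) : finite_valued U ->
  E (fun w => f (U w)) = \sum_j f j * mass U j.
Proof.
move=> fU; under eq_Rintegral do rewrite finite_valuedE.
rewrite E_sum; last by move=> j; apply: L1Zl; exact: indic_L1.
apply: eq_bigr => j _; rewrite E_Zl; last exact: indic_L1.
by rewrite /Rintegral integral_indic// setIT.
Qed.

End finite_valued.

(** * Covariances of a discretized process *)

Section discretized_process.
Context d (Omega : measurableType d) d' (X : measurableType d') (R : realType).
Variables (P : probability Omega R) (xi : nat -> {RV P >-> X}).
Variables (mu : probability X R) (l : nat) (c th : R).
Hypotheses (c_ge0 : 0 <= c) (th0 : 0 < th) (th1 : th < 1).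

(** The factor [l.+1] in the exponent is chosen so that a gap of [n] between times
    produces a bound in [th ^+ (n + k)] for every [k <= l * n], which is the second term
    of [component_covariance_bound]. *)
Definition rate (m : nat) : R := c * th ^+ (l.+1 * m).

Hypothesis mp : mixing_process xi mu rate.

Local Notation E Z := (\int[P]_w Z w).
Local Notation pr A := (fine (P A)).

Let rate_ge0 m : 0 <= rate m.
Proof. by rewrite mulr_ge0// exprn_ge0// ltW. Qed.

Let rate_le m : rate m <= c.
Proof. by rewrite /rate ler_piMr// exprn_ile1// ltW. Qed.

Lemma rate_cvg0 : rate @ \oo --> (0 : R).
Proof.
rewrite -[X in _ --> X](mulr0 c); apply: (seq_cvgZ (u := fun m => th ^+ (l.+1 * m))).
apply: (cvg_squeeze0 (v := fun m => th ^+ m)); last exact: expr_cvg0.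
move=> m; rewrite ger0_norm; last by rewrite exprn_ge0// ltW.
by apply: expr_le_expr => //; exact: leq_pmull.
Qed.

Definition domination_constant : R := (1 + c) ^+ l.

Let C := domination_constant.

Lemma domination_constant_ge0 : 0 <= C.
Proof. by rewrite exprn_ge0// addr_ge0. Qed.

(** The last of the times [n, 2 n, ..., l n] is at distance [n] from the others; each
    application of mixing detaches it at the price of a factor [1 + c]. *)
Lemma progression_domination n (A : 'I_l -> set X) : (0 < n)%N ->
  (forall a, measurable (A a)) ->
  pr (event xi predT (fun a : 'I_l => a.+1 * n)%N A) <= C * \prod_a fine (mu (A a)).
Proof.
move=> n0 mA.
pose ev k := event xi (fun a : 'I_l => a < k)%N (fun a : 'I_l => a.+1 * n)%N A.
have mu0 a : 0 <= fine (mu (A a)) by rewrite fine_ge0.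
suff H k : (k <= l)%N ->
    pr (ev k) <= (1 + c) ^+ k * \prod_(a < l | (a < k)%N) fine (mu (A a)).
  have -> : event xi predT (fun a : 'I_l => a.+1 * n)%N A = ev l.
    apply/seteqP; split => w Hw a Ha; apply: Hw => //; exact: ltn_ord.
  apply: (le_trans (H l (leqnn l))); rewrite le_eqVlt; apply/orP; left; apply/eqP.
  by congr (_ * _); apply: eq_bigl => a; rewrite ltn_ord.
elim: k => [_|k IH kl].
  rewrite expr0 mul1r big_pred0// pr_le1//; exact: measurable_event.
pose ak := Ordinal kl.
have evS : ev k.+1 = ev k `&` xi (k.+1 * n)%N @^-1` A ak.
  apply/seteqP; split => w.
    by move=> H; split; [move=> a ak'; apply: H; exact: ltnW|exact: (H ak (leqnn _))].
  move=> [H1 H2] a; rewrite ltnS leq_eqVlt => /orP[/eqP aE|]; last exact: H1.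
  by have -> : a = ak by exact: val_inj.
have prk : pr (xi (k.+1 * n)%N @^-1` A ak) = fine (mu (A ak)) by rewrite (process_law mp).
have sG : sigma_process xi [set j | (j <= k * n)%N] (ev k).
  apply: sigma_process_event => // a /= ak'.
  by rewrite leq_mul2r; apply/orP; right.
have sH : sigma_process xi [set j | (k * n + n <= j)%N] (xi (k.+1 * n)%N @^-1` A ak).
  by apply: sigma_process_preimage => //=; rewrite mulSn addnC.
have := process_mixing mp n0 sG sH.
rewrite -evS prk ler_norml => /andP[_ H].
rewrite (bigD1 ak)//= (eq_bigl (fun a : 'I_l => a < k)%N); last first.
  move=> a; rewrite ltnS -val_eqE /= leq_eqVlt; case: eqP => [->|] //=.
    by rewrite ltnn.
  by rewrite andbT.
have {}IH := IH (ltnW kl).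
have p0 := pr_ge0 P (ev k).
have pq0 := mulr_ge0 p0 (mu0 ak).
apply: (@le_trans _ _ ((1 + c) * (pr (ev k) * fine (mu (A ak))))).
  by have := ler_wpM2r pq0 (rate_le n); rewrite mulrDl mul1r; lra.
rewrite exprS -!mulrA ler_wpM2l ?addr_ge0//.
rewrite [X in _ <= _ * X]mulrC mulrA ler_wpM2r//.
Qed.

Variables (I : finType) (g : X -> I).
Hypothesis mg : forall i, measurable (g @^-1` [set i]).

Definition state_mass (v : I) : R := fine (mu (g @^-1` [set v])).

Local Notation m := state_mass.

Lemma state_mass_ge0 v : 0 <= m v. Proof. by rewrite fine_ge0. Qed.

Lemma state_mass_sum1 : \sum_v m v = 1.
Proof.
have := E_finite_valued mu (fun _ => 1) mg; rewrite E_cst => ->.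
by apply: eq_bigr => v _; rewrite mul1r.
Qed.

Let m_ge0 := state_mass_ge0.
Let m_sum1 := state_mass_sum1.

Definition adapted (J : finType) (D : set nat) (U : Omega -> J) : Prop :=
  forall j, sigma_process xi D (U @^-1` [set j]).

Lemma adapted_finite_valued (J : finType) D (U : Omega -> J) :
  adapted D U -> finite_valued U.
Proof. by move=> aU j; exact: sigma_process_measurable (aU j). Qed.

Lemma pair_preimage (J K : finType) (U : Omega -> J) (V : Omega -> K) u v :
  (fun w => (U w, V w)) @^-1` [set (u, v)] = U @^-1` [set u] `&` V @^-1` [set v].
Proof. by apply/seteqP; split => w /= [-> ->]. Qed.

Lemma finite_valued_pair (J K : finType) (U : Omega -> J) (V : Omega -> K) :
  finite_valued U -> finite_valued V -> finite_valued (fun w => (U w, V w)).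
Proof. by move=> fU fV [u v]; rewrite pair_preimage; exact: measurableI. Qed.

Lemma adapted_pair (J K : finType) D (U : Omega -> J) (V : Omega -> K) :
  adapted D U -> adapted D V -> adapted D (fun w => (U w, V w)).
Proof.
move=> aU aV [u v]; rewrite pair_preimage.
pose T' := g_sigma_algebraType
  (\bigcup_(j in D) preimage_set_system setT (xi j) measurable).
exact: (@measurableI _ T' _ _ (aU u) (aV v)).
Qed.

Definition states (tm : 'I_l -> nat) (w : Omega) : {ffun 'I_l -> I} :=
  [ffun a => g (xi (tm a) w)].

Definition sample (f : {ffun 'I_l -> I} -> R) (n : nat) (w : Omega) : R :=
  f (states (fun a => a.+1 * n)%N w).

Lemma states_preimage tm x : states tm @^-1` [set x] =
  event xi predT tm (fun a => g @^-1` [set x a]).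
Proof.
apply/seteqP; split => w /=.
  by move=> <- a _; rewrite ffunE.
by move=> H; apply/ffunP => a; rewrite ffunE; exact: H.
Qed.

Lemma adapted_states D tm : (forall a, D (tm a)) -> adapted D (states tm).
Proof. by move=> Dtm x; rewrite states_preimage; exact: sigma_process_event. Qed.

Lemma adapted_state D t : D t -> adapted D (fun w => g (xi t w)).
Proof.
move=> Dt v; have := sigma_process_preimage (xi := fun n => xi n) Dt (mg v).
exact.
Qed.

Lemma mass_state t v : mass P (fun w => g (xi t w)) v = m v.
Proof. by congr fine; exact: (process_law mp). Qed.

Lemma mixing_mass (J K : finType) n k (U : Omega -> J) (V : Omega -> K) u v :
  (0 < k)%N -> adapted [set j | (j <= n)%N] U ->
  adapted [set j | (n + k <= j)%N] V ->
  `|mass P (fun w => (U w, V w)) (u, v) - mass P U u * mass P V v| <=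
  rate k * (mass P U u * mass P V v).
Proof.
by move=> k0 aU aV; rewrite /mass pair_preimage; exact: (process_mixing mp).
Qed.

(** Summing the relative error of the mixing inequality over all pairs of values bounds
    the error by an expectation of [`|H|] under the product law. *)
Lemma mixing_expectation (J K : finType) n k (U : Omega -> J) (V : Omega -> K)
    (H : J -> K -> R) :
  (0 < k)%N -> adapted [set j | (j <= n)%N] U ->
  adapted [set j | (n + k <= j)%N] V ->
  `|E (fun w => H (U w) (V w)) - \sum_u \sum_v H u v * (mass P U u * mass P V v)| <=
  rate k * \sum_u \sum_v `|H u v| * (mass P U u * mass P V v).
Proof.
move=> k0 aU aV.
have fUV := finite_valued_pair (adapted_finite_valued aU) (adapted_finite_valued aV).
have -> : E (fun w => H (U w) (V w)) =
    \sum_u \sum_v H u v * mass P (fun w => (U w, V w)) (u, v).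
  rewrite (E_finite_valued P (fun z => H z.1 z.2) fUV).
  by rewrite pair_big; apply: eq_bigr => -[].
rewrite -sumrB mulr_sumr; apply: le_trans (ler_norm_sum _ _ _) _.
apply: ler_sum => u _; rewrite -sumrB mulr_sumr; apply: le_trans (ler_norm_sum _ _ _) _.
apply: ler_sum => v _; rewrite -mulrBr normrM mulrCA ler_wpM2l//.
exact: mixing_mass.
Qed.

(** Up to [T] lie all the coordinates of the sample before the [i]-th one, and [U].
    Replacing the joint law by the product law makes the expectation vanish, since [f]
    is centered in its [i]-th coordinate; the error is controlled by the expectation of
    [|f h|] under the product law, and the mean square of [f] under that law is at most
    twice the actual one when the rate is at most 1/2. If the rate is larger than 1/2,
    the bound follows from the inequality between arithmetic and geometric means. *)
Lemma covariance_bound (i : 'I_l) (f : {ffun 'I_l -> I} -> R) n T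
    (J : finType) (U : Omega -> J) (h : J -> R) :
  depends_upto i f -> centered_at m i f -> (i * n <= T)%N -> (T < i.+1 * n)%N ->
  adapted [set j | (j <= T)%N] U ->
  `|E (fun w => sample f n w * h (U w))| <=
  rate (i.+1 * n - T) *
    (E (fun w => sample f n w ^+ 2) + E (fun w => h (U w) ^+ 2)).
Proof.
move=> depf cenf inT Tin aU; set Y := sample f n; set k := (i.+1 * n - T)%N.
have k0 : (0 < k)%N by rewrite subn_gt0.
(* the minimum reads the coordinates from i on at time i n, so that W is adapted
   to the past of T; f ignores those beyond i, and update supplies the i-th *)
pose W := states (fun a => minn (a.+1 * n) (i * n)).
pose V w := g (xi (i.+1 * n) w).
have aW : adapted [set j | (j <= T)%N] W.
  by apply: adapted_states => a /=; apply: leq_trans (geq_minr _ _) inT.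
have aV : adapted [set j | (T + k <= j)%N] V.
  by apply: adapted_state => /=; rewrite /k; lia.
have YE w : Y w = f (update i (V w) (W w)).
  apply: depf => a ai; rewrite !ffunE; case: eqP => [->//|/eqP ai'].
  have {}ai : (a < i)%N by rewrite ltn_neqAle ai andbT.
  by rewrite (minn_idPl _)// leq_mul2r ai orbT.
have aWU := adapted_pair aW aU.
have fV := adapted_finite_valued aV; have fWU := adapted_finite_valued aWU.
have fUV := finite_valued_pair fWU fV.
have sY : sqint P Y.
  have := finite_valued_sqint P (fun z => f (update i z.2 z.1.1)) fUV.
  by congr sqint; apply/funext => w; rewrite YE.
have sh : sqint P (fun w => h (U w)).
  exact: finite_valued_sqint (adapted_finite_valued aU).
have e1 := E_sqr_ge0 P Y; have e2 := E_sqr_ge0 P (fun w => h (U w)).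
have [k12|k12] := leP (rate k) (1 / 2); last first.
  apply: (@le_trans _ _ (E (fun w => 1 / 2 * (Y w ^+ 2 + h (U w) ^+ 2)))).
    apply: E_norm_le; first exact: sqintM.
      by apply: L1Zl; apply: L1D; exact: sqint_sqr.
    move=> w; rewrite ler_norml; have := sqr_ge0 (Y w - h (U w)).
    have := sqr_ge0 (Y w + h (U w)); rewrite !expr2 => h1 h2.
    by apply/andP; split; lra.
  rewrite E_Zl; last by apply: L1D; exact: sqint_sqr.
  rewrite E_D; [|exact: sqint_sqr..].
  by apply: ler_wpM2r; [exact: addr_ge0|exact: ltW].
pose M u v := mass P (fun w => (W w, U w)) u * mass P V v.
have M0 u v : 0 <= M u v by rewrite mulr_ge0 ?mass_ge0.
have main := mixing_expectation (fun u v => f (update i v u.1) * h u.2) k0 aWU aV.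
have zero : \sum_u \sum_v f (update i v u.1) * h u.2 * M u v = 0.
  rewrite big1// => u _.
  rewrite (eq_bigr (fun v => (h u.2 * mass P (fun w => (W w, U w)) u) *
     (m v * f (update i v u.1)))).
    by rewrite -mulr_sumr cenf mulr0.
  by move=> v _; rewrite /M mass_state; ring.
rewrite -/(M _ _) in main.
have {main} : `|E (fun w => Y w * h (U w))| <=
    rate k * \sum_u \sum_v `|f (update i v u.1) * h u.2| * M u v.
  apply: le_trans main; rewrite zero subr0 le_eqVlt; apply/orP; left; apply/eqP.
  by congr (`| _ |); apply: eq_Rintegral => w _; rewrite YE.
move=> /le_trans; apply; apply: ler_wpM2l => //.
have q1 : \sum_u \sum_v f (update i v u.1) ^+ 2 * M u v <= 2 * E (fun w => Y w ^+ 2).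
  have := mixing_expectation (fun u v => f (update i v u.1) ^+ 2) k0 aWU aV.
  have -> : E (fun w => f (update i (V w) (W w, U w).1) ^+ 2) = E (fun w => Y w ^+ 2).
    by apply: eq_Rintegral => w _; rewrite YE.
  have -> : \sum_u \sum_v `|f (update i v u.1) ^+ 2| *
      (mass P (fun w => (W w, U w)) u * mass P V v) =
      \sum_u \sum_v f (update i v u.1) ^+ 2 * M u v.
    by apply: eq_bigr => u _; apply: eq_bigr => v _; rewrite ger0_norm ?sqr_ge0.
  rewrite -/(M _ _) ler_norml; set s := \sum_u _ => /andP[h1 _].
  have s0 : 0 <= s by do 2 (apply: sumr_ge0 => ? _); rewrite mulr_ge0 ?sqr_ge0.
  have := ler_wpM2r s0 k12; lra.
have q2 : \sum_u \sum_v h u.2 ^+ 2 * M u v = E (fun w => h (U w) ^+ 2).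
  rewrite (E_finite_valued P (fun z => h z.2 ^+ 2) fWU); apply: eq_bigr => u _.
  have s1 : \sum_v mass P V v = 1.
    by rewrite -m_sum1; apply: eq_bigr => v _; rewrite mass_state.
  rewrite -[RHS]mulr1 -s1 mulr_sumr; apply: eq_bigr => v _.
  by rewrite /M mulrA.
rewrite -q2.
apply: (@le_trans _ _ (1 / 2 * (\sum_u \sum_v f (update i v u.1) ^+ 2 * M u v +
    \sum_u \sum_v h u.2 ^+ 2 * M u v))).
  rewrite -big_split mulr_sumr; apply: ler_sum => u _ /=.
  rewrite -big_split mulr_sumr; apply: ler_sum => v _ /=.
  rewrite -mulrDl [leRHS]mulrA; apply: ler_wpM2r => //; rewrite ler_norml.
  have := sqr_ge0 (f (update i v u.1) - h u.2).
  have := sqr_ge0 (f (update i v u.1) + h u.2); rewrite !expr2 => h1 h2.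
  by apply/andP; split; lra.
have : 0 <= \sum_u \sum_v h u.2 ^+ 2 * M u v.
  by do 2 (apply: sumr_ge0 => ? _); rewrite mulr_ge0 ?sqr_ge0.
lra.
Qed.

Lemma finite_valued_states tm : finite_valued (states tm).
Proof. by apply: (@adapted_finite_valued _ setT); exact: adapted_states. Qed.

Lemma sqint_sample f n : sqint P (sample f n).
Proof. exact: finite_valued_sqint (finite_valued_states _). Qed.

Lemma sample_domination f n : (0 < n)%N ->
  E (fun w => sample f n w ^+ 2) <= C * normsq m f.
Proof.
move=> n0; have fst := finite_valued_states (fun a : 'I_l => a.+1 * n)%N.
rewrite (E_finite_valued P (fun x => f x ^+ 2) fst) /normsq mulr_sumr.
apply: ler_sum => x _; rewrite [leRHS]mulrA [leRHS]mulrC ler_wpM2l ?sqr_ge0//.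
by rewrite /mass states_preimage; exact: progression_domination.
Qed.

Definition covariance_seq f h n k : R := E (fun w => sample f n w * sample h k w).

Local Notation cov := covariance_seq.

Lemma covariance_seqC f h n k : cov f h n k = cov h f k n.
Proof. by apply: eq_Rintegral => w _; rewrite mulrC. Qed.

Variable phi : {ffun 'I_l -> I} -> R.

Local Notation comp i := (component m i phi).

Definition covariance_constant : R := 8 * (c + 1) * C.

Let K := covariance_constant.

Lemma covariance_constant_ge0 : 0 <= K.
Proof. by rewrite !mulr_ge0 ?addr_ge0 ?domination_constant_ge0. Qed.

Let comp_domination i n : (0 < n)%N ->
  E (fun w => sample (comp i) n w ^+ 2) <= 4 * C * normsq m phi.
Proof.
move=> n0; apply: le_trans (sample_domination _ n0) _.
rewrite (_ : 4 * C * _ = C * (4 * normsq m phi)); last by ring.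
by rewrite ler_wpM2l ?domination_constant_ge0//; exact: normsq_component.
Qed.

(** The latest time [i.+1 * n] belongs to the first sample. Its distance to the other
    times is either the distance to [j.+1 * k] or, if that sample is over by time [i *
    n], the step [n]. *)
Let covariance_bound_lt i j n k : (i < l)%N -> (j < l)%N -> (0 < n)%N -> (0 < k)%N ->
  (j.+1 * k < i.+1 * n)%N ->
  `|cov (comp i) (comp j) n k| <=
  K * normsq m phi * (th ^+ dist (i.+1 * n) (j.+1 * k) + th ^+ (n + k)).
Proof.
move=> il jl n0 k0 ji.
pose T := maxn (i * n) (j.+1 * k).
(* component j ignores the coordinates after j, which are read at an earlier time *)
pose U := states (fun b => minn (b.+1 * k) (j.+1 * k)).
have UE w : sample (comp j) k w = comp j (U w).
  have D : depends_upto (Ordinal jl) (comp j) := @depends_component _ _ _ m (Ordinal jl) phi.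
  rewrite /sample; apply: D => b bj; rewrite !ffunE.
  by rewrite (minn_idPl _)// leq_mul2r ltnS bj orbT.
have := covariance_bound (i := Ordinal il) (f := comp i) (n := n) (T := T)
  (U := U) (comp j) (@depends_component _ _ _ m (Ordinal il) phi)
  (centered_component m_sum1 (Ordinal il) phi) (leq_maxl _ _) _ _.
have Tin : (T < i.+1 * n)%N by rewrite gtn_max ji andbT mulSn; lia.
move=> /(_ Tin) H.
have {H} := H (adapted_states (fun b => leq_trans (geq_minr _ _) (leq_maxr _ _))).
have -> : E (fun w => sample (comp i) n w * comp j (U w)) = cov (comp i) (comp j) n k.
  by apply: eq_Rintegral => w _; rewrite UE.
have -> : E (fun w => comp j (U w) ^+ 2) = E (fun w => sample (comp j) k w ^+ 2).
  by apply: eq_Rintegral => w _; rewrite UE.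
move=> /le_trans; apply.
have N0 := normsq_ge0 m_ge0 phi; have C0 := domination_constant_ge0.
apply: (@le_trans _ _ (rate (i.+1 * n - T) * (8 * C * normsq m phi))).
  rewrite ler_wpM2l//; have := comp_domination i n0; have := comp_domination j k0.
  lra.
rewrite /rate (_ : c * th ^+ (l.+1 * (i.+1 * n - T)) * (8 * C * normsq m phi) =
  8 * c * C * normsq m phi * th ^+ (l.+1 * (i.+1 * n - T))); last by ring.
apply: ler_pM.
- by rewrite !mulr_ge0.
- by rewrite exprn_ge0// ltW.
- by rewrite ler_wpM2r// /K /covariance_constant ler_wpM2r// ler_wpM2l// lerDl.
have [kn|nk] := leqP (j.+1 * k) (i * n).
  rewrite -[leLHS]add0r lerD ?exprn_ge0 ?(ltW th0)//; apply: expr_le_expr => //.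
  have -> : (i.+1 * n - T = n)%N by rewrite /T (maxn_idPl kn) mulSn addnK.
  rewrite mulSn leq_add2l.
  apply: (@leq_trans (j.+1 * k)); first exact: leq_pmull.
  by apply: (leq_trans kn); rewrite leq_mul2r ltnW// orbT.
rewrite -[leLHS]addr0 lerD ?exprn_ge0 ?(ltW th0)//; apply: expr_le_expr => //.
rewrite /T (maxn_idPr (ltnW nk)) /dist.
have : (i.+1 * n - j.+1 * k <= l.+1 * (i.+1 * n - j.+1 * k))%N by rewrite leq_pmull.
lia.
Qed.

Lemma component_covariance_bound i j n k :
  (i < l)%N -> (j < l)%N -> (0 < n)%N -> (0 < k)%N ->
  `|cov (comp i) (comp j) n k| <=
  K * normsq m phi * (th ^+ dist (i.+1 * n) (j.+1 * k) + th ^+ (n + k)).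
Proof.
move=> il jl n0 k0; case: (ltngtP (j.+1 * k) (i.+1 * n)) => [lt|gt|eq].
- exact: covariance_bound_lt.
- rewrite covariance_seqC /dist addnC -/(dist _ _) [(n + k)%N]addnC.
  exact: covariance_bound_lt.
rewrite eq /dist subnn addn0 expr0.
have N0 := normsq_ge0 m_ge0 phi; have C0 := domination_constant_ge0.
apply: (@le_trans _ _ (K * normsq m phi * 1)); last first.
  apply: ler_wpM2l; first by rewrite mulr_ge0 ?covariance_constant_ge0.
  by rewrite lerDl exprn_ge0// ltW.
have s1 := sqint_sample (comp i) n; have s2 := sqint_sample (comp j) k.
apply: (@le_trans _ _ (E (fun w => 1 / 2 *
    (sample (comp i) n w ^+ 2 + sample (comp j) k w ^+ 2)))).
  apply: E_norm_le; first exact: sqintM.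
    by apply: L1Zl; apply: L1D; exact: sqint_sqr.
  move=> w; rewrite ler_norml; have := sqr_ge0 (sample (comp i) n w - sample (comp j) k w).
  have := sqr_ge0 (sample (comp i) n w + sample (comp j) k w); rewrite !expr2 => h1 h2.
  by apply/andP; split; lra.
rewrite E_Zl; last by apply: L1D; exact: sqint_sqr.
rewrite E_D; [|exact: sqint_sqr..].
have := comp_domination i n0; have := comp_domination j k0.
have := mulr_ge0 C0 N0; have := mulr_ge0 c_ge0 (mulr_ge0 C0 N0).
rewrite /K /covariance_constant; set q := normsq m phi; lra.
Qed.

(** The covariance bound against a constant. *)
Lemma component_mean_bound i n : (i < l)%N -> (0 < n)%N ->
  `|E (sample (comp i) n)| <= c * (4 * C * normsq m phi + 1) * th ^+ n.
Proof.
move=> il n0.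
have aU : adapted [set j | (j <= i * n)%N] (fun _ => tt).
  move=> []; have -> : (fun _ : Omega => tt) @^-1` [set tt] = ~` set0.
    by rewrite setC0; apply/seteqP; split.
  by apply: sigma_algebraC; exact: sigma_algebra0.
have := covariance_bound (i := Ordinal il) (f := comp i) (n := n) (T := (i * n)%N)
  (fun _ => 1) (@depends_component _ _ _ m (Ordinal il) phi)
  (centered_component m_sum1 (Ordinal il) phi) (leqnn _) _ aU.
rewrite /= mulSn addnK -[X in (X < _)%N]add0n ltn_add2r => /(_ n0).
have -> : E (fun w => sample (comp i) n w * 1) = E (sample (comp i) n).
  by apply: eq_Rintegral => w _; rewrite mulr1.
have -> : E (fun w : Omega => (1 : R) ^+ 2) = 1.
  by rewrite -[RHS](E_cst P 1); apply: eq_Rintegral => w _; rewrite expr1n.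
move=> /le_trans; apply; rewrite /rate mulrAC; apply: ler_pM.
- by rewrite mulr_ge0// addr_ge0// E_sqr_ge0.
- by rewrite exprn_ge0// ltW.
- by rewrite ler_wpM2l// lerD2r; exact: comp_domination.
- by apply: expr_le_expr => //; exact: leq_pmull.
Qed.

(** The disjoint sum indexes the coordinates of two samples, so that their joint law is
    the probability of one event. *)
Let pair_times (s s' : nat) (z : 'I_l + 'I_l) : nat :=
  match z with inl a => (a.+1 * s)%N | inr a => (a.+1 * s')%N end.

Let pair_sets (x y : {ffun 'I_l -> I}) (z : 'I_l + 'I_l) : set X :=
  match z with inl a => g @^-1` [set x a] | inr a => g @^-1` [set y a] end.

Let mpair_sets x y z : measurable (pair_sets x y z).
Proof. by case: z => a; exact: mg. Qed.

Let covariance_seqE f h s s' e e' t : cov f h (s * t + e) (s' * t + e') =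
  \sum_x \sum_y f x * h y * pr (event xi predT
     (fun z => pair_times s s' z * t + pair_times e e' z)%N (pair_sets x y)).
Proof.
pose U := states (fun a => a.+1 * (s * t + e))%N.
pose V := states (fun a => a.+1 * (s' * t + e'))%N.
have fUV := finite_valued_pair (finite_valued_states _ : finite_valued U)
  (finite_valued_states _ : finite_valued V).
rewrite /covariance_seq /sample (E_finite_valued P (fun z => f z.1 * h z.2) fUV).
rewrite pair_big; apply: eq_bigr => -[x y] _ /=; congr (_ * _).
rewrite /mass pair_preimage !states_preimage; congr fine; congr (P _).
apply/seteqP; split => w.
  move=> [H1 H2] [a|a] _ /=; [have := H1 a isT|have := H2 a isT];
  by rewrite mulnDr mulnA.
move=> H; split => a _; [have := H (inl a) isT|have := H (inr a) isT];
by rewrite /= mulnDr mulnA.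
Qed.

Let pair_event_cvg s s' e e' x y B :
  (forall z, pair_times s s' z < B)%N ->
  (fun t => pr (event xi predT
     (fun z => pair_times s s' z * t + pair_times e e' z)%N (pair_sets x y))) @ \oo -->
  \prod_(r < B) pr (event xi (fun z => pair_times s s' z == r)
     (pair_times e e') (pair_sets x y)).
Proof.
move=> sB.
have := line_event_cvg mp rate_cvg0 (sl := pair_times s s') (c := pair_times e e')
  (s := B) (mpair_sets x y).
apply: eq_cvgn => t; congr fine; congr (P _).
by apply/seteqP; split => w H z Dz; apply: H.
Qed.

Let seq_cvg_fsum (J : finType) (u : nat -> J -> R) (v : J -> R) :
  (forall j, u ^~ j @ \oo --> v j) -> (fun t => \sum_j u t j) @ \oo --> \sum_j v j.
Proof.
move=> uv; elim: (index_enum J) => [|j r IH].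
  by under eq_fun do rewrite big_nil; rewrite big_nil; exact: cvg_cst.
by under eq_fun do rewrite big_cons; rewrite big_cons; exact: seq_cvgD.
Qed.

(** A covariance is a finite combination of probabilities of events whose times move
    along lines, to which [line_event_cvg] applies. *)
Lemma covariance_line_cvg f h s s' e e' :
  exists v : R, (fun t => cov f h (s * t + e) (s' * t + e')) @ \oo --> v.
Proof.
(* a strict bound of all the slopes *)
pose B := (l * (s + s')).+1.
have sB z : (pair_times s s' z < B)%N.
  rewrite /B ltnS; case: z => a /=; apply: leq_mul => //.
    exact: leq_addr.
  exact: leq_addl.
eexists; eapply eq_cvgn.
  by move=> t; exact: (esym (covariance_seqE f h s s' e e' t)).
apply: seq_cvg_fsum => x; apply: seq_cvg_fsum => y.
by apply: seq_cvgZ; exact: pair_event_cvg.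
Qed.

(** Joint law of two values of the chain whose times differ by the lag that coordinate
    [a] sees between the samples of indices [n] and [n + k]. *)
Definition pair_mass (a k : nat) (u v : I) : R :=
  pr ((g \o xi 0%N) @^-1` [set u] `&` (g \o xi (a.+1 * k)%N) @^-1` [set v]).

(** Covariance that the samples would have if their coordinates came from independent
    copies of the chain. *)
Definition decoupled_covariance f h k : R :=
  \sum_(x : {ffun 'I_l -> I}) \sum_(y : {ffun 'I_l -> I})
    f x * h y * \prod_(a < l) pair_mass a k (x a) (y a).

(** With both slopes equal to one, cluster [a.+1] consists of the two times read by
    coordinate [a], and cluster zero is empty. *)
Lemma covariance_decoupling f h k :
  (fun n => cov f h n (n + k)) @ \oo --> decoupled_covariance f h k.
Proof.
have E n : cov f h n (n + k) = cov f h (1 * n + 0) (1 * n + k).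
  by rewrite mul1n addn0.
eapply eq_cvgn.
  by move=> n; exact: (etrans (esym (covariance_seqE f h 1 1 0 k n)) (esym (E n))).
apply: seq_cvg_fsum => x; apply: seq_cvg_fsum => y; apply: seq_cvgZ.
have sB z : (pair_times 1 1 z < l.+1)%N by case: z => a /=; rewrite muln1 ltnS.
have := @pair_event_cvg 1%N 1%N 0%N k x y l.+1 sB.
rewrite big_ord_recl /=.
rewrite (_ : event _ _ _ _ = setT); last first.
  apply/seteqP; split => // w _ z; rewrite /= /bump /=.
  by case: z => a /=; rewrite muln1.
rewrite probability_setT mul1r.
congr (_ --> _); apply: eq_bigr => a _; congr fine; congr (P _).
apply/seteqP; split => w.
  move=> H; split.
    by have := H (inl a); rewrite /= !muln1 muln0 /bump /= add1n eqxx; apply.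
  by have := H (inr a); rewrite /= !muln1 /bump /= add1n eqxx; apply.
move=> [H1 H2] [b|b]; rewrite /= !muln1 /bump /= add1n eqSS => /eqP /val_inj ->.
  by rewrite muln0.
exact: H2.
Qed.

End discretized_process.

(** * Variances of sums of discretized functions *)

Section partial_sums.
Context d (Omega : measurableType d) d' (X : measurableType d') (R : realType).
Variables (P : probability Omega R) (xi : nat -> {RV P >-> X}).
Variables (mu : probability X R) (l : nat) (c th : R).
Hypotheses (c_ge0 : 0 <= c) (th0 : 0 < th) (th1 : th < 1).
Hypothesis mp : mixing_process xi mu (rate l c th).
Hypothesis l_gt0 : (0 < l)%N.
Variables (I : finType) (g : X -> I).
Hypothesis mg : forall i, measurable (g @^-1` [set i]).
Variable phi : {ffun 'I_l -> I} -> R.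

Local Notation E Z := (\int[P]_w Z w).
Local Notation m := (state_mass mu g).
Local Notation comp i := (component m i phi).
Local Notation cov := (covariance_seq xi g).
Local Notation C := (domination_constant l c).
Local Notation K := (covariance_constant l c * normsq m phi).

Hypothesis phi_centered : \sum_x weight m x * phi x = 0.

Let m_ge0 := state_mass_ge0 mu g.
Let m_sum1 := state_mass_sum1 mu mg.

Let gth := (1 - th)^-1.

Let gth_ge0 : 0 <= gth.
Proof. by rewrite invr_ge0 subr_ge0 ltW. Qed.

Definition partial_sum (f : {ffun 'I_l -> I} -> R) (N : nat) (w : Omega) : R :=
  \sum_(1 <= n < N.+1) sample xi g f n w.

Let ssum f N : sqint P (partial_sum f N).
Proof. by apply: sqint_sum => n; exact: sqint_sample. Qed.

(** The grand mean of [phi] is zero, so its components add up to [phi] itself. *)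
Lemma partial_sum_components N w :
  partial_sum phi N w = \sum_(0 <= i < l) partial_sum (comp i) N w.
Proof.
rewrite exchange_big /=; apply: eq_bigr => n _.
by rewrite big_mkord /sample (sum_component m_sum1) phi_centered subr0.
Qed.

Let E_partial_sumM f h N :
  E (fun w => partial_sum f N w * partial_sum h N w) = box_sum (cov f h) N.
Proof. by rewrite E_sum_mul// => n; exact: sqint_sample. Qed.

Lemma partial_sum_variance N : E (fun w => partial_sum phi N w ^+ 2) =
  \sum_(0 <= i < l) \sum_(0 <= j < l) box_sum (cov (comp i) (comp j)) N.
Proof.
transitivity (E (fun w => (\sum_(0 <= i < l) partial_sum (comp i) N w) ^+ 2)).
  by apply: eq_Rintegral => w _; rewrite partial_sum_components.
rewrite E_sqr_sum; last by move=> i; exact: ssum.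
by apply: eq_bigr => i _; apply: eq_bigr => j _; exact: E_partial_sumM.
Qed.

Let bbd := @component_covariance_bound _ _ _ _ _ _ _ _ _ _ _ c_ge0 th0 th1 mp _ _ mg phi.

Let bline i j s s' e e' : (0 < s)%N -> (0 < s')%N -> exists v : R,
  (fun t => cov (comp i) (comp j) (s * t + e) (s' * t + e')) @ \oo --> v.
Proof. by move=> _ _; exact: (covariance_line_cvg th0 th1 mp mg). Qed.

Let bsym i j n k : cov (comp i) (comp j) n k = cov (comp j) (comp i) k n.
Proof. exact: covariance_seqC. Qed.

Lemma partial_sum_variance_bound N : E (fun w => partial_sum phi N w ^+ 2) <=
  l%:R ^+ 2 * covariance_constant l c * (3 * gth) * normsq m phi * N%:R.
Proof.
rewrite partial_sum_variance.
apply: (@le_trans _ _ (\sum_(0 <= i < l) \sum_(0 <= j < l) K * (3 * gth) * N%:R)).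
  apply: ler_sum_nat => i /andP[_ il]; apply: ler_sum_nat => j /andP[_ jl].
  apply: le_trans (ler_norm _) _.
  exact: (box_sum_bound th0 th1 bbd).
rewrite !sumr_const_nat !subn0 -mulrnA -[leLHS]mulr_natr natrM.
by rewrite le_eqVlt; apply/orP; left; apply/eqP; ring.
Qed.

Lemma partial_sum_mean_bound N : `|E (partial_sum phi N)| <=
  l%:R * (c * (4 * C + 1) * gth) * (normsq m phi + 1).
Proof.
have -> : E (partial_sum phi N) =
    \sum_(0 <= i < l) \sum_(1 <= n < N.+1) E (sample xi g (comp i) n).
  transitivity (E (fun w => \sum_(0 <= i < l) partial_sum (comp i) N w)).
    by apply: eq_Rintegral => w _; rewrite partial_sum_components.
  rewrite E_sum; last by move=> i; apply: sqint_L1; exact: ssum.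
  apply: eq_bigr => i _; rewrite E_sum// => n.
  by apply: sqint_L1; exact: sqint_sample.
apply: le_trans (ler_norm_sum _ _ _) _.
have C0 : 0 <= C := domination_constant_ge0 l c_ge0.
have N0 := normsq_ge0 m_ge0 phi.
apply: (@le_trans _ _ (\sum_(0 <= i < l) (c * (4 * C * normsq m phi + 1)) * gth)).
  apply: ler_sum_nat => i /andP[_ il]; apply: le_trans (ler_norm_sum _ _ _) _.
  apply: (@le_trans _ _ (\sum_(1 <= n < N.+1) (c * (4 * C * normsq m phi + 1)) * th ^+ n)).
    by apply: ler_sum_nat => n /andP[n0 _]; exact: component_mean_bound.
  rewrite -mulr_sumr ler_wpM2l// ?mulr_ge0// ?addr_ge0 ?mulr_ge0//.
  apply: le_trans (geo_sum th0 th1 N.+1).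
  by rewrite [leRHS]big_nat_recl//= big_add1 lerDr.
rewrite sumr_const_nat subn0 -[leLHS]mulr_natl -!mulrA ler_wpM2l//.
rewrite ler_wpM2l// [leRHS]mulrCA [leLHS]mulrC ler_wpM2l//.
by have := mulr_ge0 C0 N0; rewrite mulrDl mulrDr; lra.
Qed.

(** The two conclusions of the theorem for discretized functions, with the limit for
    independent copies expressed by decoupled covariances. Only this form mentions no
    particular family of copies, so [s] is the same for all of them. *)
Lemma partial_sum_limits : exists sg s : R,
  [/\ (fun N => E (fun w => partial_sum phi N w ^+ 2) / N%:R) @ \oo --> sg,
      (fun N => box_sum (fun n k =>
         decoupled_covariance xi g (comp l.-1) (comp l.-1) (dist n k)) N / N%:R)
        @ \oo --> s,
      s / l%:R <= sg &
      forall N, `|box_sum (fun n k =>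
         decoupled_covariance xi g (comp l.-1) (comp l.-1) (dist n k)) N| <=
         4 * covariance_constant l c * gth * normsq m phi * N%:R].
Proof.
pose b i j := cov (comp i) (comp j).
have jl : (l.-1 < l)%N by rewrite prednK.
have /choice[v Hv] : forall ij : nat * nat, exists v : R,
    (ij.1 < l)%N -> (ij.2 < l)%N ->
    (fun N => box_sum (b ij.1 ij.2) N / N%:R) @ \oo --> v.
  move=> [i j] /=; have [il|] := ltnP i l; last by exists 0.
  have [jl'|] := ltnP j l; last by exists 0.
  by have [v Hv] := box_sum_cvg th0 th1 bsym bbd bline il jl'; exists v.
have cv : (fun N => (\sum_(0 <= i < l) \sum_(0 <= j < l) box_sum (b i j) N) / N%:R)
    @ \oo --> \sum_(0 <= i < l) \sum_(0 <= j < l) (v (i, j)).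
  have E N : \sum_(0 <= i < l) \sum_(0 <= j < l)
      (if (i < l)%N && (j < l)%N then box_sum (b i j) N / N%:R else v (i, j)) =
      (\sum_(0 <= i < l) \sum_(0 <= j < l) box_sum (b i j) N) / N%:R.
    rewrite mulr_suml; apply: eq_big_nat => i /andP[_ il].
    rewrite mulr_suml; apply: eq_big_nat => j /andP[_ jl'].
    by rewrite il jl'.
  eapply eq_cvgn; first exact: E.
  apply: seq_cvg_sum => i; apply: seq_cvg_sum => j.
  have [il|_] := ltnP i l; last exact: cvg_cst.
  have [jl'|_] := ltnP j l; last exact: cvg_cst.
  exact: (Hv (i, j)).
have cs := Hv (l.-1, l.-1) jl jl.
have dec k : (fun n => cov (comp l.-1) (comp l.-1) n (n + k)) @ \oo -->
    decoupled_covariance xi g (comp l.-1) (comp l.-1) k.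
  exact: (covariance_decoupling th0 th1 mp mg).
exists (\sum_(0 <= i < l) \sum_(0 <= j < l) (v (i, j))), (v (l.-1, l.-1)); split.
- by under eq_fun do rewrite partial_sum_variance.
- exact: (stationary_comparison th0 th1 bsym bbd jl dec cs).
- apply: (variance_lower_bound th0 th1 bsym bbd l_gt0 _ cv cs) => M N MN.
  pose B w := \sum_(M.+1 <= k < N.+1) sample xi g (comp l.-1) k w.
  have sB : sqint P B by apply: sqint_sum => n; exact: sqint_sample.
  have sS := ssum phi N.
  have := E_sqr_ge0 P (fun w => partial_sum phi N w - B w).
  have -> : E (fun w => (partial_sum phi N w - B w) ^+ 2) =
      E (fun w => (partial_sum phi N w ^+ 2 - 2 * (partial_sum phi N w * B w)) + B w ^+ 2).
    by apply: eq_Rintegral => w _; ring.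
  have iSB := sqintM sS sB.
  rewrite E_D; [|by apply: L1B; [exact: sqint_sqr|exact: L1Zl]|exact: sqint_sqr].
  rewrite E_B; [|exact: sqint_sqr|exact: L1Zl].
  rewrite E_Zl// partial_sum_variance.
  have -> : E (fun w => partial_sum phi N w * B w) = \sum_(0 <= i < l)
      \sum_(M.+1 <= k < N.+1) \sum_(1 <= n < N.+1) b i l.-1 n k.
    transitivity (E (fun w => (\sum_(0 <= i < l) partial_sum (comp i) N w) * B w)).
      by apply: eq_Rintegral => w _; rewrite partial_sum_components.
    transitivity (E (fun w => \sum_(0 <= i < l) (partial_sum (comp i) N w * B w))).
      by apply: eq_Rintegral => w _; rewrite mulr_suml.
    rewrite E_sum; last by move=> i; apply: sqintM => //; exact: ssum.
    apply: eq_bigr => i _; rewrite exchange_big /=.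
    by rewrite E_sum_mul// => n; exact: sqint_sample.
  have -> : E (fun w => B w ^+ 2) = \sum_(M.+1 <= k < N.+1)
      \sum_(M.+1 <= n < N.+1) b l.-1 l.-1 n k.
    by rewrite E_sqr_sum; [rewrite exchange_big|move=> n; exact: sqint_sample].
  by [].
- move=> N; apply: le_trans (stationary_box_bound th0 th1 bbd jl dec N) _.
  by rewrite le_eqVlt; apply/orP; left; apply/eqP; rewrite /gth; ring.
Qed.

End partial_sums.

Section decoupled_copies.
Context d (Omega : measurableType d) d' (X : measurableType d') (R : realType).
Variables (P : probability Omega R) (xi : nat -> {RV P >-> X}).
Variables (mu : probability X R) (rho : nat -> R).
Hypothesis mp : mixing_process xi mu rho.
Context d1 (Omega1 : measurableType d1) (P1 : probability Omega1 R) (l : nat).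
Variable eta : 'I_l -> nat -> {RV P1 >-> X}.
Hypothesis eta_law : forall i, same_law P1 (eta i) P xi.
Hypothesis eta_indep : independent_processes P1 eta.

Local Notation pr A := (fine (P A)).

Lemma copy_pair_law i s t (A B : set X) : measurable A -> measurable B ->
  P1 (eta i s @^-1` A `&` eta i t @^-1` B) = P (xi s @^-1` A `&` xi t @^-1` B).
Proof.
move=> mA mB; pose n := maxn s t.
pose S := [set x : n.+1.-tuple X | A (tnth x (inord s))] `&`
          [set x : n.+1.-tuple X | B (tnth x (inord t))].
have mS : measurable S by apply: measurableI; exact: measurable_preimage_tnth.
have sn : (s < n.+1)%N by rewrite ltnS leq_maxl.
have tn : (t < n.+1)%N by rewrite ltnS leq_maxr.
have Hl := eta_law i mS; transitivity
  (P1 ((fun w => [tuple eta i j w | j < n.+1]) @^-1` S)).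
  congr (P1 _); apply/seteqP; split => w /=;
  by rewrite /S /= !tnth_mktuple !inordK.
rewrite Hl; congr (P _); apply/seteqP; split => w /=;
by rewrite /S /= !tnth_mktuple !inordK.
Qed.

Lemma copy_lag_law (i : 'I_l) s k (A B : set X) : measurable A -> measurable B ->
  P1 (eta i s @^-1` A `&` eta i (s + k)%N @^-1` B) =
  P (xi 0%N @^-1` A `&` xi k @^-1` B).
Proof.
move=> mA mB; rewrite copy_pair_law//.
pose D (z : bool) := if z then A else B.
have E t : xi t @^-1` A `&` xi (t + k)%N @^-1` B =
    event xi predT (fun z : bool => t + (if z then 0 else k))%N D.
  apply/seteqP; split => w.
    by move=> [H1 H2] [] _ /=; rewrite ?addn0.
  by move=> H; split; [have := H true isT|have := H false isT]; rewrite /= ?addn0.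
rewrite E (process_shift mp) -?E; last by case.
by have /= := E 0%N; rewrite !add0n => ->.
Qed.

Lemma copies_independent (s t : 'I_l -> nat) (A B : 'I_l -> set X) :
  (forall a, measurable (A a)) -> (forall a, measurable (B a)) ->
  P1 [set w | forall a, A a (eta a (s a) w) /\ B a (eta a (t a) w)] =
  (\prod_a P1 (eta a (s a) @^-1` A a `&` eta a (t a) @^-1` B a))%E.
Proof.
move=> mA mB.
have := eta_indep (J := [set: 'I_l]%SET)
  (E := fun a => eta a (s a) @^-1` A a `&` eta a (t a) @^-1` B a).
have H (a : 'I_l) : a \in [set: 'I_l]%SET -> sigma_process (eta a) setT
    (eta a (s a) @^-1` A a `&` eta a (t a) @^-1` B a).
  move=> _; pose T' := g_sigma_algebraType
    (\bigcup_(j in setT) preimage_set_system setT (eta a j) measurable).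
  apply: (@measurableI _ T').
    exact: (sigma_process_preimage (xi := fun n => eta a n) (j := s a)).
  exact: (sigma_process_preimage (xi := fun n => eta a n) (j := t a)).
move=> /(_ H); rewrite (eq_bigl predT) => [<-|a]; last by rewrite inE.
congr (P1 _); apply/seteqP; split => w /=.
  by move=> Hw a _; exact: Hw.
by move=> Hw a; apply: Hw; rewrite /= inE.
Qed.

Variables (I : finType) (g : X -> I).
Hypothesis mg : forall i, measurable (g @^-1` [set i]).

Local Notation E1 Z := (\int[P1]_w Z w).

Definition copy_states (n : nat) (w : Omega1) : {ffun 'I_l -> I} :=
  [ffun a => g (eta a (a.+1 * n)%N w)].

Lemma finite_valued_copy_states n : finite_valued (copy_states n).
Proof.
move=> x; have -> : copy_states n @^-1` [set x] =
    \bigcap_(a in [set: 'I_l]) (eta a (a.+1 * n)%N @^-1` (g @^-1` [set x a])).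
  apply/seteqP; split => w /=.
    by move=> <- a _ /=; rewrite ffunE.
  by move=> H; apply/ffunP => a; rewrite ffunE; exact: H.
apply: fin_bigcap_measurable => // a _.
by rewrite -[X in measurable X]setTI; exact: measurable_funP.
Qed.

Let copy_covariance_lag f h n k :
  E1 (fun w => f (copy_states n w) * h (copy_states (n + k) w)) =
  decoupled_covariance xi g f h k.
Proof.
have fU := finite_valued_pair (finite_valued_copy_states n)
  (finite_valued_copy_states (n + k)).
rewrite (E_finite_valued P1 (fun z => f z.1 * h z.2) fU) /decoupled_covariance.
rewrite pair_big; apply: eq_bigr => -[x y] _ /=; congr (_ * _).
rewrite /mass.
have -> : (fun w => (copy_states n w, copy_states (n + k) w)) @^-1` [set (x, y)] =
  [set w | forall a : 'I_l, (g @^-1` [set x a]) (eta a (a.+1 * n)%N w) /\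
     (g @^-1` [set y a]) (eta a (a.+1 * n + a.+1 * k)%N w)].
  apply/seteqP; split => w /=.
    by move=> [<- <-] a; rewrite !ffunE mulnDr.
  move=> H; congr (_, _); apply/ffunP => a; rewrite ffunE; case: (H a) => //.
  by rewrite mulnDr.
rewrite (copies_independent (fun a => (a.+1 * n)%N)
  (fun a => (a.+1 * n + a.+1 * k)%N)
  (A := fun a => g @^-1` [set x a]) (B := fun a => g @^-1` [set y a])) //.
have pE (a : 'I_l) : P1 (eta a (a.+1 * n)%N @^-1` (g @^-1` [set x a]) `&`
    eta a (a.+1 * n + a.+1 * k)%N @^-1` (g @^-1` [set y a])) =
    (pair_mass xi g a k (x a) (y a))%:E.
  have mx t i : measurable (xi t @^-1` (g @^-1` [set i])).
    by rewrite -[X in measurable X]setTI; exact: measurable_funP.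
  rewrite copy_lag_law// fineK// fin_num_measure//; apply: measurableI; exact: mx.
transitivity (fine (\prod_(a < l) (pair_mass xi g a k (x a) (y a))%:E)%E).
  by congr fine; apply: eq_bigr => a _; exact: pE.
by rewrite -(big_morph EFin (@EFinM R) (erefl _)).
Qed.

Lemma copy_covariance f n k :
  E1 (fun w => f (copy_states n w) * f (copy_states k w)) =
  decoupled_covariance xi g f f (dist n k).
Proof.
have [nk|/ltnW kn] := leqP n k.
  rewrite -{1}(subnKC nk) copy_covariance_lag; congr decoupled_covariance.
  by rewrite /dist; lia.
rewrite -[X in copy_states X](subnKC kn).
transitivity (E1 (fun w => f (copy_states k w) * f (copy_states (k + (n - k)) w))).
  by apply: eq_Rintegral => w _; rewrite mulrC.
by rewrite copy_covariance_lag; congr decoupled_covariance; rewrite /dist; lia.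
Qed.

Lemma sqint_copy f n : sqint P1 (fun w => f (copy_states n w)).
Proof. exact: finite_valued_sqint (finite_valued_copy_states n). Qed.

(** Independence of the copies factors the joint law of two samples over the
    coordinates, and equality of the laws with stationarity makes each factor depend on
    the lag only; hence the covariances are exactly the decoupled ones. *)
Lemma copy_sum_variance f N :
  E1 (fun w => (\sum_(1 <= n < N.+1) f (copy_states n w)) ^+ 2) =
  box_sum (fun n k => decoupled_covariance xi g f f (dist n k)) N.
Proof.
rewrite E_sqr_sum; last by move=> n; exact: sqint_copy.
by apply: eq_bigr => n _; apply: eq_bigr => k _; exact: copy_covariance.
Qed.

End decoupled_copies.

(** * Density of discretized functions in mean square *)

Section dominated_mean_square.
Context d (T : measurableType d) (R : realType) (P : probability T R).

Lemma dominated_mean_square_cvg (u : nat -> T -> R) (F h : T -> R) :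
  (forall n, measurable_fun setT (u n)) -> measurable_fun setT F -> sqint P h ->
  (forall n x, `|u n x| <= h x) -> (forall x, `|F x| <= h x) ->
  (forall x, u ^~ x @ \oo --> F x) ->
  (fun n => \int[P]_x (F x - u n x) ^+ 2) @ \oo --> (0 : R).
Proof.
move=> mu mF sh uh Fh uF.
have iG : L1 P (fun x => 4 * h x ^+ 2) by apply: L1Zl; exact: sqint_sqr.
pose f n x := ((F x - u n x) ^+ 2)%:E.
have mf n : measurable_fun setT (f n).
  by apply/measurable_EFinP; apply: measurable_funX; exact: measurable_funB.
have [] := @dominated_convergence _ _ _ P setT measurableT f (cst 0%E)
  (fun x => (4 * h x ^+ 2)%:E) mf.
- exact: measurable_cst.
- apply: aeW => x _; apply/fine_cvgP; split; first by near=> n.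
  have H : (fun n => F x - u n x) @ \oo --> (0 : R).
    rewrite -(subrr (F x)); apply: seq_cvgB => //; exact: cvg_cst.
  have := seq_cvgM H H; rewrite mulr0; apply: eq_cvgn => n /=.
  by rewrite expr2.
- exact: iG.
- apply: aeW => x n _; rewrite /f /= lee_fin ger0_norm ?sqr_ge0//.
  have := uh n x; have := Fh x; rewrite !ler_norml => /andP[f1 f2] /andP[u1 u2].
  have h0 : 0 <= h x by lra.
  have : 0 <= (2 * h x - (F x - u n x)) * (2 * h x + (F x - u n x)).
    by apply: mulr_ge0; lra.
  by rewrite !expr2; lra.
move=> _ _; rewrite integral0 => /fine_cvgP[_].
exact.
Unshelve. all: by end_near. Qed.

End dominated_mean_square.

Section discretized_functions.
Context d (X : measurableType d) (R : realType) (l : nat).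
Implicit Types F G : l.-tuple X -> R.

Definition coding (I : finType) (g : X -> I) (x : l.-tuple X) : {ffun 'I_l -> I} :=
  [ffun a => g (tnth x a)].

(** The same coding [g] is used for all coordinates, because they are values of one
    process. *)
Definition discretized F : Prop :=
  exists (I : finType) (g : X -> I) (phi : {ffun 'I_l -> I} -> R),
    (forall i, measurable (g @^-1` [set i])) /\ forall x, F x = phi (coding g x).

Lemma discretized2 F G : discretized F -> discretized G ->
  exists (I : finType) (g : X -> I) (phi psi : {ffun 'I_l -> I} -> R),
    [/\ forall i, measurable (g @^-1` [set i]),
        forall x, F x = phi (coding g x) & forall x, G x = psi (coding g x)].
Proof.
move=> [I [g [phi [mg FE]]]] [J [h [psi [mh GE]]]].
exists (I * J)%type, (fun x => (g x, h x)).
exists (fun y => phi [ffun a => (y a).1]), (fun y => psi [ffun a => (y a).2]); split.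
- move=> [i j]; rewrite (_ : _ @^-1` _ = g @^-1` [set i] `&` h @^-1` [set j]).
    exact: measurableI.
  by apply/seteqP; split => x /= [-> ->].
- by move=> x; rewrite FE; congr phi; apply/ffunP => a; rewrite !ffunE.
- by move=> x; rewrite GE; congr psi; apply/ffunP => a; rewrite !ffunE.
Qed.

Lemma discretized_op (h : R -> R -> R) F G : discretized F -> discretized G ->
  discretized (fun x => h (F x) (G x)).
Proof.
move=> dF dG; have [I [g [phi [psi [mg FE GE]]]]] := discretized2 dF dG.
by exists I, g, (fun y => h (phi y) (psi y)); split => // x; rewrite FE GE.
Qed.

Lemma discretized_cst (k : R) : discretized (fun _ => k).
Proof.
exists unit, (fun _ => tt), (fun _ => k); split => // -[].
by rewrite (_ : _ @^-1` _ = setT)//; apply/seteqP; split.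
Qed.

Lemma discretized_rect (A : 'I_l -> set X) : (forall a, measurable (A a)) ->
  discretized (\1_(rect A) : l.-tuple X -> R).
Proof.
move=> mA.
exists {ffun 'I_l -> bool}, (fun x => [ffun a => x \in A a]).
exists (fun y : {ffun 'I_l -> {ffun 'I_l -> bool}} => [forall a, y a a]%:R); split.
  move=> b; rewrite (_ : _ @^-1` _ =
      \bigcap_(a in [set: 'I_l]) (if b a then A a else ~` A a)).
    by apply: fin_bigcap_measurable => // a _; case: ifP => _ //; exact: measurableC.
  apply/seteqP; split => x /=.
    move=> <- a _; rewrite ffunE; case: ifPn; first by rewrite inE.
    by rewrite notin_setE.
  move=> H; apply/ffunP => a; rewrite ffunE; have := H a I; case: (b a).
    by move=> Ax; rewrite mem_set.
  by move=> Ax; apply/negbTE; rewrite notin_setE.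
move=> x; rewrite indicE; congr (_%:R); congr nat_of_bool.
apply/idP/forallP.
  by rewrite inE => Ax a; rewrite !ffunE mem_set.
by move=> H; rewrite inE => a; have := H a; rewrite !ffunE inE.
Qed.

Lemma finite_valued_coding (I : finType) (g : X -> I) :
  (forall i, measurable (g @^-1` [set i])) -> finite_valued (coding g).
Proof.
move=> mg y; rewrite (_ : _ @^-1` _ = rect (fun a => g @^-1` [set y a])).
  exact: measurable_rect.
apply/seteqP; split => x /=.
  by move=> <- a /=; rewrite ffunE.
by move=> H; apply/ffunP => a; rewrite ffunE; exact: H.
Qed.

Lemma sqint_discretized (nu : probability (l.-tuple X) R) F :
  discretized F -> sqint nu F.
Proof.
move=> [I [g [phi [mg FE]]]].
rewrite (_ : F = fun x => phi (coding g x)); last exact/funext.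
exact: finite_valued_sqint (finite_valued_coding mg).
Qed.

Section density.
Variables nu1 nu2 : probability (l.-tuple X) R.

Local Notation E1 Z := (\int[nu1]_x Z x).
Local Notation E2 Z := (\int[nu2]_x Z x).

(** The approximation is simultaneous for two probabilities: for the domination of the
    law of a sample by a product measure, the same approximant has to be good under
    both. *)
Definition approximable F : Prop :=
  [/\ sqint nu1 F, sqint nu2 F & forall e : R, 0 < e -> exists G,
    [/\ discretized G, E1 (fun x => (F x - G x) ^+ 2) <= e &
        E2 (fun x => (F x - G x) ^+ 2) <= e]].

Lemma approximable_discretized F : discretized F -> approximable F.
Proof.
move=> dF; split; [exact: sqint_discretized..|move=> e e0; exists F; split => //].
  under eq_Rintegral do rewrite subrr expr0n /=; rewrite E_cst; exact: ltW.
under eq_Rintegral do rewrite subrr expr0n /=; rewrite E_cst; exact: ltW.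
Qed.

Let mean_square_add (nu : probability (l.-tuple X) R) F F' G G' :
  sqint nu F -> sqint nu F' -> sqint nu G -> sqint nu G' ->
  \int[nu]_x ((F x + F' x) - (G x + G' x)) ^+ 2 <=
  2 * \int[nu]_x (F x - G x) ^+ 2 + 2 * \int[nu]_x (F' x - G' x) ^+ 2.
Proof.
move=> sF sF' sG sG'; apply: le_trans (E_sqrD_le (sqintB sF sG) (sqintB sF' sG')).
rewrite le_eqVlt; apply/orP; left; apply/eqP.
by apply: eq_Rintegral => x _; rewrite opprD addrACA.
Qed.

Lemma approximableD F F' : approximable F -> approximable F' ->
  approximable (fun x => F x + F' x).
Proof.
move=> [s1 s2 H] [s1' s2' H']; split; [exact: sqintD..|move=> e e0].
have e40 : 0 < e / 4 by rewrite divr_gt0.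
have [G [dG G1 G2]] := H _ e40; have [G' [dG' G1' G2']] := H' _ e40.
exists (fun x => G x + G' x); split; first exact: discretized_op.
  apply: le_trans (mean_square_add s1 s1' _ _) _; try exact: sqint_discretized.
  lra.
apply: le_trans (mean_square_add s2 s2' _ _) _; try exact: sqint_discretized.
lra.
Qed.

Lemma approximableZ (k : R) F : approximable F -> approximable (fun x => k * F x).
Proof.
move=> [s1 s2 H]; split; [exact: sqintZl..|move=> e e0].
have k0 : 0 < k ^+ 2 + 1 by rewrite ltr_wpDl ?sqr_ge0.
have [G [dG G1 G2]] := H _ (divr_gt0 e0 k0).
have E (nu : probability (l.-tuple X) R) : sqint nu F ->
    \int[nu]_x (F x - G x) ^+ 2 <= e / (k ^+ 2 + 1) ->
    \int[nu]_x (k * F x - k * G x) ^+ 2 <= e.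
  move=> sF le; have sG := sqint_discretized nu dG.
  have -> : \int[nu]_x (k * F x - k * G x) ^+ 2 =
      k ^+ 2 * \int[nu]_x (F x - G x) ^+ 2.
    rewrite -E_Zl; last exact: sqint_sqr (sqintB sF sG).
    by apply: eq_Rintegral => x _; ring.
  apply: (@le_trans _ _ ((k ^+ 2 + 1) * (e / (k ^+ 2 + 1)))).
    apply: ler_pM => //; [exact: sqr_ge0|exact: E_sqr_ge0|by rewrite lerDl].
  by rewrite mulrCA divff ?mulr1// lt0r_neq0.
exists (fun x => k * G x); split; [|exact: E..].
exact: (discretized_op (fun _ b => k * b) dG dG).
Qed.

Lemma approximable_limit F : sqint nu1 F -> sqint nu2 F ->
  (forall e : R, 0 < e -> exists F', [/\ approximable F',
      E1 (fun x => (F x - F' x) ^+ 2) <= e & E2 (fun x => (F x - F' x) ^+ 2) <= e]) ->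
  approximable F.
Proof.
move=> s1 s2 H; split => // e e0; have e40 : 0 < e / 4 by rewrite divr_gt0.
have [F' [[s1' s2' H'] F1 F2]] := H _ e40; have [G [dG G1 G2]] := H' _ e40.
exists G; split => //.
  apply: le_trans (E_sqrB_le s1 s1' (sqint_discretized _ dG)) _; lra.
apply: le_trans (E_sqrB_le s2 s2' (sqint_discretized _ dG)) _; lra.
Qed.

Lemma approximable_sum J (r : seq J) (F : J -> l.-tuple X -> R) :
  (forall j, approximable (F j)) -> approximable (fun x => \sum_(j <- r) F j x).
Proof.
move=> aF; elim: r => [|j r IH].
  under eq_fun do rewrite big_nil.
  by apply: approximable_discretized; exact: discretized_cst.
by under eq_fun do rewrite big_cons; exact: approximableD.
Qed.

Lemma approximable_dominated (u : nat -> l.-tuple X -> R) (F h : l.-tuple X -> R) :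
  (forall n, approximable (u n)) -> measurable_fun setT F ->
  sqint nu1 h -> sqint nu2 h ->
  (forall n x, `|u n x| <= h x) -> (forall x, `|F x| <= h x) ->
  (forall x, u ^~ x @ \oo --> F x) -> approximable F.
Proof.
move=> au mF s1 s2 uh Fh uF.
have mu n : measurable_fun setT (u n) by case: (au n) => -[].
have Fh2 x : F x ^+ 2 <= h x ^+ 2.
  have := Fh x; rewrite ler_norml => /andP[h1 h2].
  have : 0 <= (h x - F x) * (h x + F x) by apply: mulr_ge0; lra.
  by rewrite !expr2; lra.
apply: approximable_limit; [exact: sqint_le s1|exact: sqint_le s2|move=> e e0].
have /cvg_epsP/(_ e e0)[N1 H1] := dominated_mean_square_cvg mu mF s1 uh Fh uF.
have /cvg_epsP/(_ e e0)[N2 H2] := dominated_mean_square_cvg mu mF s2 uh Fh uF.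
exists (u (N1 + N2)%N); split => //.
  have := H1 _ (leq_addr N2 N1); rewrite subr0; exact: le_trans (ler_norm _).
have := H2 _ (leq_addl N1 N2); rewrite subr0; exact: le_trans (ler_norm _).
Qed.

(** Rectangles are discretized, and the other two cases of [rect_ind] are a linear
    combination and a bounded pointwise limit. *)
Lemma approximable_indic (A : set (l.-tuple X)) : measurable A ->
  approximable (\1_A : l.-tuple X -> R).
Proof.
move: A; apply: rect_ind.
- by move=> A mA; apply: approximable_discretized; exact: discretized_rect.
- move=> S mS aS.
  have -> : \1_(~` S) = (fun x => 1 + (-1) * \1_S x) :> (l.-tuple X -> R).
    apply/funext => x; rewrite !indicE in_setC mulN1r.
    by case: (x \in S); rewrite /= ?subrr ?subr0.
  apply: approximableD; last exact: approximableZ.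
  by apply: approximable_discretized; exact: discretized_cst.
move=> F mF tF aF.
have m1 n : approximable (fun x => \sum_(0 <= k < n) \1_(F k) x).
  by apply: approximable_sum => k; exact: aF.
have s n x : \sum_(0 <= k < n) \1_(F k) x = (\1_(\bigcup_(k < n) F k) x : R).
  elim: n => [|n IH].
    rewrite big_geq// indicE memNset// => -[k] /=.
    by rewrite ltn0.
  rewrite big_nat_recr//= IH !indicE.
  have -> : \bigcup_(k < n.+1) F k = \bigcup_(k < n) F k `|` F n.
    apply/seteqP; split => y.
      move=> [k /=]; rewrite ltnS leq_eqVlt => /orP[/eqP ->|kn] Fk; first by right.
      by left; exists k.
    by move=> [[k /= kn Fk]|Fn]; [exists k => //=; exact: ltnW|exists n => /=].
  rewrite in_setU; have [xn|_] := boolP (x \in F n); last by rewrite addr0 orbF.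
  rewrite memNset ?add0r// => -[k /= kn Fk].
  have := tF k n I I; rewrite inE in xn => H.
  by have kn' := H (ex_intro _ x (conj Fk xn)); rewrite kn' ltnn in kn.
apply: (approximable_dominated (u := fun n x => \sum_(0 <= k < n) \1_(F k) x)
  (h := fun _ => 1)) => //; [|exact: sqint_cst|exact: sqint_cst|..].
- apply: measurable_indic; exact: bigcup_measurable.
- by move=> n x; rewrite s indicE; case: (_ \in _); rewrite ?normr1 ?normr0.
- by move=> x; rewrite indicE; case: (_ \in _); rewrite ?normr1 ?normr0.
move=> x; apply/cvg_epsP => e e0.
have [|xF] := boolP (x \in \bigcup_k F k).
  rewrite inE => -[k _ Fk]; exists k.+1 => n kn.
  rewrite s !indicE !mem_set ?subrr ?normr0 ?ltW//; last by exists k.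
  by exists k.
exists 0%N => n _; rewrite s !indicE (negbTE xF) memNset ?subrr ?normr0 ?ltW//.
by move=> [k _ Fk]; move: xF; rewrite notin_setE; apply; exists k.
Qed.

Import HBNNSimple.

Let approximable_nonneg F : (forall x, 0 <= F x) -> sqint nu1 F -> sqint nu2 F ->
  approximable F.
Proof.
move=> F0 s1 s2; have mF := s1.1.
have mEF : measurable_fun setT (EFin \o F) by exact/measurable_EFinP.
pose u := nnsfun_approx (@measurableT _ (l.-tuple X)) mEF.
have uF x : (u ^~ x) @ \oo --> F x.
  have EF0 y : [set: l.-tuple X] y -> (0 <= (EFin \o F) y)%E.
    by move=> _; rewrite lee_fin.
  have H : EFin \o (u ^~ x) @ \oo --> (EFin \o F) x by exact: cvg_nnsfun_approx.
  by move: H => /fine_cvgP[].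
have ule n x : u n x <= F x.
  have nd : nondecreasing_seq (u ^~ x).
    by move=> a b ab; exact/lefP/nd_nnsfun_approx.
  rewrite -(cvg_lim _ (uF x))//.
  by apply: nondecreasing_cvgn_le => //; apply/cvg_ex; exists (F x); exact: uF.
apply: (approximable_dominated (u := fun n => u n) (h := F)) => //.
- move=> n.
  have -> : (u n : _ -> R) = fun x =>
      \sum_(y <- finmap.enum_fset (fset_set (range (u n)))) y * \1_(u n @^-1` [set y]) x.
    by apply/funext => x; rewrite [LHS]fimfunE fsbig_finite.
  apply: approximable_sum => y; apply: approximableZ; apply: approximable_indic.
  by rewrite -[X in measurable X]setTI; exact: measurable_funP.
- by move=> n x; rewrite ger0_norm.
- by move=> x; rewrite ger0_norm.
Qed.

(** Nonnegative functions are increasing limits of simple functions, dominated by the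
    function itself. *)
Lemma approximable_sqint F : sqint nu1 F -> sqint nu2 F -> approximable F.
Proof.
move=> s1 s2; have mF := s1.1.
have E x : F x = Num.max (F x) 0 + (-1) * Num.max (- F x) 0.
  have [h|/ltW h] := leP 0 (F x).
    have h' : - F x <= 0 by rewrite oppr_le0.
    by rewrite ?(elimT max_idPl h) (elimT max_idPr h') mulr0 addr0.
  have h' : 0 <= - F x by rewrite oppr_ge0.
  by rewrite ?(elimT max_idPr h) (elimT max_idPl h') mulN1r opprK add0r.
have mp : measurable_fun setT (fun x => Num.max (F x) 0) by exact: measurable_maxr.
have mn : measurable_fun setT (fun x => Num.max (- F x) 0).
  by apply: measurable_maxr => //; exact: measurableT_comp.
have lep x : Num.max (F x) 0 ^+ 2 <= F x ^+ 2.
  by rewrite maxElt; case: ifP => _ //; rewrite expr0n /= sqr_ge0.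
have len x : Num.max (- F x) 0 ^+ 2 <= F x ^+ 2.
  by rewrite maxElt; case: ifP => _; rewrite ?sqrrN// expr0n /= sqr_ge0.
rewrite (funext E); apply: approximableD; last apply: approximableZ;
  apply: approximable_nonneg.
- by move=> x; rewrite le_max lexx orbT.
- exact: sqint_le s1.
- exact: sqint_le s2.
- by move=> x; rewrite le_max lexx orbT.
- exact: sqint_le s1.
- exact: sqint_le s2.
Qed.

End density.

End discretized_functions.

(** * Domination by a product measure and the last coordinate *)

Section domination.
Context d0 (Omega : measurableType d0) d (X : measurableType d) (R : realType).
Variables (P : probability Omega R) (mu : probability X R) (l : nat) (C : R).
Variable W : {mfun Omega >-> l.-tuple X}.
Hypothesis C_ge0 : 0 <= C.
Hypothesis W_rect : forall A : 'I_l -> set X, (forall a, measurable (A a)) ->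
  fine (P (W @^-1` rect A)) <= C * \prod_a fine (mu (A a)).

Let nu1 : probability (l.-tuple X) R := distribution P W.
Let nu2 : probability (l.-tuple X) R := product_power mu l.

Lemma fine_product_power_rect (A : 'I_l -> set X) : (forall a, measurable (A a)) ->
  fine (product_power mu l (rect A)) = \prod_a fine (mu (A a)).
Proof.
move=> mA; rewrite product_power_rect//.
have -> : (\prod_(a < l) mu (A a))%E = (\prod_(a < l) (fine (mu (A a)))%:E)%E.
  by apply: eq_bigr => a _; rewrite fineK// fin_num_measure.
by rewrite -(big_morph EFin (@EFinM R) (erefl _)).
Qed.

Lemma coding_preimage (I : finType) (g : X -> I) y :
  coding g @^-1` [set y] = rect (fun a : 'I_l => g @^-1` [set y a]).
Proof.
apply/seteqP; split => x /=.
  by move=> <- a /=; rewrite ffunE.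
by move=> H; apply/ffunP => a; rewrite ffunE; exact: H.
Qed.

Let dominate_discretized G : discretized G ->
  \int[nu1]_x G x ^+ 2 <= C * \int[nu2]_x G x ^+ 2.
Proof.
move=> [I [g [phi [mg GE]]]]; have fc := finite_valued_coding (l := l) mg.
have E (nu : probability (l.-tuple X) R) :
    \int[nu]_x G x ^+ 2 = \sum_y phi y ^+ 2 * mass nu (coding g) y.
  rewrite -(E_finite_valued nu (fun y => phi y ^+ 2) fc).
  by apply: eq_Rintegral => x _; rewrite GE.
rewrite !E mulr_sumr; apply: ler_sum => y _; rewrite mulrCA ler_wpM2l ?sqr_ge0//.
by rewrite /mass coding_preimage [in leRHS]fine_product_power_rect//; exact: W_rect.
Qed.

Let sqr_split (nu : probability (l.-tuple X) R) F G (t : R) : 0 < t ->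
  sqint nu F -> sqint nu G ->
  \int[nu]_x F x ^+ 2 <=
  (1 + t) * \int[nu]_x G x ^+ 2 + (1 + t^-1) * \int[nu]_x (F x - G x) ^+ 2.
Proof.
move=> t0 sF sG; have sFG := sqintB sF sG.
rewrite -!E_Zl; [|exact: sqint_sqr..].
rewrite -E_D; [|apply: L1Zl; exact: sqint_sqr..].
apply: E_le; [exact: sqint_sqr|by apply: L1D; apply: L1Zl; exact: sqint_sqr|].
move=> x; rewrite -subr_ge0.
have -> : (1 + t) * G x ^+ 2 + (1 + t^-1) * (F x - G x) ^+ 2 - F x ^+ 2 =
    t^-1 * (t * G x - (F x - G x)) ^+ 2 by field; rewrite lt0r_neq0.
by rewrite mulr_ge0 ?invr_ge0 ?sqr_ge0// ltW.
Qed.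

(** Passage to the limit from discretized functions. The weighted inequality
    [sqr_split], with weight [t] and an approximation at distance [t ^+ 2], costs an
    error of order [t]. *)
Let dominate_sqint F : sqint nu1 F -> sqint nu2 F ->
  \int[nu1]_x F x ^+ 2 <= C * \int[nu2]_x F x ^+ 2.
Proof.
move=> s1 s2; have [_ _ aF] := approximable_sqint s1 s2.
set A1 := \int[nu1]_x _; set A2 := \int[nu2]_x _.
have A20 : 0 <= A2 by exact: E_sqr_ge0.
have CA : 0 <= C * A2 by exact: mulr_ge0.
(* coefficient of t once every t ^+ 2 below is bounded by t *)
pose B := 3 * (C * A2) + 4 * C + 2.
have B0 : 0 < B by rewrite /B ltr_wpDl// addr_ge0// ?mulr_ge0.
have key t : 0 < t -> t <= 1 -> A1 <= C * A2 + t * B.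
  move=> t0 t1; have [G [dG G1 G2]] := aF _ (exprn_gt0 2 t0).
  have sG nu := sqint_discretized nu dG.
  have h1 := sqr_split t0 s1 (sG nu1); have h2 := sqr_split t0 (sG nu2) s2.
  have h3 := dominate_discretized dG.
  have ti : 0 <= 1 + t^-1 by rewrite addr_ge0// invr_ge0 ltW.
  have tt : (1 + t^-1) * t ^+ 2 = t ^+ 2 + t by field; rewrite lt0r_neq0.
  have e1 : (1 + t^-1) * \int[nu1]_x (F x - G x) ^+ 2 <= t ^+ 2 + t.
    by rewrite -tt ler_wpM2l.
  have e2 : (1 + t^-1) * \int[nu2]_x (G x - F x) ^+ 2 <= t ^+ 2 + t.
    rewrite -tt ler_wpM2l// (le_trans _ G2)// le_eqVlt; apply/orP; left; apply/eqP.
    by apply: eq_Rintegral => x _; rewrite -sqrrN opprB.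
  rewrite -/A1 in h1; rewrite -/A2 in h2.
  have t2 : t ^+ 2 <= t by rewrite expr2 ler_piMl// ltW.
  have h4 : \int[nu2]_x G x ^+ 2 <= (1 + t) * A2 + 2 * t by lra.
  have h5 : \int[nu1]_x G x ^+ 2 <= C * ((1 + t) * A2 + 2 * t).
    by apply: (le_trans h3); rewrite ler_wpM2l.
  have h6 : (1 + t) * \int[nu1]_x G x ^+ 2 <= (1 + t) * (C * ((1 + t) * A2 + 2 * t)).
    by rewrite ler_wpM2l// addr_ge0// ltW.
  have -> : C * A2 + t * B = C * A2 + 3 * t * (C * A2) + 4 * t * C + 2 * t.
    by rewrite /B; ring.
  have h7 : (1 + t) * (C * ((1 + t) * A2 + 2 * t)) =
      C * A2 + 2 * t * (C * A2) + t ^+ 2 * (C * A2) + 2 * t * C + 2 * t ^+ 2 * C by ring.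
  have h8 : t ^+ 2 * (C * A2) <= t * (C * A2) by rewrite ler_wpM2r.
  have h9 : t ^+ 2 * C <= t * C by rewrite ler_wpM2r.
  lra.
apply/ler_addgt0Pr => e e0.
have [eB|Be] := leP (e / B) 1.
  apply: (le_trans (key (e / B) _ eB)); first exact: divr_gt0.
  by rewrite divfK// lt0r_neq0.
apply: (le_trans (key 1 ltr01 (lexx _))); rewrite mul1r lerD2l ltW//.
by rewrite -[B]mul1r -ltr_pdivlMr.
Qed.

(** An inequality between measures of rectangles extends to mean squares of all
    functions. Square integrability under the law of [W] is not known beforehand, so the
    truncations [min (|F|, n)] are treated first and [n] tends to infinity by monotone
    convergence. *)
Lemma domination F : sqint (product_power mu l) F ->
  sqint P (F \o W) /\ \int[P]_w F (W w) ^+ 2 <=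
    C * \int[product_power mu l]_x F x ^+ 2.
Proof.
move=> sF; have mF : measurable_fun [set: l.-tuple X] F := sF.1.
pose u (n : nat) x : R := Num.min `|F x| n%:R.
have u0 n x : 0 <= u n x by rewrite le_min normr_ge0 ler0n.
have uF n x : u n x <= `|F x| by rewrite ge_min lexx.
have un n x : u n x <= n%:R by rewrite ge_min lexx orbT.
have mu_ n : measurable_fun [set: l.-tuple X] (u n).
  by apply: measurable_minr => //; exact: measurableT_comp.
have uF2 n x : u n x ^+ 2 <= F x ^+ 2.
  by rewrite -[leRHS]real_normK ?num_real// lerXn2r ?nnegrE.
have s1 n : sqint nu1 (u n).
  apply: (sqint_le (mu_ n) _ (sqint_cst nu1 n%:R)) => x.
  by rewrite lerXn2r ?nnegrE// ler0n.
have s2 n : sqint nu2 (u n) by exact: sqint_le sF.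
have le_n n : \int[nu1]_x u n x ^+ 2 <= C * \int[nu2]_x F x ^+ 2.
  apply: (le_trans (dominate_sqint (s1 n) (s2 n))); rewrite ler_wpM2l//.
  by apply: E_le => //; exact: sqint_sqr.
have lim x : limn (fun n => (u n x ^+ 2)%:E) = (F x ^+ 2)%:E.
  apply/cvg_lim => //; apply/fine_cvgP; split; first by near=> n.
  apply/cvg_epsP => e e0; exists (Num.truncn `|F x|).+1 => n nF.
  have Fn : `|F x| <= n%:R.
    by apply/ltW/(lt_le_trans (truncnS_gt _)); rewrite ler_nat.
  by rewrite /= /u (elimT min_idPl Fn) real_normK ?num_real// subrr normr0 ltW.
have F1 : (\int[nu1]_x ((F x) ^+ 2)%:E <= (C * \int[nu2]_x F x ^+ 2)%:E)%E.
  have := @cvg_monotone_convergence _ _ _ nu1 setT measurableT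
    (fun n x => (u n x ^+ 2)%:E) _ _ _.
  have -> : (fun x => limn (fun n => (u n x ^+ 2)%:E)) = fun x => (F x ^+ 2)%:E.
    by apply/funext => x; exact: lim.
  move=> H; have {}H : (fun n => \int[nu1]_x (u n x ^+ 2)%:E)%E @ \oo -->
      (\int[nu1]_x (F x ^+ 2)%:E)%E.
    apply: H.
    - by move=> n; apply/measurable_EFinP; exact: measurable_funX.
    - by move=> n x _; rewrite lee_fin sqr_ge0.
    - move=> x _ a b ab; rewrite lee_fin lerXn2r ?nnegrE//.
      by rewrite le_min uF /= (le_trans (un a x))// ler_nat.
  apply: (cvge_to_le H); near=> n.
  by rewrite (EFin_E_sqr (s1 n)) lee_fin.
have s1F : sqint nu1 F by split => //; exact: le_lt_trans F1 (ltry _).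
have tr : (\int[P]_w ((F (W w)) ^+ 2)%:E = \int[nu1]_x ((F x) ^+ 2)%:E)%E.
  rewrite [RHS]ge0_integral_distribution//.
    by apply/measurable_EFinP; exact: measurable_funX.
  by move=> x; rewrite lee_fin sqr_ge0.
split; last by rewrite /Rintegral tr; exact: dominate_sqint.
split; last by rewrite tr; case: s1F.
exact: measurableT_comp.
Unshelve. all: by end_near. Qed.

End domination.

Section product_power_integral.
Context d (X : measurableType d) (R : realType) (mu : probability X R) (l : nat).
Variables (I : finType) (g : X -> I).
Hypothesis mg : forall i, measurable (g @^-1` [set i]).

Lemma E_product_power_coding (f : {ffun 'I_l -> I} -> R) :
  \int[product_power mu l]_x f (coding g x) =
  \sum_y weight (state_mass mu g) y * f y.
Proof.
rewrite (E_finite_valued (product_power mu l) f (finite_valued_coding (l := l) mg)).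
apply: eq_bigr => y _; rewrite mulrC; congr (_ * _).
by rewrite /mass coding_preimage fine_product_power_rect.
Qed.

End product_power_integral.

Section last_coordinate.
Context d (X : measurableType d) (R : realType) (mu : probability X R) (l : nat).
Hypothesis l_gt0 : (0 < l)%N.
Local Notation nu := (product_power mu l).
Local Notation T := (l.-tuple X).
Implicit Types F G : T -> R.

Let last : 'I_l := Ordinal (etrans (ltn_predL l) l_gt0).

Let set_last_pair (z : T * X) : T := set_last z.1 z.2.

Let measurable_set_last : measurable_fun [set: T * X] set_last_pair.
Proof.
apply/measurable_fun_tnthP => i.
have -> : (@tnth l X)^~ i \o set_last_pair =
    (fun z => if val i == l.-1 then z.2 else tnth z.1 i).
  by apply/funext => z; rewrite /= tnth_mktuple.
case: (val i == l.-1) => /=; first exact: measurable_snd.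
exact: (measurableT_comp (measurable_tnth i) measurable_fst).
Qed.

HB.instance Definition _ :=
  isMeasurableFun.Build _ _ _ _ set_last_pair measurable_set_last.

(** Replacing the last coordinate by an independent one preserves the product measure,
    so this is [domination] with constant 1. *)
Lemma set_last_domination F : sqint nu F ->
  (\int[nu \x mu]_z ((F (set_last z.1 z.2)) ^+ 2)%:E <=
   (\int[nu]_x F x ^+ 2)%:E)%E.
Proof.
move=> sF.
have Wr (A : 'I_l -> set X) : (forall a, measurable (A a)) ->
    fine ((nu \x mu)%E (set_last_pair @^-1` rect A)) <= 1 * \prod_a fine (mu (A a)).
  move=> mA; rewrite mul1r.
  have -> : set_last_pair @^-1` rect A =
      rect (fun a => if a == last then setT else A a) `*` A last.
    apply/seteqP; split => -[x y] /=.
      move=> H; split; last by have := H last; rewrite tnth_mktuple /= eqxx.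
      move=> a; case: eqP => // /eqP al; have := H a; rewrite tnth_mktuple.
      by rewrite -val_eqE /= in al; rewrite (negbTE al).
    move=> [H1 H2] a; rewrite tnth_mktuple; case: eqP => [al|/eqP al].
      by have -> : a = last by exact: val_inj.
    by have := H1 a; rewrite -val_eqE /= (negbTE al).
  have mA' a : measurable (if a == last then setT else A a) by case: ifP.
  rewrite product_measure1E//; last exact: measurable_rect.
  rewrite fineM ?fin_num_measure//; last exact: measurable_rect.
  rewrite fine_product_power_rect// (bigD1 last)//= eqxx probability_setT mul1r.
  rewrite [leRHS](bigD1 last)//= mulrC le_eqVlt; apply/orP; left; apply/eqP.
  by congr (_ * _); apply: eq_bigr => a /negbTE ->.
have [s le] := @domination _ _ _ _ _ (nu \x mu)%E mu l 1 set_last_pair ler01 Wr _ sF.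
rewrite mul1r in le.
by rewrite (EFin_E_sqr s) lee_fin.
Qed.

Definition last_average F (x : T) : R := \int[mu]_y F (set_last x y).

Lemma last_centeredE F x : last_centered mu F x = F x - last_average F x.
Proof. by []. Qed.

Lemma measurable_last_average F : measurable_fun setT F ->
  measurable_fun setT (last_average F).
Proof.
move=> mF; apply: measurableT_comp => //.
pose f (z : T * X) := (F (set_last z.1 z.2))%:E.
have mf : measurable_fun setT f.
  by apply/measurable_EFinP; apply: (measurableT_comp mF); exact: measurable_set_last.
have -> : (fun x => \int[mu]_y (F (set_last x y))%:E)%E =
    (fun x => \int[mu]_y f^\+ (x, y) - \int[mu]_y f^\- (x, y))%E.
  by apply/funext => x; rewrite [LHS]integralE; congr (_ - _)%E;
    apply: eq_integral => y _; rewrite ?funeposE ?funenegE.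
apply: emeasurable_funB.
  by apply: (measurable_fun_fubini_tonelli_F f^\+)%E => //; exact: measurable_funepos.
by apply: (measurable_fun_fubini_tonelli_F f^\-)%E => //; exact: measurable_funeneg.
Qed.

Lemma measurable_set_last_section x : measurable_fun setT (@set_last d X l x).
Proof.
apply/measurable_fun_tnthP => i.
have -> : (@tnth l X)^~ i \o set_last x =
    (fun y => if val i == l.-1 then y else tnth x i).
  by apply/funext => z; rewrite /= tnth_mktuple.
by case: (val i == l.-1); [exact: measurable_id|exact: measurable_cst].
Qed.

Lemma coding_set_last (I : finType) (g : X -> I) x y :
  coding g (set_last x y) = update last (g y) (coding g x).
Proof.
apply/ffunP => a; rewrite !ffunE tnth_mktuple -val_eqE /=.
by case: ifP.
Qed.

Lemma section_discretized G x : discretized G -> L1 mu (fun y => G (set_last x y)).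
Proof.
move=> [I [g [phi [mg GE]]]].
have := finite_valued_L1 mu (fun v => phi (update last v (coding g x))) mg.
by congr L1; apply/funext => y; rewrite GE coding_set_last.
Qed.

(** For discretized functions the centering of the last coordinate is the last
    martingale difference, to which the estimates of the previous parts apply. *)
Lemma last_centered_coding (I : finType) (g : X -> I) (phi : {ffun 'I_l -> I} -> R) F :
  (forall i, measurable (g @^-1` [set i])) -> (forall x, F x = phi (coding g x)) ->
  forall x, last_centered mu F x = component (state_mass mu g) l.-1 phi (coding g x).
Proof.
move=> mg FE x; rewrite last_centeredE /component.
have m1 := state_mass_sum1 mu mg; rewrite prednK// (proj_last m1) FE.
congr (_ - _); rewrite -[RHS](proj_average m1 last) /last_average.
transitivity (\int[mu]_y (fun v => phi (update last v (coding g x))) (g y)).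
  by apply: eq_Rintegral => y _; rewrite FE coding_set_last.
rewrite (E_finite_valued mu (fun v => phi (update last v (coding g x))) mg).
apply: eq_bigr => v _; rewrite mulrC; congr (_ * _).
by rewrite /= prednK// (proj_last m1).
Qed.

(** Jensen's inequality for the integral over the last coordinate. When the right-hand
    side is infinite there is nothing to prove, and this is the only case in which the
    section of [F] may fail to be integrable. *)
Lemma last_average_contraction F G x : measurable_fun setT F -> discretized G ->
  (((last_average F x - last_average G x) ^+ 2)%:E <=
   \int[mu]_y ((F (set_last x y) - G (set_last x y)) ^+ 2)%:E)%E.
Proof.
move=> mF dG; set J := (\int[mu]_y _)%E.
have [->|Joo] := eqVneq J +oo%E; first exact: leey.
have iG := section_discretized x dG.
have mFx : measurable_fun setT (fun y => F (set_last x y)).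
  exact: (measurableT_comp mF (measurable_set_last_section x)).
have s : sqint mu (fun y => F (set_last x y) - G (set_last x y)).
  split; last by rewrite ltey.
  by apply: measurable_funB => //; exact: L1_measurable iG.
have iF : L1 mu (fun y => F (set_last x y)).
  have := L1D (sqint_L1 s) iG; congr L1; apply/funext => y; exact: subrK.
rewrite /J (EFin_E_sqr s) lee_fin /last_average -E_B//.
exact: sqr_E_le.
Qed.

(** Averaging over the last coordinate is a contraction in mean square. *)
Lemma last_centered_mean_square F G : sqint nu F -> discretized G ->
  sqint nu (fun x => last_centered mu F x - last_centered mu G x) /\
  \int[nu]_x (last_centered mu F x - last_centered mu G x) ^+ 2 <=
    4 * \int[nu]_x (F x - G x) ^+ 2.
Proof.
move=> sF dG; have mF := sF.1; have sG := sqint_discretized nu dG.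
have mG := sG.1; have sFG := sqintB sF sG.
pose A x := last_average F x - last_average G x.
have mA : measurable_fun setT A by apply: measurable_funB; exact: measurable_last_average.
have leA : (\int[nu]_x ((A x) ^+ 2)%:E <= (\int[nu]_x (F x - G x) ^+ 2)%:E)%E.
  apply: le_trans (set_last_domination sFG).
  pose h (z : T * X) := ((F (set_last z.1 z.2) - G (set_last z.1 z.2)) ^+ 2)%:E.
  have mh : measurable_fun setT h.
    apply/measurable_EFinP; apply: measurable_funX.
    exact: (measurableT_comp sFG.1 measurable_set_last).
  have h0 z : (0 <= h z)%E by rewrite lee_fin sqr_ge0.
  rewrite (fubini_tonelli1 h mh h0); apply: ge0_le_integral => //.
  - by move=> x _; rewrite lee_fin sqr_ge0.
  - by apply/measurable_EFinP; exact: measurable_funX.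
  - exact: measurable_fun_fubini_tonelli_F.
  - by move=> x _; exact: last_average_contraction.
have sA : sqint nu A by split => //; exact: le_lt_trans leA (ltry _).
have leA' : \int[nu]_x A x ^+ 2 <= \int[nu]_x (F x - G x) ^+ 2.
  by rewrite -lee_fin -(EFin_E_sqr sA).
have E x : last_centered mu F x - last_centered mu G x = (F x - G x) - A x.
  by rewrite !last_centeredE /A; ring.
have sE : sqint nu (fun x => last_centered mu F x - last_centered mu G x).
  by rewrite (funext E); exact: sqintB.
split => //.
have -> : \int[nu]_x (last_centered mu F x - last_centered mu G x) ^+ 2 =
    \int[nu]_x (((F x - G x) - 0) - (A x - 0)) ^+ 2.
  by apply: eq_Rintegral => x _; rewrite E !subr0.
apply: le_trans (_ : 2 * \int[nu]_x (F x - G x) ^+ 2 + 2 * \int[nu]_x A x ^+ 2 <= _).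
  have := E_sqrD_le sFG (sqintZl (-1) sA).
  have -> : \int[nu]_x (-1 * A x) ^+ 2 = \int[nu]_x A x ^+ 2.
    by apply: eq_Rintegral => x _; ring.
  apply: le_trans; rewrite le_eqVlt; apply/orP; left; apply/eqP.
  by apply: eq_Rintegral => x _; ring.
lra.
Qed.

End last_coordinate.

(** * Extension of variance limits by density *)

Section extension.
Context d0 (Omega : measurableType d0) d (X : measurableType d) (R : realType).
Variables (P : probability Omega R) (mu : probability X R) (l : nat).
Local Notation nu := (product_power mu l).
Local Notation T := (l.-tuple X).
Local Notation normT F := (\int[nu]_x F x ^+ 2).
Implicit Types F G : T -> R.

Definition centered_discretized G : Prop :=
  discretized G /\ \int[nu]_x G x = 0.

Lemma mean_square_approximant_le F G : sqint nu F -> discretized G ->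
  normT G <= 2 * normT F + 2 * \int[nu]_x (F x - G x) ^+ 2.
Proof.
move=> sF dG; have sG := sqint_discretized nu dG.
have := E_sqrD_le sF (sqintB sG sF).
have -> : \int[nu]_x (F x + (G x - F x)) ^+ 2 = normT G.
  by apply: eq_Rintegral => x _; rewrite addrC subrK.
have -> // : \int[nu]_x (G x - F x) ^+ 2 = \int[nu]_x (F x - G x) ^+ 2.
by apply: eq_Rintegral => x _; rewrite -sqrrN opprB.
Qed.

(** The mean of an approximant is small since that of [F] is zero, so subtracting it
    does not spoil the approximation. *)
Lemma centered_approximation F e : sqint nu F -> \int[nu]_x F x = 0 -> 0 < e ->
  exists2 G, centered_discretized G & \int[nu]_x (F x - G x) ^+ 2 <= e.
Proof.
move=> sF F0 e0; have [_ _ aF] := approximable_sqint sF sF.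
have e40 : 0 < e / 4 by rewrite divr_gt0.
have [G [dG G1 _]] := aF _ e40; have sG := sqint_discretized nu dG.
pose k := \int[nu]_x G x.
have dk := discretized_cst X l k.
have dGk : discretized (fun x => G x - k) by exact: (discretized_op (fun a b => a - b)).
exists (fun x => G x - k); first split => //.
  by rewrite E_B ?E_cst ?subrr//; [exact: sqint_L1|exact: L1_cst].
have sFG := sqintB sF sG.
have k2 : k ^+ 2 <= \int[nu]_x (F x - G x) ^+ 2.
  have := sqr_E_le sFG; rewrite E_B; [|exact: sqint_L1..].
  by rewrite F0 sub0r sqrrN.
have := E_sqrD_le sFG (sqint_cst nu k); rewrite E_cst.
have -> : \int[nu]_x (F x - G x + k) ^+ 2 = \int[nu]_x (F x - (G x - k)) ^+ 2.
  by apply: eq_Rintegral => x _; rewrite opprB addrA addrAC.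
lra.
Qed.

(** [V N F] stands for a sum of [N] samples of [F]. On centered discretized functions
    its second moment grows linearly, uniformly in the mean square of the function; on
    all functions only a bound [c N], with no control on the growth of [c], is assumed. *)
Variable V : nat -> (T -> R) -> Omega -> R.
Variables (B D : R) (c : nat -> R).
Hypotheses (B_ge0 : 0 <= B) (D_ge0 : 0 <= D) (c_ge0 : forall N, 0 <= c N).
Hypothesis V_sqint : forall N F, sqint nu F -> sqint P (V N F).
Hypothesis V_continuous : forall N F G, sqint nu F -> discretized G ->
  \int[P]_w (V N F w - V N G w) ^+ 2 <= c N * \int[nu]_x (F x - G x) ^+ 2.
Hypothesis V_subtract : forall N G G' w, discretized G -> discretized G' ->
  V N (fun x => G x - G' x) w = V N G w - V N G' w.
Hypothesis V_variance : forall N G, centered_discretized G ->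
  \int[P]_w V N G w ^+ 2 <= B * normT G * N%:R.
Hypothesis V_mean : forall N G, centered_discretized G ->
  `|\int[P]_w V N G w| <= D * (normT G + 1).

Let sV N G : discretized G -> sqint P (V N G).
Proof. by move=> dG; apply: V_sqint; exact: sqint_discretized. Qed.

(** The linear growth extends to [F - G]: an auxiliary approximant [H] of [F], as close
    as one likes depending on [N], makes the contribution of [c N] negligible. *)
Lemma variance_difference_bound N F G : sqint nu F -> \int[nu]_x F x = 0 ->
  centered_discretized G ->
  \int[P]_w (V N F w - V N G w) ^+ 2 <=
    4 * B * N%:R * \int[nu]_x (F x - G x) ^+ 2.
Proof.
move=> sF F0 cG; have [dG G0] := cG; have sG := sqint_discretized nu dG.
set J := \int[nu]_x _.
(* if H is at squared distance e / Z from F, the terms due to H add up to at most e *)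
pose Z := 2 * c N + 4 * B * N%:R + 1.
have BN : 0 <= 4 * B * N%:R by rewrite !mulr_ge0.
have Z0 : 0 < Z by rewrite ltr_wpDl// addr_ge0// mulr_ge0.
apply/ler_addgt0Pr => e e0.
have [H cH FH] := centered_approximation sF F0 (divr_gt0 e0 Z0).
have [dH H0] := cH; have sH := sqint_discretized nu dH.
apply: (le_trans (E_sqrB_le (V_sqint N sF) (sV N dH) (sV N dG))).
have h1 : \int[P]_w (V N F w - V N H w) ^+ 2 <= c N * (e / Z).
  by apply: (le_trans (V_continuous N sF dH)); rewrite ler_wpM2l.
have cHG : centered_discretized (fun x => H x - G x).
  split; first exact: (discretized_op (fun a b => a - b)).
  by rewrite E_B ?H0 ?G0 ?subrr//; exact: sqint_L1.
have h2 : \int[P]_w (V N H w - V N G w) ^+ 2 <=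
    B * (2 * (e / Z) + 2 * J) * N%:R.
  have -> : \int[P]_w (V N H w - V N G w) ^+ 2 =
      \int[P]_w V N (fun x => H x - G x) w ^+ 2.
    by apply: eq_Rintegral => w _; rewrite V_subtract.
  apply: (le_trans (V_variance N cHG)); rewrite ler_wpM2r// ler_wpM2l//.
  apply: le_trans (E_sqrB_le sH sF sG) _; rewrite lerD2r ler_wpM2l//.
  apply: le_trans FH; rewrite le_eqVlt; apply/orP; left; apply/eqP.
  by apply: eq_Rintegral => x _; rewrite -sqrrN opprB.
have h3 : e = e / Z * Z by rewrite divfK// lt0r_neq0.
have h4 : 0 <= e / Z by rewrite divr_ge0// ltW.
rewrite [in leRHS]h3; move: (e / Z) h1 h2 h4 => r h1 h2 h4.
have -> : 4 * B * N%:R * J + r * Z =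
  2 * (c N * r) + 2 * (B * (2 * r + 2 * J) * N%:R) + r by rewrite /Z; ring.
lra.
Qed.

(** The same device as in [variance_difference_bound]: [F] is approximated within [(c N
    + 1)^-1]. *)
Lemma mean_bound F : sqint nu F -> \int[nu]_x F x = 0 ->
  forall N, `|\int[P]_w V N F w| <= D * (2 * normT F + 3) + 1.
Proof.
move=> sF F0 N; have Z0 : 0 < c N + 1 by rewrite ltr_wpDl.
have Zi : 0 < (c N + 1)^-1 by rewrite invr_gt0.
have [G cG FG] := centered_approximation sF F0 Zi; have [dG G0] := cG.
have sF' := V_sqint N sF; have sG' := sV N dG.
have -> : \int[P]_w V N F w = \int[P]_w V N G w + \int[P]_w (V N F w - V N G w).
  by rewrite E_B; [rewrite addrC subrK|exact: sqint_L1..].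
apply: le_trans (ler_normD _ _) _; apply: lerD.
  apply: (le_trans (V_mean N cG)); rewrite ler_wpM2l//.
  have := mean_square_approximant_le sF dG.
  have : (c N + 1)^-1 <= 1 by rewrite invf_le1// lerDr.
  lra.
have sq : (\int[P]_w (V N F w - V N G w)) ^+ 2 <= 1 ^+ 2.
  apply: le_trans (sqr_E_le (sqintB sF' sG')) _.
  apply: (le_trans (V_continuous N sF dG)).
  apply: (@le_trans _ _ ((c N + 1) * (c N + 1)^-1)); last first.
    by rewrite divff ?expr1n// lt0r_neq0.
  by apply: ler_pM => //; [exact: E_sqr_ge0|rewrite lerDl].
by rewrite -(@ler_pXn2r _ 2) ?nnegrE// real_normK ?num_real.
Qed.

(** By [variance_difference_bound] the second moments per step of [F] and [G] are close
    uniformly in [N]. *)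
Lemma variance_approximation F : sqint nu F -> \int[nu]_x F x = 0 ->
  forall e : R, 0 < e -> exists2 de : R, 0 < de &
  forall G, centered_discretized G -> \int[nu]_x (F x - G x) ^+ 2 <= de ->
  forall N, (0 < N)%N ->
    `|\int[P]_w V N F w ^+ 2 / N%:R - \int[P]_w V N G w ^+ 2 / N%:R| <= e.
Proof.
move=> sF F0 e e0.
set A := normT F; have A0 : 0 <= A by exact: E_sqr_ge0.
(* up to the factor B N, both second moments are at most 4 A + 12, and the difference
   contributes 8 t *)
pose Z := B * (4 * A + 20) + 1.
have BA : 0 <= B * (4 * A + 20) by rewrite mulr_ge0// addr_ge0// mulr_ge0.
have Z0 : 0 < Z by rewrite ltr_wpDl.
pose t := Num.min 1 (e / Z).
have t0 : 0 < t by rewrite lt_min ltr01 divr_gt0.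
have t1 : t <= 1 by rewrite ge_min lexx.
have tZ : t * Z <= e by rewrite -ler_pdivlMr// ge_min lexx orbT.
exists (t ^+ 2); first exact: exprn_gt0.
move=> G cG FG N N0; have [dG _] := cG.
have NR : 0 < N%:R :> R by rewrite ltr0n.
rewrite -mulrBl normrM normfV (gtr0_norm NR) ler_pdivrMr//.
apply: le_trans (_ : t * (B * (4 * A + 20)) * N%:R <= _); last first.
  by rewrite ler_wpM2r// (le_trans _ tZ)// ler_wpM2l ?ltW// /Z ltrDl.
set a := V N F; set b := V N G.
have sa : sqint P a by exact: V_sqint.
have sb : sqint P b by exact: sV.
have sab := sqintB sa sb.
have dif := variance_difference_bound N sF F0 cG.
have t2 : t ^+ 2 <= 1 by rewrite expr_le1// ltW.
have tt : t ^+ 2 <= t by rewrite expr2 ler_piMl// ltW.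
have BN : 0 <= B * N%:R by rewrite mulr_ge0.
have G2 : normT G <= 2 * A + 2.
  by have := mean_square_approximant_le sF dG; rewrite -/A; lra.
have vb : \int[P]_w b w ^+ 2 <= (B * N%:R) * (2 * A + 2).
  apply: (le_trans (V_variance N cG)).
  by rewrite mulrAC ler_wpM2l.
have dab : \int[P]_w (a w - b w) ^+ 2 <= 4 * (B * N%:R) * t ^+ 2.
  apply: (le_trans dif); rewrite -[leLHS]mulrA -[leLHS]mulrA -!mulrA.
  by rewrite !ler_wpM2l.
have dab1 : \int[P]_w (a w - b w) ^+ 2 <= 4 * (B * N%:R).
  apply: (le_trans dab); rewrite -[leRHS]mulr1 ler_wpM2l// mulr_ge0//.
have va : \int[P]_w a w ^+ 2 <= (B * N%:R) * (4 * A + 12).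
  have := E_sqrD_le sb sab.
  have -> : \int[P]_w (b w + (a w - b w)) ^+ 2 = \int[P]_w a w ^+ 2.
    by apply: eq_Rintegral => w _; rewrite addrC subrK.
  have -> : B * N%:R * (4 * A + 12) =
    2 * (B * N%:R * (2 * A + 2)) + 2 * (4 * (B * N%:R)) by ring.
  lra.
have split (u v : Omega -> R) : sqint P u -> sqint P v ->
    \int[P]_w u w ^+ 2 - \int[P]_w v w ^+ 2 <=
    t * \int[P]_w v w ^+ 2 + (1 + t^-1) * \int[P]_w (u w - v w) ^+ 2.
  move=> su sv; rewrite -E_B; [|exact: sqint_sqr..].
  have suv := sqintB su sv.
  rewrite -!E_Zl; [|exact: sqint_sqr..].
  rewrite -E_D; [|apply: L1Zl; exact: sqint_sqr..].
  apply: E_le; [by apply: L1B; exact: sqint_sqr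
    |by apply: L1D; apply: L1Zl; exact: sqint_sqr|].
  move=> w; rewrite -subr_ge0.
  have -> : t * v w ^+ 2 + (1 + t^-1) * (u w - v w) ^+ 2 - (u w ^+ 2 - v w ^+ 2) =
      t^-1 * (t * v w - (u w - v w)) ^+ 2 by field; rewrite lt0r_neq0.
  by rewrite mulr_ge0 ?invr_ge0 ?sqr_ge0// ltW.
have E3 : (1 + t^-1) * \int[P]_w (a w - b w) ^+ 2 <= 8 * t * (B * N%:R).
  apply: (@le_trans _ _ ((1 + t^-1) * (4 * (B * N%:R) * t ^+ 2))).
    by rewrite ler_wpM2l// addr_ge0// invr_ge0 ltW.
  have -> : (1 + t^-1) * (4 * (B * N%:R) * t ^+ 2) = 4 * (B * N%:R) * (t ^+ 2 + t).
    by field; rewrite lt0r_neq0.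
  have -> : 8 * t * (B * N%:R) = 4 * (B * N%:R) * (2 * t) by ring.
  by rewrite ler_wpM2l ?mulr_ge0//; lra.
have E4 : \int[P]_w (b w - a w) ^+ 2 = \int[P]_w (a w - b w) ^+ 2.
  by apply: eq_Rintegral => w _; rewrite -sqrrN opprB.
have tv (v : Omega -> R) : \int[P]_w v w ^+ 2 <= B * N%:R * (4 * A + 12) ->
    t * \int[P]_w v w ^+ 2 <= t * (B * N%:R * (4 * A + 12)).
  by move=> h; rewrite ler_wpM2l// ltW.
have vb' : \int[P]_w b w ^+ 2 <= B * N%:R * (4 * A + 12).
  by apply: (le_trans vb); rewrite ler_wpM2l//; lra.
have h1 := split _ _ sa sb; have h2 := split _ _ sb sa; rewrite E4 in h2.
have h3 := tv _ va; have h4 := tv _ vb'.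
have -> : t * (B * (4 * A + 20)) * N%:R =
  t * (B * N%:R * (4 * A + 12)) + 8 * t * (B * N%:R) by ring.
by rewrite ler_norml; apply/andP; split; lra.
Qed.

(** A uniform limit of convergent sequences converges, and the limit depends
    continuously on the function. *)
Lemma variance_limit F (v : (T -> R) -> R) : sqint nu F -> \int[nu]_x F x = 0 ->
  (forall G, centered_discretized G ->
    (fun N => \int[P]_w V N G w ^+ 2 / N%:R) @ \oo --> v G) ->
  exists s : R, (fun N => \int[P]_w V N F w ^+ 2 / N%:R) @ \oo --> s /\
    forall e : R, 0 < e -> exists2 de : R, 0 < de &
      forall G, centered_discretized G -> \int[nu]_x (F x - G x) ^+ 2 <= de ->
      `|s - v G| <= e.
Proof.
move=> sF F0 vG; have appr := variance_approximation sF F0.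
have [s Hs] : exists s : R, (fun N => \int[P]_w V N F w ^+ 2 / N%:R) @ \oo --> s.
  apply: cvg_uniform_limit => e e0; have [de de0 Hde] := appr e e0.
  have [G cG FG] := centered_approximation sF F0 de0.
  exists (fun N => \int[P]_w V N G w ^+ 2 / N%:R), (v G); split; first exact: vG.
  exact: Hde.
exists s; split => // e e0; have [de de0 Hde] := appr e e0.
exists de => // G cG FG; apply: (cvg_lim_dist Hs (vG G cG)).
exact: Hde.
Qed.

End extension.

Section variance_and_second_moment.
Context d (Omega : measurableType d) (R : realType) (P : probability Omega R).

Lemma sqint_Lfun (Z : Omega -> R) : sqint P Z -> Z \in Lfun P 2%:E.
Proof.
move=> sZ; rewrite inE; apply/andP; split; rewrite inE /=; first exact: sZ.1.
rewrite /finite_norm unlock poweR_lty//=.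
have := sZ.2; congr (_ < _)%E; apply: eq_integral => w _ /=.
by rewrite powR_mulrn// real_normK// num_real.
Qed.

(** Bounded means make the square of the mean negligible after division by [N]. *)
Lemma variance_second_moment_cvg (Z : nat -> Omega -> R) (s B : R) :
  (forall N, sqint P (Z N)) -> (forall N, `|\int[P]_w Z N w| <= B) ->
  (fun N => \int[P]_w Z N w ^+ 2 / N%:R) @ \oo --> s ->
  ((N%:R^-1)%:E * 'V_P[Z N])%E @[N --> \oo] --> s%:E /\
  ((N%:R^-1)%:E * 'E_P[(Z N ^+ 2)%R])%E @[N --> \oo] --> s%:E.
Proof.
move=> sZ ZB Zs.
have E2 N : 'E_P[(Z N ^+ 2)%R]%E = (\int[P]_w Z N w ^+ 2)%:E.
  rewrite unlock -(EFin_E_sqr (sZ N)); apply: eq_integral => w _.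
  by rewrite /= expr2.
have E1 N : 'E_P[Z N]%E = (\int[P]_w Z N w)%:E.
  by rewrite unlock fineK//; exact: integrable_fin_num (sqint_L1 (sZ N)).
split.
  have V N : ((N%:R^-1)%:E * 'V_P[Z N])%E =
      (\int[P]_w Z N w ^+ 2 / N%:R - (\int[P]_w Z N w) ^+ 2 / N%:R)%:E.
    rewrite varianceE ?sqint_Lfun// E2 E1 -EFin_expe -EFinB -EFinM.
    by congr EFin; rewrite mulrC mulrBl.
  under eq_fun do rewrite V.
  apply: cvg_EFin; first by near=> N.
  rewrite -[X in _ --> X]subr0; apply: seq_cvgB => //.
  apply: (cvg_squeeze0 (v := fun N : nat => B ^+ 2 / N%:R)); last exact: cvg_inv_nat.
  move=> N; rewrite normrM [X in _ * X]ger0_norm ?invr_ge0// ler_wpM2r ?invr_ge0//.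
  rewrite ger0_norm ?sqr_ge0// -[leLHS]real_normK ?num_real//.
  by rewrite lerXn2r ?nnegrE// (le_trans _ (ZB N)).
under eq_fun do rewrite E2 -EFinM mulrC.
by apply: cvg_EFin; first by near=> N.
Unshelve. all: by end_near. Qed.

End variance_and_second_moment.

(** * Nonconventional sums of square integrable functions *)

Section sums_of_samples.
Context d0 (Omega : measurableType d0) d (X : measurableType d) (R : realType).
Variables (P : probability Omega R) (mu : probability X R) (l : nat) (C : R).
Variable W : nat -> {mfun Omega >-> l.-tuple X}.
Hypothesis C_ge0 : 0 <= C.
Hypothesis W_rect : forall n (A : 'I_l -> set X), (forall a, measurable (A a)) ->
  fine (P (W n @^-1` rect A)) <= C * \prod_a fine (mu (A a)).
Local Notation nu := (product_power mu l).
Implicit Types F G : l.-tuple X -> R.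

Definition sample_sum F (N : nat) (w : Omega) : R := \sum_(0 <= n < N) F (W n w).

Lemma sqint_sample_sum F N : sqint nu F -> sqint P (sample_sum F N).
Proof.
by move=> sF; apply: sqint_sum => n; have [] := domination C_ge0 (W_rect n) sF.
Qed.

(** No mixing enters here: the samples are only dominated by the product measure, hence
    the factor [N ^ 2]. *)
Lemma sample_sum_mean_square F N : sqint nu F ->
  \int[P]_w sample_sum F N w ^+ 2 <= N%:R ^+ 2 * C * \int[nu]_x F x ^+ 2.
Proof.
move=> sF; set B := C * \int[nu]_x F x ^+ 2.
have sW n : sqint P (fun w => F (W n w)) by have [] := domination C_ge0 (W_rect n) sF.
have leW n : \int[P]_w F (W n w) ^+ 2 <= B.
  by have [] := domination C_ge0 (W_rect n) sF.
rewrite E_sqr_sum//.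
apply: (@le_trans _ _ (\sum_(0 <= i < N) \sum_(0 <= j < N) B)).
  apply: ler_sum => i _; apply: ler_sum => j _.
  apply: (@le_trans _ _
      (\int[P]_w (1 / 2 * (F (W i w) ^+ 2 + F (W j w) ^+ 2)))).
    apply: E_le; [exact: sqintM|by apply: L1Zl; apply: L1D; exact: sqint_sqr|].
    by move=> w; have := sqr_ge0 (F (W i w) - F (W j w)); rewrite !expr2; lra.
  rewrite E_Zl; last by apply: L1D; exact: sqint_sqr.
  rewrite E_D; [|exact: sqint_sqr..].
  by have := leW i; have := leW j; lra.
rewrite !sumr_const_nat !subn0 -mulrnA -[leLHS]mulr_natr natrM /B.
by rewrite le_eqVlt; apply/orP; left; apply/eqP; ring.
Qed.

Lemma sample_sumB F G N w :
  sample_sum F N w - sample_sum G N w = sample_sum (fun x => F x - G x) N w.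
Proof. by rewrite /sample_sum sumrB. Qed.

End sums_of_samples.

Section progression_samples.
Context d (Omega : measurableType d) d' (X : measurableType d') (R : realType).
Variables (P : probability Omega R) (l : nat).

Lemma measurable_tuple_of (xi : 'I_l -> {mfun Omega >-> X}) :
  measurable_fun [set: Omega] (fun w => [tuple xi i w | i < l]).
Proof.
apply/measurable_fun_tnthP => i.
rewrite (_ : _ \o _ = xi i)//.
by apply/funext => w /=; rewrite tnth_mktuple.
Qed.

Definition tuple_of (xi : 'I_l -> {mfun Omega >-> X}) (w : Omega) : l.-tuple X :=
  [tuple xi i w | i < l].

HB.instance Definition _ (xi : 'I_l -> {mfun Omega >-> X}) :=
  isMeasurableFun.Build _ _ _ _ (tuple_of xi) (measurable_tuple_of xi).

End progression_samples.

Section main.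
Context d (Omega : measurableType d) d' (X : measurableType d') (R : realType).
Variables (P : probability Omega R) (xi : nat -> {RV P >-> X}).
Variables (mu : probability X R) (l : nat) (c th : R).
Hypotheses (c_ge0 : 0 <= c) (th0 : 0 < th) (th1 : th < 1).
Hypothesis mp : mixing_process xi mu (rate l c th).
Hypothesis l_gt0 : (0 < l)%N.
Local Notation nu := (product_power mu l).
Local Notation T := (l.-tuple X).
Local Notation C := (domination_constant l c).
Implicit Types F G : T -> R.

Let gth := (1 - th)^-1.
Let gth_ge0 : 0 <= gth. Proof. by rewrite invr_ge0 subr_ge0 ltW. Qed.

Let W (n : nat) : {mfun Omega >-> T} := tuple_of (fun i : 'I_l => xi (i.+1 * n.+1)%N).

Let W_rect n (A : 'I_l -> set X) : (forall a, measurable (A a)) ->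
  fine (P (W n @^-1` rect A)) <= C * \prod_a fine (mu (A a)).
Proof.
move=> mA; have -> : W n @^-1` rect A =
    event xi predT (fun a : 'I_l => a.+1 * n.+1)%N A.
  apply/seteqP; split => w /=.
    by move=> H a _; have := H a; rewrite tnth_mktuple.
  by move=> H a; rewrite tnth_mktuple; exact: H.
exact: (progression_domination c_ge0 th0 th1 mp).
Qed.

Lemma nonconventional_sumE F N w : nonconventional_sum F xi N w = sample_sum W F N w.
Proof. by rewrite /nonconventional_sum big_add1; apply: eq_bigr. Qed.

Let V N F : Omega -> R := nonconventional_sum F xi N.

Let V_sqint N F : sqint nu F -> sqint P (V N F).
Proof.
move=> sF; rewrite (_ : V N F = sample_sum W F N).
  exact: (sqint_sample_sum (domination_constant_ge0 l c_ge0) W_rect).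
by apply/funext => w; exact: nonconventional_sumE.
Qed.

Let V_continuous N F G : sqint nu F -> discretized G ->
  \int[P]_w (V N F w - V N G w) ^+ 2 <= (N%:R ^+ 2 * C) * \int[nu]_x (F x - G x) ^+ 2.
Proof.
move=> sF dG; have sFG := sqintB sF (sqint_discretized nu dG).
apply: le_trans (sample_sum_mean_square (domination_constant_ge0 l c_ge0) W_rect N sFG).
rewrite le_eqVlt; apply/orP; left; apply/eqP; apply: eq_Rintegral => w _.
by rewrite /V !nonconventional_sumE sample_sumB.
Qed.

Let V_subtract N G G' w : discretized G -> discretized G' ->
  V N (fun x => G x - G' x) w = V N G w - V N G' w.
Proof. by move=> _ _; rewrite /V !nonconventional_sumE sample_sumB. Qed.

Lemma nonconventional_sum_coding (I : finType) (g : X -> I)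
    (phi : {ffun 'I_l -> I} -> R) G N w : (forall x, G x = phi (coding g x)) ->
  V N G w = partial_sum xi g phi N w.
Proof.
move=> GE; apply: eq_bigr => n _; rewrite GE; congr phi.
by apply/ffunP => a; rewrite !ffunE tnth_mktuple.
Qed.

Let normsqE (I : finType) (g : X -> I) (phi : {ffun 'I_l -> I} -> R) G :
  (forall i, measurable (g @^-1` [set i])) -> (forall x, G x = phi (coding g x)) ->
  normsq (state_mass mu g) phi = \int[nu]_x G x ^+ 2.
Proof.
move=> mg GE; rewrite /normsq -(E_product_power_coding mu mg (fun y => phi y ^+ 2)).
by apply: eq_Rintegral => x _; rewrite GE.
Qed.

Let weighted_sumE (I : finType) (g : X -> I) (phi : {ffun 'I_l -> I} -> R) G :
  (forall i, measurable (g @^-1` [set i])) -> (forall x, G x = phi (coding g x)) ->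
  \int[nu]_x G x = 0 -> \sum_x weight (state_mass mu g) x * phi x = 0.
Proof.
move=> mg GE G0; transitivity (\int[nu]_x G x); last exact: G0.
transitivity (\int[nu]_x phi (coding g x)).
  by rewrite (E_product_power_coding mu mg phi).
by apply: eq_Rintegral => x _; rewrite GE.
Qed.

Let BV := l%:R ^+ 2 * covariance_constant l c * (3 * gth).
Let DV := l%:R * (c * (4 * C + 1) * gth).

Let V_variance N G : centered_discretized mu G ->
  \int[P]_w V N G w ^+ 2 <= BV * \int[nu]_x G x ^+ 2 * N%:R.
Proof.
move=> [[I [g [phi [mg GE]]]] G0].
rewrite -(normsqE mg GE).
have := partial_sum_variance_bound c_ge0 th0 th1 mp mg (weighted_sumE mg GE G0) N.
apply: le_trans; rewrite le_eqVlt; apply/orP; left; apply/eqP.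
by apply: eq_Rintegral => w _; rewrite (nonconventional_sum_coding _ _ GE).
Qed.

Let V_mean N G : centered_discretized mu G ->
  `|\int[P]_w V N G w| <= DV * (\int[nu]_x G x ^+ 2 + 1).
Proof.
move=> [[I [g [phi [mg GE]]]] G0].
rewrite -(normsqE mg GE).
have := partial_sum_mean_bound c_ge0 th0 th1 mp mg (weighted_sumE mg GE G0) N.
apply: le_trans; rewrite le_eqVlt; apply/orP; left; apply/eqP; congr (`|_|).
by apply: eq_Rintegral => w _; rewrite (nonconventional_sum_coding _ _ GE).
Qed.

Let BV_ge0 : 0 <= BV.
Proof.
apply: mulr_ge0; last by apply: mulr_ge0.
by apply: mulr_ge0; [exact: sqr_ge0|exact: covariance_constant_ge0].
Qed.

Let DV_ge0 : 0 <= DV.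
Proof.
apply: mulr_ge0 => //; apply: mulr_ge0 => //; apply: mulr_ge0 => //.
by apply: addr_ge0 => //; apply: mulr_ge0 => //; exact: domination_constant_ge0.
Qed.

Definition decoupled_copies d1 (Omega1 : measurableType d1) (P1 : probability Omega1 R)
    (eta : 'I_l -> nat -> {RV P1 >-> X}) : Prop :=
  (forall i, same_law P1 (eta i) P xi) /\ independent_processes P1 eta.

(** The limit for the copies is chosen before the copies, so that one function of [G]
    serves for all of them. *)
Lemma discretized_limits G : centered_discretized mu G -> exists sgs : R * R,
  [/\ (fun N => \int[P]_w nonconventional_sum G xi N w ^+ 2 / N%:R) @ \oo --> sgs.1,
      sgs.2 / l%:R <= sgs.1 &
      forall d1 (Omega1 : measurableType d1) (P1 : probability Omega1 R)
        (eta : 'I_l -> nat -> {RV P1 >-> X}), decoupled_copies eta ->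
      (fun N => \int[P1]_w decoupled_sum (last_centered mu G) eta N w ^+ 2 / N%:R)
        @ \oo --> sgs.2].
Proof.
move=> [[I [g [phi [mg GE]]]] G0].
have [sg [s [H1 H2 H3 _]]] :=
  partial_sum_limits c_ge0 th0 th1 mp l_gt0 mg (weighted_sumE mg GE G0).
exists (sg, s); split => //=.
  apply: eq_cvgn H1 => N; congr (_ / _); apply: eq_Rintegral => w _.
  by rewrite -(nonconventional_sum_coding _ _ GE).
move=> d1 Omega1 P1 eta [law indep]; apply: eq_cvgn H2 => N.
rewrite -(copy_sum_variance mp law indep mg); congr (_ / _).
apply: eq_Rintegral => w _; congr (_ ^+ 2); apply: eq_bigr => n _.
rewrite (last_centered_coding mu l_gt0 mg GE); congr component.
by apply/ffunP => a; rewrite !ffunE tnth_mktuple.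
Qed.

Section copies.
Context d1 (Omega1 : measurableType d1) (P1 : probability Omega1 R).
Variable eta : 'I_l -> nat -> {RV P1 >-> X}.
Hypothesis copies : decoupled_copies eta.

Let law := copies.1.
Let indep := copies.2.

Let W1 (n : nat) : {mfun Omega1 >-> T} :=
  tuple_of (fun i : 'I_l => eta i (i.+1 * n.+1)%N).

Let copy_rect n (A : 'I_l -> set X) : (forall a, measurable (A a)) ->
  fine (P1 [set w | forall a : 'I_l, A a (eta a (a.+1 * n)%N w)]) =
  \prod_a fine (mu (A a)).
Proof.
move=> mA; have -> : [set w | forall a : 'I_l, A a (eta a (a.+1 * n)%N w)] =
   [set w | forall a : 'I_l, A a (eta a (a.+1 * n)%N w) /\ A a (eta a (a.+1 * n)%N w)].
  by apply/seteqP; split => w H a; [split; exact: H|case: (H a)].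
rewrite (copies_independent indep (fun a : 'I_l => (a.+1 * n)%N)
  (fun a : 'I_l => (a.+1 * n)%N) mA mA).
transitivity (fine (\prod_(a < l) (fine (mu (A a)))%:E)%E); last first.
  by rewrite -(big_morph EFin (@EFinM R) (erefl _)).
congr fine; apply: eq_bigr => a _.
by rewrite (copy_pair_law law)// setIid (process_law mp)// fineK// fin_num_measure.
Qed.

Let W1_rect n (A : 'I_l -> set X) : (forall a, measurable (A a)) ->
  fine (P1 (W1 n @^-1` rect A)) <= 1 * \prod_a fine (mu (A a)).
Proof.
move=> mA; rewrite mul1r -(copy_rect n.+1 mA) le_eqVlt; apply/orP; left; apply/eqP.
congr fine; congr (P1 _); apply/seteqP; split => w /= H a.
  by have := H a; rewrite tnth_mktuple.
by rewrite tnth_mktuple.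
Qed.

Let U N F : Omega1 -> R := decoupled_sum (last_centered mu F) eta N.

Let UE N F w : U N F w = sample_sum W1 (last_centered mu F) N w.
Proof. by rewrite /U /decoupled_sum big_add1. Qed.

Let zero_discretized : discretized (fun _ : T => 0 : R).
Proof. exact: discretized_cst. Qed.

Let last_centered0 x : last_centered mu (fun _ : T => 0 : R) x = 0.
Proof. by rewrite /last_centered E_cst subrr. Qed.

Let sqint_last_centered F : sqint nu F -> sqint nu (last_centered mu F).
Proof.
move=> sF; have [s _] := last_centered_mean_square l_gt0 sF zero_discretized.
by move: s; congr sqint; apply/funext => x; rewrite last_centered0 subr0.
Qed.

Let U_sqint N F : sqint nu F -> sqint P1 (U N F).
Proof.
move=> sF; rewrite (_ : U N F = sample_sum W1 (last_centered mu F) N).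
  by apply: (sqint_sample_sum ler01 W1_rect); exact: sqint_last_centered.
by apply/funext => w; exact: UE.
Qed.

Let U_continuous N F G : sqint nu F -> discretized G ->
  \int[P1]_w (U N F w - U N G w) ^+ 2 <= (N%:R ^+ 2 * 4) * \int[nu]_x (F x - G x) ^+ 2.
Proof.
move=> sF dG; have [s le] := last_centered_mean_square l_gt0 sF dG.
apply: (@le_trans _ _ (\int[P1]_w sample_sum W1
   (fun x => last_centered mu F x - last_centered mu G x) N w ^+ 2)).
  rewrite le_eqVlt; apply/orP; left; apply/eqP; apply: eq_Rintegral => w _.
  by rewrite !UE sample_sumB.
apply: le_trans (sample_sum_mean_square ler01 W1_rect N s) _.
by rewrite mulr1 -mulrA ler_wpM2l// sqr_ge0.
Qed.

Let U_subtract N G G' w : discretized G -> discretized G' ->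
  U N (fun x => G x - G' x) w = U N G w - U N G' w.
Proof.
move=> dG dG'; rewrite !UE sample_sumB; apply: eq_bigr => n _.
rewrite /last_centered E_B; [by ring|exact: (section_discretized mu l_gt0)..].
Qed.

Let U_coding (I : finType) (g : X -> I) (phi : {ffun 'I_l -> I} -> R) G N w :
  (forall i, measurable (g @^-1` [set i])) -> (forall x, G x = phi (coding g x)) ->
  U N G w = \sum_(1 <= n < N.+1)
    component (state_mass mu g) l.-1 phi (copy_states eta g n w).
Proof.
move=> mg GE; apply: eq_bigr => n _.
rewrite (last_centered_coding mu l_gt0 mg GE); congr component.
by apply/ffunP => a; rewrite !ffunE tnth_mktuple.
Qed.

Let BU := 4 * covariance_constant l c * gth.

Let U_variance N G : centered_discretized mu G ->
  \int[P1]_w U N G w ^+ 2 <= BU * \int[nu]_x G x ^+ 2 * N%:R.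
Proof.
move=> [[I [g [phi [mg GE]]]] G0].
have [sg [s [_ _ _ H]]] :=
  partial_sum_limits c_ge0 th0 th1 mp l_gt0 mg (weighted_sumE mg GE G0).
rewrite -(normsqE mg GE); apply: le_trans (H N); apply: le_trans (ler_norm _).
rewrite -(copy_sum_variance mp law indep mg) le_eqVlt; apply/orP; left; apply/eqP.
by apply: eq_Rintegral => w _; rewrite (U_coding N w mg GE).
Qed.

Let U_mean N G : centered_discretized mu G ->
  `|\int[P1]_w U N G w| <= 0 * (\int[nu]_x G x ^+ 2 + 1).
Proof.
move=> [[I [g [phi [mg GE]]]] G0]; rewrite mul0r normr_le0.
have fc n := finite_valued_copy_states eta mg n.
set f := component (state_mass mu g) l.-1 phi.
transitivity (\int[P1]_w (\sum_(1 <= n < N.+1) f (copy_states eta g n w)) == 0).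
  by congr (_ == _); apply: eq_Rintegral => w _; rewrite (U_coding N w mg GE).
apply/eqP; rewrite E_sum; last by move=> n; exact: (finite_valued_L1 P1 f (fc n)).
rewrite big1// => n _; rewrite (E_finite_valued P1 f (fc n)).
pose last := Ordinal (etrans (ltn_predL l) l_gt0).
apply: etrans (centered_sum0 (state_mass_sum1 mu mg)
  (centered_component (state_mass_sum1 mu mg) last phi)).
apply: eq_bigr => x _; rewrite mulrC; congr (_ * _).
rewrite /mass /weight -(copy_rect n (A := fun a => g @^-1` [set x a])) //.
congr fine; congr (P1 _); apply/seteqP; split => w /=.
  by move=> <- a; rewrite ffunE.
by move=> H; apply/ffunP => a; rewrite ffunE; exact: H.
Qed.

Let BU_ge0 : 0 <= BU.
Proof.
by apply: mulr_ge0 => //; apply: mulr_ge0 => //; exact: covariance_constant_ge0.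
Qed.

Lemma decoupled_sum_limit F (v : (T -> R) -> R) :
  sqint nu F -> \int[nu]_x F x = 0 ->
  (forall G, centered_discretized mu G ->
    (fun N => \int[P1]_w U N G w ^+ 2 / N%:R) @ \oo --> v G) ->
  exists s : R, [/\
    ((N%:R^-1)%:E * 'V_P1[U N F])%E @[N --> \oo] --> s%:E,
    ((N%:R^-1)%:E * 'E_P1[(U N F ^+ 2)%R])%E @[N --> \oo] --> s%:E,
    0 <= s &
    forall e : R, 0 < e -> exists2 de : R, 0 < de &
      forall G, centered_discretized mu G -> \int[nu]_x (F x - G x) ^+ 2 <= de ->
      `|s - v G| <= e].
Proof.
move=> sF F0 vG.
have c0 N : 0 <= N%:R ^+ 2 * 4 :> R by rewrite mulr_ge0// sqr_ge0.
have [s [Hs Hv]] := variance_limit BU_ge0 c0 U_sqint U_continuous U_subtract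
  U_variance sF F0 vG.
have mean := mean_bound (lexx 0) c0 U_sqint U_continuous U_mean sF F0.
have [h1 h2] := variance_second_moment_cvg (fun N => U_sqint N sF) mean Hs.
exists s; split => //; apply: (cvgr_to_ge Hs); near=> N.
by rewrite mulr_ge0 ?invr_ge0// E_sqr_ge0.
Unshelve. all: by end_near. Qed.

End copies.

(** Both limits come from [variance_limit], and the inequality between them passes to
    the limit along discretized approximants of [F], by the continuity of both limits. *)
Theorem nonconventional_variance F : sqint nu F -> \int[nu]_x F x = 0 ->
  exists sigma2 : R,
    [/\ ((N%:R^-1)%:E * 'V_P[nonconventional_sum F xi N])%E @[N --> \oo] --> sigma2%:E,
        ((N%:R^-1)%:E * 'E_P[(nonconventional_sum F xi N ^+ 2)%R])%E
          @[N --> \oo] --> sigma2%:E &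
        forall d1 (Omega1 : measurableType d1) (P1 : probability Omega1 R)
          (eta : 'I_l -> nat -> {RV P1 >-> X}), decoupled_copies eta ->
          exists s2 : R,
            [/\ ((N%:R^-1)%:E * 'V_P1[decoupled_sum (last_centered mu F) eta N])%E
                  @[N --> \oo] --> s2%:E,
                ((N%:R^-1)%:E * 'E_P1[(decoupled_sum (last_centered mu F) eta N ^+ 2)%R])%E
                  @[N --> \oo] --> s2%:E,
                0 <= s2 & s2 / l%:R <= sigma2]].
Proof.
move=> sF F0.
have /choice[v Hv] : forall G, exists sgs : R * R, centered_discretized mu G ->
  [/\ (fun N => \int[P]_w V N G w ^+ 2 / N%:R) @ \oo --> sgs.1,
      sgs.2 / l%:R <= sgs.1 &
      forall d1 (Omega1 : measurableType d1) (P1 : probability Omega1 R)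
        (eta : 'I_l -> nat -> {RV P1 >-> X}), decoupled_copies eta ->
      (fun N => \int[P1]_w decoupled_sum (last_centered mu G) eta N w ^+ 2 / N%:R)
        @ \oo --> sgs.2].
  move=> G; have [cG|ncG] := pselect (centered_discretized mu G).
    by have [sgs H] := discretized_limits cG; exists sgs.
  by exists (0, 0).
have c0 N : 0 <= N%:R ^+ 2 * C.
  by rewrite mulr_ge0 ?sqr_ge0// domination_constant_ge0.
have vS G : centered_discretized mu G ->
    (fun N => \int[P]_w V N G w ^+ 2 / N%:R) @ \oo --> (v G).1.
  by move=> cG; have [] := Hv G cG.
have [sg [Hs Hsv]] := variance_limit (v := fun G => (v G).1)
  BV_ge0 c0 V_sqint V_continuous V_subtract V_variance sF F0 vS.
have mean := mean_bound DV_ge0 c0 V_sqint V_continuous V_mean sF F0.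
have [h1 h2] := variance_second_moment_cvg (fun N => V_sqint N sF) mean Hs.
exists sg; split => // d1 Omega1 P1 eta copies.
have vU G : centered_discretized mu G ->
    (fun N => \int[P1]_w decoupled_sum (last_centered mu G) eta N w ^+ 2 / N%:R)
      @ \oo --> (v G).2.
  by move=> cG; have [_ _ H] := Hv G cG; exact: H.
have [s [u1 u2 s0 Hu]] := decoupled_sum_limit copies (v := fun G => (v G).2) sF F0 vU.
exists s; split => //.
apply/ler_addgt0Pr => e e0; have e20 : 0 < e / 2 by rewrite divr_gt0.
have [de1 de10 D1] := Hsv _ e20; have [de2 de20 D2] := Hu _ e20.
have de0 : 0 < Num.min de1 de2 by rewrite lt_min de10.
have [G cG] := centered_approximation sF F0 de0.
rewrite le_min => /andP[FG1 FG2].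
have i1 := D1 G cG FG1; have i2 := D2 G cG FG2.
have [_ i3 _] := Hv G cG.
have lR : 0 < l%:R :> R by rewrite ltr0n.
have l1 : (l%:R)^-1 <= 1 :> R by rewrite invf_le1// ler1n.
have i4 : (s - (v G).2) / l%:R <= e / 2.
  move: i2; rewrite ler_norml => /andP[_ i2].
  apply: (@le_trans _ _ (e / 2 / l%:R)); first by rewrite ler_wpM2r// invr_ge0 ltW.
  by rewrite ler_piMr// ltW.
move: i1; rewrite ler_norml => /andP[i1 _].
move: i4; rewrite mulrBl; lra.
Qed.

End main.

(** * Exponentially mixing Markov chains *)

Theorem theorem2p3 (R : realType) (X : ptopologicalType)
  (polishX : polish R X)
  (d : measure_display) (Omega : measurableType d) (P : probability Omega R)
  (mu : probability (borel X) R) (p : R.-pker (borel X) ~> (borel X))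
  (xi : nat -> {RV P >-> borel X})
  (markov_xi : stationary_markov_chain xi p mu)
  (l : nat) (l_ge1 : (1 <= l)%N)
  (F : l.-tuple (borel X) -> R)
  (F_borel : measurable_fun setT F)
  (F_sqr : (\int[product_power mu l]_x ((F x) ^+ 2)%:E < +oo)%E)
  (F_mean0 : (\int[product_power mu l]_x (F x)%:E = 0)%E)
  (alpha : R) (alpha_gt0 : 0 < alpha)
  (psi_le : forall m : nat, (1 <= m)%N ->
    (psi_mixing P xi m <= (alpha^-1 * expR (- (alpha * m%:R)))%:E)%E) :
  let S := nonconventional_sum F xi in
  exists sigma2 : R,
    [/\ ((N%:R^-1)%:E * 'V_P[S N])%E @[N --> \oo] --> sigma2%:E,
        ((N%:R^-1)%:E * 'E_P[(S N ^+ 2)%R])%E @[N --> \oo] --> sigma2%:E &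
        forall (d' : measure_display) (Omega' : measurableType d')
          (P' : probability Omega' R)
          (eta : 'I_l -> nat -> {RV P' >-> borel X}),
          (forall i, same_law P' (eta i) P xi) ->
          independent_processes P' eta ->
          let U := decoupled_sum (last_centered mu F) eta in
          exists s2 : R,
            [/\ ((N%:R^-1)%:E * 'V_P'[U N])%E @[N --> \oo] --> s2%:E,
                ((N%:R^-1)%:E * 'E_P'[(U N ^+ 2)%R])%E @[N --> \oo] --> s2%:E &
                sigma2 >= (2 * l%:R)^-1 * s2]].

Proof.
have a1 : 0 < alpha / l.+1%:R by rewrite divr_gt0.
pose th := expR (- (alpha / l.+1%:R)).
have th1 : th < 1 by rewrite expR_lt1 oppr_lt0.
have c_ge0 : 0 <= alpha^-1 by rewrite invr_ge0 ltW.
(* with this th, th ^+ (l.+1 * m) is the exponential of - alpha m *)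
have mp : mixing_process xi mu (rate l alpha^-1 th).
  apply: (markov_mixing_process markov_xi) => m m1.
  suff -> : rate l alpha^-1 th m = alpha^-1 * expR (- (alpha * m%:R)).
    exact: psi_le.
  rewrite /rate /th -expRM_natl; congr (_ * expR _).
  rewrite natrM mulrN mulrAC; congr (- (_ * _)).
  by rewrite mulrC divfK// pnatr_eq0.
have sF : sqint (product_power mu l) F by split.
have F0 : \int[product_power mu l]_x F x = 0 by rewrite /Rintegral F_mean0.
have [sigma2 [V2 E2 copies]] := nonconventional_variance c_ge0 (expR_gt0 _) th1 mp
  l_ge1 sF F0.
exists sigma2; split => // d' Omega' P' eta law indep.
have [s2 [VU EU s2_ge0 le]] := copies _ _ _ _ (conj law indep).
exists s2; split => //; apply: le_trans le.
rewrite invfM -mulrA [leRHS]mulrC ler_piMl ?mulr_ge0 ?invr_ge0//.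
by rewrite invf_le1// ler1n.
Qed.
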